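(* Let $E$ be an elliptic curve over a finite field $\mathbb{F}_q$ of characteristic $p$, with $q = p^m$, and let $a$ be the trace of the Frobenius endomorphism acting on $E$ over $\mathbb{F}_q$. Then the Mertens conjecture for $E/\mathbb{F}_q$ (i.e. the statement that $|M_{E/\mathbb{F}_q}(X)| \le q^{X/2}$ for all sufficiently large positive integers $X$) is true if and only if $q$ and $a$ satisfy precisely one of the following conditions: (1) $a = 2$, where either $m$ is arbitrary and $p \neq 2$, or $m = 1$ and $p = 2$; (2) $a = \sqrt{q}$, where $m$ is even and $p \not\equiv 1 \pmod{3}$; (3) $a = 0$, where either $m$ is even and $p \not\equiv 1 \pmod 4$, or $m$ is odd. Moreover, in all these cases, $|M_{E/\mathbb{F}_q}(X)| \le q^{X/2}$ for all integers $X \ge 1$, and for every $\varepsilon > 0$ there exist infinitely many positive integers $X$ (depending on $q$ and $a$) for which $|M_{E/\mathbb{F}_q}(X)| > (1-\varepsilon) q^{X/2}$.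
   Context: For an elliptic curve $E$ over $\mathbb{F}_q$, the trace of Frobenius is the integer $a = q + 1 - \#E(\mathbb{F}_q)$. A prime divisor of $E$ is a closed point (a Galois orbit of $\overline{\mathbb{F}_q}$-points), and effective divisors are finite formal sums of prime divisors with nonnegative integer coefficients; $\deg$ denotes the degree of a divisor (over $\mathbb{F}_q$). For an effective divisor $N$ of $E$, the Möbius function is $\mu_{E/\mathbb{F}_q}(N) = 1$ if $N$ is the zero divisor, $(-1)^t$ if $N$ is the sum of $t$ distinct prime divisors, and $0$ if some prime divisor occurs in $N$ with multiplicity at least $2$. For a positive integer $X$, $M_{E/\mathbb{F}_q}(X) = \sum_{N \text{ effective},\ 0 \le \deg(N) \le X-1} \mu_{E/\mathbb{F}_q}(N)$. *)

(* Defs.v *)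
From HB Require Import structures.
From mathcomp Require Import all_boot all_order all_algebra.
From mathcomp Require Import finmap.
From mathcomp Require Import all_classical all_reals all_analysis.
Import Order.TTheory GRing.Theory Num.Theory.

Set Implicit Arguments.
Unset Strict Implicit.
Unset Printing Implicit Defensive.

Local Open Scope classical_set_scope.
Local Open Scope ring_scope.

(* Coefficients of y^2 + a1 x y + a3 y = x^3 + a2 x^2 + a4 x + a6. *)
Record weierstrass (F : fieldType) := Weierstrass {
  wa1 : F; wa2 : F; wa3 : F; wa4 : F; wa6 : F }.

(* The usual discriminant, meaningful in every characteristic (2 and 3
   included). *)
Definition wdisc (F : fieldType) (W : weierstrass F) : F :=
  let: Weierstrass a1 a2 a3 a4 a6 := W in
  let b2 := a1 ^+ 2 + 4%:R * a2 in
  let b4 := 2%:R * a4 + a1 * a3 in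
  let b6 := a3 ^+ 2 + 4%:R * a6 in
  let b8 := a1 ^+ 2 * a6 + 4%:R * a2 * a6 - a1 * a3 * a4 + a2 * a3 ^+ 2
            - a4 ^+ 2 in
  - b2 ^+ 2 * b8 - 8%:R * b4 ^+ 3 - 27%:R * b6 ^+ 2 + 9%:R * b2 * b4 * b6.

Record elliptic_curve (F : fieldType) := EllipticCurve {
  ec_weierstrass :> weierstrass F;
  ec_smooth : wdisc ec_weierstrass != 0 }.

(* Points of E over an extension iota : F -> L; None is the point at infinity,
   the only point of the projective curve outside the affine chart. *)
Definition on_curve (F L : fieldType) (iota : {rmorphism F -> L})
    (E : elliptic_curve F) : pred (option (L * L)) := fun P =>
  if P is Some (x, y) then
    y ^+ 2 + iota (wa1 E) * x * y + iota (wa3 E) * y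
    == x ^+ 3 + iota (wa2 E) * x ^+ 2 + iota (wa4 E) * x + iota (wa6 E)
  else true.

Definition ec_trace (F : finFieldType) (E : elliptic_curve F) : int :=
  #|F|%:Z + 1 - #|on_curve idfun E|%:Z.

Section ClosedPoints.
Variables (F K : fieldType) (iota : {rmorphism F -> K}) (E : elliptic_curve F).

(* Orbit of a K-point under Aut(K / F), the Galois group when K is an algebraic
   closure of a finite field F. *)
Definition galois_orbit (P : option (K * K)) : set (option (K * K)) :=
  [set Q | exists g : {rmorphism K -> K},
     [/\ bijective g, forall c : F, g (iota c) = iota c
       & Q = omap (fun xy => (g xy.1, g xy.2)) P]].

Definition closed_points : set (set (option (K * K))) :=
  [set galois_orbit P | P in [set P | on_curve iota E P]].

Definition effective_divisor := {fsfun closed_points -> nat with 0%N}.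

(* For F finite and K algebraic over F, orbits are finite, and as F is perfect
   the degree of the residue field over F is the size of the orbit. *)
Definition closed_point_deg (C : closed_points) : nat :=
  #|` fset_set (val C)|%fset.

Definition divisor_deg (N : effective_divisor) : nat :=
  (\sum_(C <- finsupp N) N C * closed_point_deg C)%N.

Definition ec_mobius (N : effective_divisor) : int :=
  if `[< exists C : closed_points, (2 <= N C)%N >] then 0
  else (-1) ^+ #|` finsupp N|%fset.

(* \sum over a set is meaningful only for finite support: over a finite field
   there are finitely many effective divisors of bounded degree. *)
Definition ec_mertens (X : nat) : int :=
  \sum_(N \in [set N : effective_divisor | (divisor_deg N <= X - 1)%N])
    ec_mobius N.

End ClosedPoints.

Definition mertens_bound (R : realType) (F : finFieldType) (K : fieldType)
    (iota : {rmorphism F -> K}) (E : elliptic_curve F) (X : nat) : Prop :=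
  `|(ec_mertens iota E X)%:~R : R| <= (#|F|%:R : R) `^ (X%:R / 2%:R).

Definition mertens_conjecture (R : realType) (F : finFieldType) (K : fieldType)
    (iota : {rmorphism F -> K}) (E : elliptic_curve F) : Prop :=
  \forall X \near \oo, mertens_bound R iota E X.

Definition mertens_cond1 (p m : nat) (a : int) : Prop :=
  a = 2 /\ (p <> 2%N \/ (m = 1%N /\ p = 2%N)).

Definition mertens_cond2 (R : realType) (p m : nat) (a : int) : Prop :=
  [/\ a%:~R = Num.sqrt ((p ^ m)%:R : R), ~~ odd m & p <> 1 %[mod 3]].

Definition mertens_cond3 (p m : nat) (a : int) : Prop :=
  a = 0 /\ ((~~ odd m /\ p <> 1 %[mod 4]) \/ odd m).

Definition exactly_one (A B C : Prop) : Prop :=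
  [\/ [/\ A, ~ B & ~ C], [/\ ~ A, B & ~ C] | [/\ ~ A, ~ B & C]].

(* Main.v *)
(* An affine effective divisor of E corresponds, in Mumford's notation, to a
   triple (c, g, t) of polynomials with g dividing t^2 + b t - f.  The symmetry
   exchanging g with (t^2 + b t - f) / g counts the triples of each degree, that
   is, it gives the zeta function of the affine curve.  Its inverse is the
   generating function of M(X), whence M(X + 2) = a M(X + 1) - q M(X).

   Normalised by q^(X/2), this sequence is a sinusoid A cos(X theta + psi) with
   2 cos theta = a / sqrt q and A^2 = 4 (q + 1 - a) / (4 q - a^2).  If theta is
   an irrational multiple of pi, the values are dense in [-A, A], and A <= 1
   forces a = 2.  Otherwise q divides a^2, the sequence has period dividing 12
   up to sign, and only a = 0 and a = sqrt q (or a = 2) remain.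

   What is left is to exclude the values of a that no curve attains.  In
   characteristic 2 with a = 2, an ordinary curve has an even number of points,
   and for a supersingular one a is a sum of additive characters whose square q
   divides, so q <= 4.  For p >= 5 and p | a, the Hasse invariant vanishes, so E
   has no p-torsion and x([p]P) = d^-1 (x(P)^(p^2) + c); hence, for even m, the
   Frobenius acts on the abscissas of the 2-torsion points by an affine map.
   Comparing with the parity of #E(F_q), the abscissas are permuted by a
   transposition when a = 0 and p = 1 mod 4, so that one of them is 0 and j = 1728,
   and by a 3-cycle when a = sqrt q and p = 1 mod 3, so that j = 0.  Both
   contradict the explicit Hasse invariant. *)

Require Import Defs.
From HB Require Import structures.
From mathcomp Require Import all_boot all_order all_algebra all_field.
From mathcomp Require Import ring lra zify.
Import Order.TTheory GRing.Theory Num.Theory.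
Set Implicit Arguments.
Unset Strict Implicit.
Unset Printing Implicit Defensive.
Local Open Scope ring_scope.

(** * Counting Mumford triples *)

(** The triples are counted over F_q, whereas closed points are Galois orbits over an algebraic
    closure. The bridge is uniqueness: over the closure a divisor determines its triple, so a
    Frobenius-stable divisor has a Frobenius-stable triple, which descends to F_q. The point at
    infinity stays outside the triples. It contributes the Euler factor 1 - u, which is cancelled by
    the summation over all degrees below X; this is why M itself has the inverse of the affine zeta
    function as generating function. Power series are replaced by finite products over the closed
    points of degree at most n + 1, compared up to degree n. The bound on the trace that enters is a
    <= q, which holds since E has a point at infinity; for a^2 >= 4 q the recurrence itself makes
    |M(X)| exceed q^(X/2) for arbitrarily large X. Associativity of the group law comes from graphs
    of polynomials of degree at most 2 through three points: such a configuration does not depend on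
    the order of the points. *)

Section PolyLists.
Variable F : finFieldType.
Local Notation q := #|F|.

Definition polysn k : seq {poly F} := [seq rVpoly v | v : 'rV[F]_k].

Lemma mem_polysn k p : (p \in polysn k) = (size p <= k)%N.
Proof.
apply/mapP/idP => [[v _ ->]|hp].
  by rewrite /rVpoly; exact: size_poly.
by exists (poly_rV p); rewrite ?mem_enum // poly_rV_K.
Qed.

Lemma uniq_polysn k : uniq (polysn k).
Proof. by rewrite map_inj_uniq ?enum_uniq //; apply: can_inj (@rVpolyK _ _). Qed.

Lemma size_polysn k : size (polysn k) = (q ^ k)%N.
Proof. by rewrite size_map -cardE card_mx mul1n. Qed.

Definition monics k : seq {poly F} := [seq 'X^k + p | p <- polysn k].

Lemma mem_monics k p : (p \in monics k) = (p \is monic) && (size p == k.+1).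
Proof.
apply/mapP/andP => [[r]|[mp /eqP sp]].
  rewrite mem_polysn => hr ->.
  have s : size ('X^k + r) = k.+1 by rewrite size_polyDl size_polyXn // ltnS.
  by rewrite s monicE lead_coefDl ?lead_coefXn ?eqxx // size_polyXn ltnS.
exists (p - 'X^k); last by rewrite addrC subrK.
rewrite mem_polysn; apply/leq_sizeP => j; rewrite leq_eqVlt coefB coefXn.
case/predU1P => [<-|hj].
  by move: mp; rewrite eqxx monicE lead_coefE sp /= => /eqP ->; rewrite subrr.
by rewrite nth_default ?sp // gtn_eqF // subr0.
Qed.

Lemma uniq_monics k : uniq (monics k).
Proof. by rewrite map_inj_uniq ?uniq_polysn //; apply: addrI. Qed.

Lemma size_monics k : size (monics k) = (q ^ k)%N.
Proof. by rewrite size_map size_polysn. Qed.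

End PolyLists.

Lemma size_bij (T U : eqType) (s : seq T) (s' : seq U) (f : T -> U) (g : U -> T) :
  uniq s -> uniq s' ->
  {in s, forall x, f x \in s' /\ g (f x) = x} ->
  {in s', forall y, g y \in s /\ f (g y) = y} -> size s = size s'.
Proof.
move=> us us' hf hg; apply/eqP; rewrite eqn_leq; apply/andP; split.
  rewrite -(size_map f); apply: uniq_leq_size.
    by rewrite map_inj_in_uniq // => x y /hf[_ {2}<-] /hf[_ {2}<-] ->.
  by move=> _ /mapP[x /hf[? _] ->].
rewrite -(size_map g); apply: uniq_leq_size.
  by rewrite map_inj_in_uniq // => x y /hg[_ {2}<-] /hg[_ {2}<-] ->.
by move=> _ /mapP[x /hg[? _] ->].
Qed.

Section Mumford.
Variables (L : fieldType) (b f : {poly L}).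

(** The norm of y - t from the function field of y^2 + b y = f down to the rational functions in x:
    its roots are the abscissas of the points where the curve meets y = t(x). *)
Definition wpol (t : {poly L}) := t ^+ 2 + b * t - f.

Hypotheses (sb : (size b <= 2)%N) (mf : f \is monic) (sf : size f = 4%N).

(** The cubic f dominates for deg t <= 1 and t^2 dominates for deg t >= 2; their degrees 3 and 2 deg
    t never coincide, so the degree of the norm is always known. *)
Lemma size_wpol_lo (t : {poly L}) : (size t <= 2)%N -> size (wpol t) = 4%N.
Proof.
move=> st; rewrite /wpol addrC size_polyDl size_polyN sf //.
apply: leq_ltn_trans (size_polyD _ _) _; rewrite gtn_max; apply/andP; split.
  by apply: leq_ltn_trans (size_polyMleq _ _) _; lia.
by apply: leq_ltn_trans (size_polyMleq _ _) _; lia.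
Qed.

Lemma size_wpol_hi (t : {poly L}) d : (2 <= d)%N -> size t = d.+1 -> size (wpol t) = d.*2.+1.
Proof.
move=> d2 st.
have st2 : size (t ^+ 2) = d.*2.+1.
  have t0 : t != 0 by rewrite -size_poly_eq0 st.
  by rewrite expr2 size_mul // st; lia.
have sbt : (size (b * t)%R <= d.+2)%N.
  by apply: leq_trans (size_polyMleq _ _) _; lia.
rewrite /wpol -addrA size_polyDl ?st2 //.
apply: leq_ltn_trans (size_polyD _ _) _; rewrite size_polyN sf; lia.
Qed.

Lemma wpol_neq0 t : wpol t != 0.
Proof.
rewrite -size_poly_eq0; have [st|st] := leqP (size t) 2; first by rewrite size_wpol_lo.
by rewrite (@size_wpol_hi _ (size t).-1) //; lia.
Qed.

Lemma wpolB t t' : wpol t - wpol t' = (t - t') * (t + t' + b).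
Proof. by rewrite /wpol; ring. Qed.

Lemma dvdp_wpol_mod g t t' : g %| t - t' -> (g %| wpol t) = (g %| wpol t').
Proof.
move=> h; rewrite -[wpol t](subrK (wpol t')) dvdp_addr // wpolB.
exact: dvdp_mulr.
Qed.

End Mumford.

Section Count.
Variables (F : finFieldType) (b f : {poly F}).
Hypotheses (sb : (size b <= 2)%N) (mf : f \is monic) (sf : size f = 4%N).
Local Notation q := #|F|.
Local Notation W := (wpol b f).

Definition mumf j D : seq ({poly F} * {poly F}) :=
  [seq gt <- [seq (g, t) | g <- monics F j, t <- polysn F D] | gt.1 %| W gt.2].

Lemma mem_mumf j D g t : ((g, t) \in mumf j D) =
  [&& g \is monic, size g == j.+1, (size t <= D)%N & g %| W t].
Proof.
rewrite mem_filter /= -mem_polysn [RHS]andbA -mem_monics andbC [RHS]andbA; congr (_ && _).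
apply/allpairsP/andP => [[[x y] /= [hx hy [-> ->]]]|[hg ht]] //.
by exists (g, t).
Qed.

Lemma uniq_mumf j D : uniq (mumf j D).
Proof.
apply: filter_uniq; apply: allpairs_uniq; rewrite ?uniq_monics ?uniq_polysn //.
by move=> [? ?] [? ?] _ _ [-> ->].
Qed.

Definition nmumf j D := size (mumf j D).

(** Divisibility by g depends only on t modulo g. Hence a longer t is a reduced one plus g u, with u
    an arbitrary polynomial of size at most k. *)
Lemma nmumf_shift j k : nmumf j (j + k) = (nmumf j j * q ^ k)%N.
Proof.
rewrite -size_polysn -(size_allpairs (fun x y => (x, y))); apply/esym.
apply: (@size_bij _ _ _ _ (fun x => (x.1.1, x.1.2 + x.1.1 * x.2))
   (fun y => ((y.1, y.2 %% y.1), y.2 %/ y.1))).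
- apply: allpairs_uniq; rewrite ?uniq_mumf ?uniq_polysn //.
  by move=> [? ?] [? ?] _ _ [-> ->].
- exact: uniq_mumf.
- move=> _ /allpairsP[[[g t] u] /= [h1 h2 ->]] /=; move: h1 h2.
  rewrite !mem_mumf mem_polysn => /and4P[mg /eqP sg st hd] su.
  have sgu : (size (g * u)%R <= j + k)%N.
    by apply: leq_trans (size_polyMleq _ _) _; rewrite sg; lia.
  have stg : (size t < size g)%N by rewrite sg ltnS.
  split.
    rewrite mg sg eqxx /= (@dvdp_wpol_mod _ _ _ _ _ t) ?hd ?andbT.
      apply: leq_trans (size_polyD _ _) _; rewrite geq_max sgu andbT; lia.
    by rewrite addrC addKr dvdp_mulr.
  by rewrite addrC mulrC modp_addl_mul_small // divp_addl_mul_small.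
move=> [g t]; rewrite mem_mumf => /and4P[mg /eqP sg st hd] /=; split.
  apply/allpairsP; exists ((g, t %% g), t %/ g) => /=; split => //.
    rewrite mem_mumf mg sg eqxx /= -ltnS -sg ltn_modp monic_neq0 //=.
    rewrite (@dvdp_wpol_mod _ _ _ _ _ t) // -dvdpNr opprB.
    by rewrite {1}(divp_eq t g) addrK dvdp_mulIr.
  by rewrite mem_polysn size_divp ?monic_neq0 // sg /= leq_subLR.
by congr (_, _); rewrite addrC mulrC -divp_eq.
Qed.

(** The remaining zeros of y - t. The quotient is rescaled because first components must be monic,
    whereas the norm has leading coefficient -1 or the square of that of t. *)
Definition compl_mumf (gt : {poly F} * {poly F}) :=
  ((lead_coef (W gt.2))^-1 *: (W gt.2 %/ gt.1), gt.2).

Lemma compl_mumfP w j D g t : (j <= w)%N -> size (W t) = w.+1 ->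
  (g, t) \in mumf j D ->
  compl_mumf (g, t) \in mumf (w - j) D /\ compl_mumf (compl_mumf (g, t)) = (g, t).
Proof.
move=> jw sW; rewrite mem_mumf => /and4P[mg /eqP sg st hd].
have g0 := monic_neq0 mg.
have lc0 : lead_coef (W t) != 0 by rewrite lead_coef_eq0 wpol_neq0.
have eW : W t = (W t %/ g) * g by rewrite divpK.
have d0 : W t %/ g != 0.
  by apply/eqP => h; move: lc0; rewrite eW h mul0r lead_coef0 eqxx.
have lcd : lead_coef (W t %/ g) = lead_coef (W t).
  by rewrite [in RHS]eW lead_coefM (eqP mg) mulr1.
rewrite /compl_mumf /=; split.
  rewrite mem_mumf monicE lead_coefZ lcd mulVf // eqxx st /=.
  rewrite size_scale ?invr_eq0 // size_divp // sW sg /= subSn // eqxx /=.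
  by rewrite dvdpZl ?invr_eq0 // {2}eW dvdp_mulIl.
congr (_, _).
have -> : W t %/ ((lead_coef (W t))^-1 *: (W t %/ g)) = lead_coef (W t) *: g.
  rewrite divpZr ?invr_eq0 // invrK; congr (_ *: _).
  by rewrite {1}eW mulKp.
by rewrite scalerA mulVf // scale1r.
Qed.

Lemma nmumf_line j : (j <= 3)%N -> nmumf j 2 = nmumf (3 - j) 2.
Proof.
move=> j3; apply: (@size_bij _ _ _ _ compl_mumf compl_mumf); rewrite ?uniq_mumf //.
  move=> [g t] h; apply: (@compl_mumfP 3) => //.
  by move: h; rewrite mem_mumf => /and4P[_ _ st _]; rewrite size_wpol_lo.
move=> [g t] h; rewrite -{1}(subKn j3); apply: (@compl_mumfP 3) => //; first by lia.
by move: h; rewrite mem_mumf => /and4P[_ _ st _]; rewrite size_wpol_lo.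
Qed.

Lemma nmumf_line0 j : (3 < j)%N -> nmumf j 2 = 0%N.
Proof.
move=> j3; apply/eqP/nilP; case e: (mumf j 2) => [//|[g t] s].
have : (g, t) \in mumf j 2 by rewrite e mem_head.
rewrite mem_mumf => /and4P[_ /eqP sg st hd].
have := dvdp_leq (wpol_neq0 sb mf sf t) hd.
by rewrite size_wpol_lo // sg; lia.
Qed.

(** The complement depends on the degree of the norm, hence on the exact degree of t, so the pairs
    are sorted by it. *)
Definition exact_mumf j d := [seq gt : {poly F} * {poly F} <- mumf j d.+1 | size gt.2 == d.+1].

Lemma mem_exact_mumf j d gt :
  (gt \in exact_mumf j d) = (size (gt.2 : {poly F}) == d.+1) && (gt \in mumf j d.+1).
Proof. by rewrite [LHS]mem_filter. Qed.

Lemma nmumf_exact j d : nmumf j d.+1 = (nmumf j d + size (exact_mumf j d))%N.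
Proof.
rewrite /nmumf /exact_mumf addnC -[LHS](count_predC (fun gt : {poly F} * {poly F} => size gt.2 == d.+1)).
rewrite -size_filter; congr (_ + _)%N; rewrite -size_filter; apply: perm_size.
apply: uniq_perm; [exact/filter_uniq/uniq_mumf | exact: uniq_mumf | move=> [g t]].
rewrite mem_filter !mem_mumf /=; lia.
Qed.

Lemma exact_mumf_sym j d : (2 <= d)%N -> (j <= d.*2)%N ->
  size (exact_mumf j d) = size (exact_mumf (d.*2 - j) d).
Proof.
move=> d2 jd; apply: (@size_bij _ _ _ _ compl_mumf compl_mumf);
  try exact/filter_uniq/uniq_mumf.
  move=> [g t]; rewrite !mem_exact_mumf => /andP[/= /eqP st h].
  rewrite st eqxx /=; apply: (@compl_mumfP d.*2) => //.
  exact: size_wpol_hi.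
move=> [g t]; rewrite !mem_exact_mumf => /andP[/= /eqP st h].
rewrite st eqxx /= -{1}(subKn jd); apply: (@compl_mumfP d.*2) => //; first by lia.
exact: size_wpol_hi.
Qed.

Lemma exact_mumf0 j d : (2 <= d)%N -> (d.*2 < j)%N -> size (exact_mumf j d) = 0%N.
Proof.
move=> d2 jd; apply/eqP/nilP; case e: (exact_mumf j d) => [//|[g t] s].
have : (g, t) \in exact_mumf j d by rewrite e mem_head.
rewrite mem_exact_mumf mem_mumf => /andP[/eqP /= st' /and4P[_ /eqP sg st hd]].
have := dvdp_leq (wpol_neq0 sb mf sf t) hd.
by rewrite (size_wpol_hi sb mf sf d2 st') sg; lia.
Qed.

(** Pairs with deg t < deg g: on a smooth curve they are the effective affine divisors of degree j
    that contain no sum of a point and its conjugate. *)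
Definition rmumf j := nmumf j j.

Lemma card_gt0 : (0 < q)%N.
Proof. by apply/card_gt0P; exists 0. Qed.

(** The new t have exact degree D. Complementation replaces J > D by 2 D - J < D, where t is longer
    than g and the number of pairs follows from the reduced ones. *)
Lemma nmumf_step J D : (2 <= D)%N -> (D < J)%N -> (J <= D.*2)%N ->
  nmumf J D.+1 = (nmumf J D + rmumf (D.*2 - J) * (q ^ (J - D) * q.-1))%N.
Proof.
move=> D2 DJ JD; rewrite nmumf_exact exact_mumf_sym //; congr (_ + _)%N.
have := nmumf_exact (D.*2 - J) D.
rewrite [in LHS](_ : D.+1 = (D.*2 - J) + (J - D).+1)%N; last by lia.
rewrite nmumf_shift [X in (nmumf _ X + _)%N](_ : D = (D.*2 - J) + (J - D))%N; last by lia.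
rewrite nmumf_shift -/(rmumf _) expnS.
by have := card_gt0; case: q => // q' _ /=; nia.
Qed.

Lemma nmumf_step0 J D : (2 <= D)%N -> (D.*2 < J)%N -> nmumf J D.+1 = nmumf J D.
Proof. by move=> D2 DJ; rewrite nmumf_exact exact_mumf0 // addn0. Qed.

Lemma rmumf0 : rmumf 0 = 1%N.
Proof.
rewrite /rmumf /nmumf; apply/eqP; rewrite eqn_leq; apply/andP; split.
  rewrite (@uniq_leq_size _ _ [:: (1, 0)]) ?uniq_mumf // => -[g t].
  rewrite mem_mumf inE => /and4P[mg /size_poly1P [c _ eg] st _].
  move: mg st; rewrite eg monicE lead_coefC => /eqP ->.
  by rewrite leqn0 size_poly_eq0 => /eqP ->.
have : (1, 0) \in mumf 0 0 by rewrite mem_mumf monic1 size_poly1 size_poly0 dvd1p.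
by case: (mumf 0 0).
Qed.

Lemma rmumf2 : rmumf 2 = (q * rmumf 1)%N.
Proof. by rewrite /rmumf nmumf_line // (nmumf_shift 1 1) expn1 mulnC. Qed.

Lemma rmumf3 : rmumf 3 = (q ^ 2 + rmumf 1 * (q * q.-1))%N.
Proof.
rewrite /rmumf nmumf_step // nmumf_line // (nmumf_shift 0 2).
by rewrite -/(rmumf 0) rmumf0 mul1n expn1.
Qed.

(** Raising J by 2 and D by 1 preserves 2 D - J, so the increments in D of the two sides involve the
    same reduced pairs and differ by a factor q. The induction starts at lines, where both sides
    vanish because J > 3. *)
Lemma nmumf_shift2 J D : (4 <= J)%N -> (2 <= D)%N -> (D <= J)%N ->
  nmumf J.+2 D.+1 = (q * nmumf J D)%N.
Proof.
move=> J4; elim: D => // D IH; rewrite ltnS leq_eqVlt => /predU1P[<-|D2] DJ.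
  by rewrite nmumf_step0 // ?nmumf_line0 ?muln0 //; lia.
have [JD|JD] := leqP J D.*2.
  rewrite nmumf_step; [|lia..]; rewrite (@nmumf_step J D); [|lia..].
  rewrite IH //; last by lia.
  rewrite (_ : D.+1.*2 - J.+2 = D.*2 - J)%N; last by lia.
  rewrite (_ : J.+2 - D.+1 = (J - D).+1)%N; last by lia.
  by rewrite expnS; ring.
by rewrite nmumf_step0 ?(@nmumf_step0 J D) ?IH; lia.
Qed.

Lemma rmumf_step J : (4 <= J)%N -> rmumf J.+2 = (q ^ 2 * rmumf J)%N.
Proof.
move=> J4; rewrite {1}/rmumf nmumf_step; [|lia..].
rewrite nmumf_shift2 //; last by lia.
rewrite (_ : J.+1.*2 - J.+2 = J)%N; last by lia.
rewrite (_ : J.+2 - J.+1 = 1)%N; last by lia.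
rewrite -/(rmumf J).
by have := card_gt0; case: q => // q' _ /=; ring.
Qed.

Lemma rmumfE J : rmumf J.+4 = (q ^ J.+2 * q.-1 * (rmumf 1).+1)%N.
Proof.
elim/ltn_ind: J => -[|[|J]] IH.
- rewrite /rmumf nmumf_step // nmumf_step // nmumf_line0 // -/(rmumf 0) -/(rmumf 2).
  by rewrite rmumf0 rmumf2 /=; rewrite add0n; ring.
- rewrite /rmumf nmumf_step // nmumf_step // nmumf_step0 // nmumf_line0 //.
  rewrite -/(rmumf 1) -/(rmumf 3) rmumf3 /=.
  by have := card_gt0; case: q => // q' _ /=; ring.
rewrite rmumf_step // IH //.
by rewrite [in RHS]expnS [in RHS]expnS; ring.
Qed.

(* The triple (c, (g, t)) stands for the effective divisor c + (g, y - t), in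
   Mumford's notation; its degree is 2 deg c + deg g. *)
Definition triples n : seq ({poly F} * ({poly F} * {poly F})) :=
  flatten [seq [seq (c, gt) | c <- monics F i, gt <- mumf (n - i.*2) (n - i.*2)]
             | i <- iota 0 (n./2).+1].

Lemma mem_triples n c g t : ((c, (g, t)) \in triples n) =
  [&& c \is monic, g \is monic, (size t < size g)%N, g %| W t
    & ((size c).-1.*2 + (size g).-1 == n)%N].
Proof.
apply/flatten_mapP/and5P => [[i]|[mc mg st hd /eqP hn]].
  rewrite mem_iota add0n ltnS => /= hi /allpairsP[[c' [g' t']] /=].
  rewrite mem_monics mem_mumf => -[/andP[mc /eqP sc] /and4P[mg /eqP sg st hd] [-> -> ->]].
  split => //; first by rewrite sg ltnS.
  by rewrite sc sg /= subnKC //; lia.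
have c0 : (0 < size c)%N by rewrite size_poly_gt0 monic_neq0.
have g0 : (0 < size g)%N by rewrite size_poly_gt0 monic_neq0.
exists (size c).-1; first by rewrite mem_iota; lia.
apply/allpairsP; exists (c, (g, t)); split => //.
  by rewrite mem_monics mc /= prednK.
have -> : (n - (size c).-1.*2 = (size g).-1)%N by rewrite -hn addKn.
by rewrite mem_mumf mg hd prednK // eqxx -ltnS prednK // st.
Qed.

Lemma uniq_triples n : uniq (triples n).
Proof.
rewrite /triples; elim: (iota 0 _) (iota_uniq 0 n./2.+1) => //= i s IH /andP[his us].
rewrite cat_uniq IH // andbT; apply/andP; split.
  apply: allpairs_uniq; rewrite ?uniq_monics ?uniq_mumf //.
  by move=> [? ?] [? ?] _ _ [-> ->].
apply/hasPn => -[c gt] /flatten_mapP[i' hi' /allpairsP[[c' gt'] /= [h1 _ [e1 _]]]].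
apply/allpairsP => -[[c'' gt''] /= [h2 _ [e2 _]]].
move: h1 h2; rewrite -e1 -e2 !mem_monics => /andP[_ /eqP ->] /andP[_ /eqP[e]].
by move: his; rewrite -e hi'.
Qed.

Definition ntriples n := size (triples n).

Lemma ntriplesE n : ntriples n = \sum_(i < (n./2).+1) (q ^ i * rmumf (n - i.*2))%N.
Proof.
rewrite /ntriples size_flatten /shape -map_comp sumnE big_map.
rewrite -[n./2.+1 in LHS]subn0 -/(index_iota 0 _) big_mkord; apply: eq_bigr => i _ /=.
by rewrite size_allpairs size_monics.
Qed.

Lemma ntriples0 : ntriples 0 = 1%N.
Proof. by rewrite ntriplesE big_ord1 mul1n rmumf0. Qed.

Lemma ntriples1 : ntriples 1 = rmumf 1.
Proof. by rewrite ntriplesE big_ord1 mul1n. Qed.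

Lemma ntriplesSS n : ntriples n.+2 = (rmumf n.+2 + q * ntriples n)%N.
Proof.
rewrite !ntriplesE big_ord_recl mul1n /=; congr (_ + _)%N.
rewrite big_distrr /=; apply: eq_bigr => i _.
by rewrite /bump /= add1n doubleS expnS mulnA.
Qed.

(** With q - a reduced pairs of degree 1, these are the coefficients of degree at least 2 of (1 - a
    u + q u^2) / (1 - q u), the zeta function of the affine curve. *)
Lemma ntriples_gt1 n : ntriples n.+2 = (q ^ n.+1 * (rmumf 1).+1)%N.
Proof.
elim/ltn_ind: n => -[|[|n]] IH; rewrite ntriplesSS.
- by rewrite rmumf2 ntriples0; ring.
- rewrite rmumf3 ntriples1.
  by have := card_gt0; case: q => // q' _ /=; ring.
rewrite rmumfE IH // [in RHS]expnS.
by have := card_gt0; case: q => // q' _ /=; rewrite !expnS; ring.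
Qed.

End Count.

(** * Mumford triples and divisors *)

Lemma mupMXsubC (K : fieldType) (x z : K) (p : {poly K}) : p != 0 ->
  mup x (p * ('X - z%:P)) = (mup x p + (z == x))%N.
Proof.
move=> p0; rewrite mupM ?polyXsubC_eq0 // -(expr1 ('X - z%:P)) mup_XsubCX.
by case: (z == x).
Qed.

Lemma mup_gt0 (K : fieldType) (x : K) (p : {poly K}) : p != 0 ->
  (0 < mup x p)%N = root p x.
Proof. by move=> p0; rewrite -XsubC_dvd // dvdp_XsubCl. Qed.

Lemma dvdp_root (K : fieldType) (p d : {poly K}) x : p %| d -> root p x -> root d x.
Proof. by rewrite -!dvdp_XsubCl => h h'; apply: dvdp_trans h' h. Qed.

Lemma dvdp_mup (K : closedFieldType) (p d : {poly K}) : p != 0 -> d != 0 ->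
  (forall x, (mup x p <= mup x d)%N) -> p %| d.
Proof.
have [r ->] := closed_field_poly_normal p.
rewrite scaler_eq0 negb_or => /andP[l0 _] d0 h; rewrite dvdpZl //.
have {}h x : (count_mem x r <= mup x d)%N.
  by have := h x; rewrite -mul_polyC mupMr ?mu_prod_XsubC // rootC.
elim: r d d0 h => [|z r IH] d d0 h; first by rewrite big_nil dvd1p.
have : ('X - z%:P) %| d.
  rewrite XsubC_dvd //; apply: leq_trans (h z); by rewrite /= eqxx.
case/dvdpP => d' e; have d'0 : d' != 0 by apply: contraNneq d0 => h'; rewrite e h' mul0r.
rewrite big_cons e mulrC dvdp_mul2r ?polyXsubC_eq0 //; apply: IH => // x.
by have := h x; rewrite e mupMXsubC //= [(mup x d' + _)%N]addnC leq_add2l.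
Qed.

Lemma monic_mup_inj (K : closedFieldType) (p d : {poly K}) : p \is monic -> d \is monic ->
  (forall x, mup x p = mup x d) -> p = d.
Proof.
move=> mp md h; have [p0 d0] := (monic_neq0 mp, monic_neq0 md).
by apply/eqP; rewrite -eqp_monic //; apply/andP; split; apply: dvdp_mup => // x; rewrite h.
Qed.

Section MumfordDivisors.
Variables (K : closedFieldType) (b f : {poly K}).
Local Notation W := (wpol b f).

Definition onc (P : K * K) := P.2 ^+ 2 + b.[P.1] * P.2 == f.[P.1].
Definition conj_y (P : K * K) := - P.2 - b.[P.1].

(* The only consequence of smoothness that is needed: at a ramification point
   x - x0 has valuation 2, whereas y - t(x) has valuation 1. *)
Hypothesis smooth : forall (t : {poly K}) x, root (W t) x -> t.[x] = conj_y (x, t.[x]) ->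
  ~~ (('X - x%:P) ^+ 2 %| W t).

Lemma root_wpol t x : root (W t) x = onc (x, t.[x]).
Proof. by rewrite /root /wpol /onc /= !hornerE subr_eq0. Qed.

Lemma onc_same_x x y y' : onc (x, y) -> onc (x, y') -> y' = y \/ y' = conj_y (x, y).
Proof.
rewrite /onc /conj_y /= => /eqP h /eqP h'.
have /eqP : (y' - y) * (y' + y + b.[x]) = 0.
  transitivity ((y' ^+ 2 + b.[x] * y') - (y ^+ 2 + b.[x] * y)); first by ring.
  by rewrite h' h subrr.
rewrite mulf_eq0 subr_eq0 => /orP[/eqP ->|]; first by left.
by rewrite -addrA addr_eq0 opprD => /eqP ->; right.
Qed.

Lemma onc_conj x y : onc (x, conj_y (x, y)) = onc (x, y).
Proof. by rewrite /onc /conj_y /=; congr (_ == _); ring. Qed.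

Lemma conj_yK x y : conj_y (x, conj_y (x, y)) = y.
Proof. by rewrite /conj_y /=; ring. Qed.

Definition triple_ok (T : {poly K} * ({poly K} * {poly K})) :=
  [&& T.1 \is monic, T.2.1 \is monic, (size T.2.2 < size T.2.1)%N & T.2.1 %| W T.2.2].

Definition triple_deg (T : {poly K} * ({poly K} * {poly K})) :=
  ((size T.1).-1.*2 + (size T.2.1).-1)%N.

(** The multiplicity of P in the divisor of the triple. A root of c counts for both points above it,
    which coincide at a ramification point and then give multiplicity 2; a root of g counts only for
    the point selected by t. *)
Definition pmult (T : {poly K} * ({poly K} * {poly K})) (P : K * K) :=
  (mup P.1 T.1 * (1 + (P.2 == conj_y P)) + (T.2.2.[P.1] == P.2) * mup P.1 T.2.1)%N.

(** Twice a ramification point is the divisor of x - x0 and belongs to c, so g may contain the point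
    only once; smoothness enforces this. *)
Lemma mup_ram g t x : g != 0 -> g %| W t -> t.[x] = conj_y (x, t.[x]) -> (mup x g <= 1)%N.
Proof.
move=> g0 hd e; have [h|h] := boolP (root g x); last by rewrite mupNroot.
rewrite mup_leq //; apply: contra (smooth (dvdp_root hd h) e) => h'.
exact: dvdp_trans h' hd.
Qed.

(** Points are added one at a time, as in Cantor's composition: a point whose conjugate is present
    completes a vertical pair, any other point enlarges g and corrects t. *)
Lemma pmult_exists (s : seq (K * K)) : all onc s ->
  exists T, [/\ triple_ok T, triple_deg T = size s
    & forall P, onc P -> count_mem P s = pmult T P].
Proof.
elim: s => [_|[x0 y0] s IH /= /andP[h0 /IH[[c [g t]] [/and4P[/= mc mg st hd] dT hT]]]].
  exists (1, (1, 0)); split => //.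
  - by rewrite /triple_ok /= monic1 size_poly1 size_poly0 dvd1p.
  - by rewrite /triple_deg /= size_poly1.
  by move=> P _; rewrite /pmult /= !mupNroot ?root1 // muln0.
have [c0 g0] := (monic_neq0 mc, monic_neq0 mg).
have mX : 'X - x0%:P \is monic by exact: monicXsubC.
have sc : (0 < size c)%N by rewrite size_poly_gt0.
have sg : (0 < size g)%N by rewrite size_poly_gt0.
(* The conjugate of the new point lies on the pair (g, t): the two points form the divisor of x -
   x0, which moves from g to c. *)
case: (boolP (root g x0 && (t.[x0] == conj_y (x0, y0)))) => [/andP[rg /eqP et]|hB].
  have [g1 eg] := factor_theorem _ _ rg.
  have g10 : g1 != 0 by apply: contraNneq g0 => h; rewrite eg h mul0r.
  have mg1 : g1 \is monic by move: mg; rewrite eg monicMr.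
  have sg1 : size g = (size g1).+1 by rewrite eg size_Mmonic // size_XsubC addn2.
  have hd1 : g1 %| W t by apply: dvdp_trans hd; rewrite eg dvdp_mulr.
  have dt : g1 %| t %% g1 - t.
    by rewrite {2}(divp_eq t g1) opprD addrCA subrr addr0 -mulNr dvdp_mulIr.
  have et' x : root g1 x -> (t %% g1).[x] = t.[x].
    by move=> h; apply/eqP; rewrite -subr_eq0 -hornerN -hornerD; exact: dvdp_root dt h.
  exists (c * ('X - x0%:P), (g1, t %% g1)); split.
  - by rewrite /triple_ok /= monicMr // mc mg1 ltn_modp g10 (dvdp_wpol_mod _ _ dt).
  - move: dT; rewrite /triple_deg /= size_Mmonic // size_XsubC sg1 addn2 /= => <-.
    have : (0 < size g1)%N by rewrite size_poly_gt0.
    by move: sc; case: (size c) => // n _; case: (size g1) => // n' _ /=; clear; lia.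
  move=> [x y] h; rewrite /= hT // /pmult /= eg !mupMXsubC //.
  have e1 : ((t.[x] == y) * mup x g1 = ((t %% g1).[x] == y) * mup x g1)%N.
    have [r|r] := boolP (root g1 x); first by rewrite et'.
    by rewrite mupNroot // !muln0.
  rewrite (mulnDr (nat_of_bool (t.[x] == y))) e1 (mulnDl (mup x c)) xpair_eqE.
  have [e|nx] := eqVneq x0 x; last by rewrite /= muln0 mul0n !addn0.
  move: h et h0; rewrite -e => h et h0.
  rewrite /= mul1n muln1 et eq_sym [conj_y (x0, y0) == y]eq_sym.
  have [->|->] := onc_same_x h0 h; last first.
    by rewrite conj_yK eqxx; move: (_ * mup x0 g1)%N => m; case: (_ == _); clear; lia.
  by rewrite eqxx; move: (_ * mup x0 g1)%N => m; case: (_ == _); clear; lia.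
have hy : root g x0 -> t.[x0] = y0 /\ y0 != conj_y (x0, y0).
  move=> rg; move: hB; rewrite rg /= => hB.
  have ht : onc (x0, t.[x0]) by rewrite -root_wpol; exact: dvdp_root hd rg.
  have [e|e] := onc_same_x h0 ht; last by rewrite e eqxx in hB.
  by move: hB; rewrite e.
have [w ew] : exists w, W t = w * g by exact/dvdpP.
pose u := t + t + b.
have eW r : W (t + r *: g) = (w + r *: u + r ^+ 2 *: g) * g.
  by rewrite -!mul_polyC rmorphXn /= !mulrDl -ew /wpol /u; ring.
(* The new t must agree with the old one modulo g, hence the form t + s0 g. Away from the roots of
   g, s0 interpolates the new point. At a root the point is already present and s0 is a Hensel step,
   solvable because u = 2 t + b is nonzero at an unramified point. *)
have [s0 [hs1 hs2]] : exists s0, (t + s0 *: g).[x0] = y0 /\ root (w + s0 *: u + s0 ^+ 2 *: g) x0.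
  have [rg|rg] := boolP (root g x0).
    have [e ne] := hy rg.
    have u0 : u.[x0] != 0.
      apply: contra ne => /eqP; rewrite /u !hornerE e /conj_y /= => h.
      by rewrite -subr_eq0 opprD !opprK addrA h.
    exists (- w.[x0] / u.[x0]); split.
      by rewrite hornerD hornerZ (eqP rg) mulr0 addr0.
    by rewrite /root 2!hornerD !hornerZ (eqP rg) mulr0 addr0 divfK // subrr.
  exists ((y0 - t.[x0]) / g.[x0]); split; first by rewrite !hornerE divfK // addrC subrK.
  set s1 := _ / _.
  have : root (W (t + s1 *: g)) x0 by rewrite root_wpol !hornerE divfK // addrC subrK.
  by rewrite eW rootM (negPf rg) orbF.
have sX : size (g * ('X - x0%:P)) = (size g).+1 by rewrite size_Mmonic // size_XsubC addn2.
exists (c, (g * ('X - x0%:P), t + s0 *: g)); split.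
- rewrite /triple_ok /= mc monicMr // mg sX eW mulrC dvdp_mul2r // dvdp_XsubCl hs2 andbT /=.
  rewrite ltnS; apply: leq_trans (size_polyD _ _) _; rewrite geq_max (ltnW st) /=.
  exact: size_scale_leq.
- by move: dT sg; rewrite /triple_deg /= sX /=; clear; lia.
move=> [x y] h; rewrite /= hT // /pmult /= !mupMXsubC // xpair_eqE !hornerE.
have e1 : ((t.[x] == y) * mup x g = ((t.[x] + s0 * g.[x])%R == y) * mup x g)%N.
  have [r|r] := boolP (root g x); first by rewrite (eqP r) mulr0 addr0.
  by rewrite mupNroot // !muln0.
rewrite e1 (mulnDr (nat_of_bool (_ == y))).
have [e|nx] := eqVneq x0 x; last by rewrite /= muln0 addn0.
by rewrite -e; move: hs1; rewrite !hornerE => ->; rewrite /= [RHS]addnC addnA.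
Qed.

Lemma exists_onc x : exists y, onc (x, y).
Proof.
have : size ('X^2 + b.[x] *: 'X - (f.[x])%:P : {poly K}) != 1%N.
  rewrite -addrA size_polyDl size_polyXn // ltnS.
  apply: leq_trans (size_polyD _ _) _; rewrite geq_max size_polyN.
  by rewrite (leq_trans (size_scale_leq _ _)) ?size_polyX // (leq_trans (size_polyC_leq1 _)).
by case/closed_rootP => y; rewrite /root !hornerE subr_eq0 => h; exists y.
Qed.

(** Above an unramified x, the order of c is the smaller multiplicity of the two conjugate points,
    the order of g is the difference, and t selects the point with the larger one. Above a ramified
    x, the multiplicity is twice the order of c, plus 0 or 1 from g. *)
Lemma pmult_inj T T' : triple_ok T -> triple_ok T' ->
  (forall P, onc P -> pmult T P = pmult T' P) -> T = T'.
Proof.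
case: T T' => [c [g t]] [c' [g' t']].
move=> /and4P[/= mc mg st hd] /and4P[/= mc' mg' st' hd'] h.
have [c0 g0] := (monic_neq0 mc, monic_neq0 mg).
have [c'0 g'0] := (monic_neq0 mc', monic_neq0 mg').
have H x : [/\ mup x c = mup x c', mup x g = mup x g' & root g x -> t.[x] = t'.[x]].
  have [y hy] := exists_onc x.
  have := h _ hy; have := h (x, conj_y (x, y)); rewrite onc_conj => /(_ hy).
  rewrite /pmult /= conj_yK -!mup_gt0 //.
  have A (p r : {poly K}) : p != 0 -> p %| W r -> (0 < mup x p)%N ->
      r.[x] = y \/ r.[x] = conj_y (x, y).
    move=> p0 hp; rewrite mup_gt0 // => hr; apply: onc_same_x hy _.
    by rewrite -root_wpol; exact: dvdp_root hp hr.
  have := A _ _ g0 hd; have := A _ _ g'0 hd'.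
  have [e|ne] := eqVneq y (conj_y (x, y)).
    have B (p r : {poly K}) : p != 0 -> p %| W r -> (0 < mup x p)%N -> mup x p = 1%N.
      move=> p0 hp hr; have := A _ _ p0 hp hr; rewrite -e => -[] er;
        by apply/eqP; rewrite eqn_leq hr andbT; apply: (mup_ram p0 hp); rewrite er.
    have := B _ _ g0 hd; have := B _ _ g'0 hd'.
    rewrite -e; case: (mup x g) => [|n]; case: (mup x g') => [|n'].
    - by move=> _ _ _ _ _ /=; rewrite !muln0 !addn0 => h'; split => //; clear -h'; lia.
    - move=> /(_ isT)-> _ /(_ isT) E _; have -> : t'.[x] = y by case: E.
      by rewrite eqxx muln0; clear; lia.
    - move=> _ /(_ isT)-> _ /(_ isT) E; have -> : t.[x] = y by case: E.
      by rewrite eqxx muln0; clear; lia.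
    move=> /(_ isT)-> /(_ isT)-> /(_ isT) E' /(_ isT) E.
    have -> : t'.[x] = y by case: E'.
    have -> : t.[x] = y by case: E.
    by rewrite eqxx => h' _; split => //; clear -h'; lia.
  rewrite addn0 !muln1.
  case: (mup x g) => [|n]; case: (mup x g') => [|n'].
  - by move=> _ _; rewrite !muln0 !addn0 => -> _; split.
  - move=> /(_ isT)[]-> _; rewrite eqxx ?(negPf ne) ?[_ == y]eq_sym ?(negPf ne); clear; lia.
  - move=> _ /(_ isT)[]->; rewrite eqxx ?(negPf ne) ?[_ == y]eq_sym ?(negPf ne); clear; lia.
  move=> /(_ isT)[]-> /(_ isT)[]->;
    rewrite !eqxx ?(negPf ne) ?[_ == y]eq_sym ?(negPf ne) => h1 h2;
    clear -h1 h2; (split; [lia | lia | move=> _; try by [] ]); lia.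
have ec : c = c' by apply: monic_mup_inj => // x; case: (H x).
have eg : g = g' by apply: monic_mup_inj => // x; case: (H x).
subst c' g'; suff -> : t = t' by [].
apply/eqP; rewrite -subr_eq0; apply/negP => /negP d0.
(* Since W t - W t' = (t - t') (t + t' + b), and the last factor is nonzero at an unramified root of
   g, the order of t - t' there is that of W t - W t', a multiple of g. At a ramified root g has
   order 1 and equality of the values suffices. *)
have : g %| t - t'.
  apply: dvdp_mup => // x; have [r|r] := boolP (root g x); last by rewrite mupNroot.
  have [_ _ /(_ r) et] := H x.
  have rd : root (t - t') x by rewrite /root !hornerE et subrr.
  have [e|ne] := eqVneq t.[x] (conj_y (x, t.[x])).
    by apply: leq_trans (mup_ram g0 hd e) _; rewrite mup_gt0.
  have nr : ~~ root (t + t' + b) x.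
    apply: contra ne; rewrite /root !hornerE -et /conj_y /= => h1.
    by rewrite -subr_eq0 opprD !opprK addrA.
  rewrite -(mupMl (t - t') nr) -(wpolB b f).
  have d1 : W t - W t' != 0.
    by rewrite wpolB mulf_neq0 //; apply: contraNneq nr => ->; rewrite root0.
  rewrite mup_geq //; apply: (@dvdp_trans _ g); first by rewrite -mup_geq.
  exact: dvdp_sub.
move/(dvdp_leq d0); rewrite leqNgt; apply/negP/negPn.
by apply: leq_ltn_trans (size_polyD _ _) _; rewrite size_polyN gtn_max st.
Qed.

End MumfordDivisors.

(** * Frobenius *)

Section Frobenius.
Variables (F : finFieldType) (p m : nat).
Hypotheses (hp : p \in [pchar F]) (hq : #|F| = (p ^ m)%N).
Variables (K : closedFieldType) (iota : {rmorphism F -> K}).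
Hypothesis hK : integralRange iota.
Local Notation q := #|F|.

Definition frobn (i : nat) (x : K) : K := x ^+ (q ^ i).

Lemma pcharK : p \in [pchar K].
Proof. by rewrite (fmorph_pchar iota). Qed.

Lemma p_prime : prime p.
Proof. exact: pcharf_prime hp. Qed.

Lemma q_gt1 : (1 < q)%N.
Proof. exact: finNzRing_gt1. Qed.

Lemma exponent_gt0 : (0 < m)%N.
Proof. by have := q_gt1; rewrite hq; case: m. Qed.

Lemma pnat_qi i : ([pchar K]).-nat (q ^ i)%N.
Proof.
rewrite hq -expnM pnatX; apply/orP; left.
by rewrite pnatE ?p_prime // pcharK.
Qed.

Lemma frobnB i : zmod_morphism (frobn i).
Proof.
move=> x y; rewrite /frobn exprDn_pchar ?pnat_qi //; congr (_ + _).
have : frobn i (y - y) = 0 by rewrite subrr /frobn expr0n expn_eq0; move: q_gt1; case: #|F|.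
rewrite /frobn exprDn_pchar ?pnat_qi // addrC => /eqP; rewrite addr_eq0 => /eqP ->.
by [].
Qed.

Lemma frobnM i : monoid_morphism (frobn i).
Proof. by split=> [|x y]; rewrite /frobn ?expr1n ?exprMn. Qed.

Definition frobm i : {rmorphism K -> K} :=
  HB.pack (frobn i) (GRing.isZmodMorphism.Build K K (frobn i) (frobnB i))
                    (GRing.isMonoidMorphism.Build K K (frobn i) (frobnM i)).

Lemma frobn0 x : frobn 0 x = x.
Proof. by rewrite /frobn expr1. Qed.

Lemma frobnD i j x : frobn (i + j) x = frobn i (frobn j x).
Proof. by rewrite /frobn -exprM -expnD addnC. Qed.

Lemma frobn_iota i c : frobn i (iota c) = iota c.
Proof.
elim: i => [|i IH]; first exact: frobn0.
by rewrite -addn1 frobnD -[RHS]IH; congr frobn; rewrite /frobn expn1 -rmorphXn /= expf_card.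
Qed.

Lemma frobn_inj i : injective (frobn i).
Proof. exact: (fmorph_inj (frobm i)). Qed.

Lemma frob1_fixed x : frobn 1 x = x -> exists c, x = iota c.
Proof.
rewrite /frobn expn1 => e.
have : root (map_poly iota ('X^q - 'X)) x.
  by rewrite rmorphB /= map_polyXn map_polyX /root !hornerE e subrr.
rewrite finField_genPoly rmorph_prod /=.
under eq_bigr => c _ do rewrite rmorphB /= map_polyX map_polyC.
rewrite -(big_map iota predT (fun z => 'X - z%:P)) root_prod_XsubC => /mapP[c _ ->].
by exists c.
Qed.

Lemma frobn_periodic x : exists2 n, (0 < n)%N & frobn n x = x.
Proof.
have [P mP rP] := hK x.
have rn i : root (map_poly iota P) (frobn i x).
  have -> : map_poly iota P = map_poly (frobm i) (map_poly iota P).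
    by rewrite -map_poly_comp; apply: eq_map_poly => c /=; rewrite frobn_iota.
  exact: rmorph_root.
have P0 : map_poly iota P != 0 by rewrite map_poly_eq0 monic_neq0.
have : ~~ uniq [seq frobn i x | i <- seq.iota 0 (size (map_poly iota P))].
  apply/negP => u.
  have := max_poly_roots P0 _ u; rewrite size_map size_iota ltnn => h.
  by have : false by apply: h; apply/allP => _ /mapP[i _ ->]; exact: rn.
case/(uniqPn 0) => i [j [ij]]; rewrite size_map size_iota => jn.
rewrite !(nth_map 0) ?size_iota ?(ltn_trans ij) // !nth_iota ?(ltn_trans ij) // !add0n => e.
exists (j - i)%N; first by rewrite subn_gt0.
by apply: (@frobn_inj i); rewrite -frobnD subnKC ?(ltnW ij).
Qed.

Lemma frobn_mul n k x : frobn n x = x -> frobn (n * k) x = x.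
Proof.
by move=> e; elim: k => [|k IH]; rewrite ?muln0 ?frobn0 // mulnS frobnD IH.
Qed.

Lemma frobn_periodic2 x y : exists2 n, (0 < n)%N & frobn n x = x /\ frobn n y = y.
Proof.
have [n n0 ex] := frobn_periodic x; have [k k0 ey] := frobn_periodic y.
exists (n * k)%N; first by rewrite muln_gt0 n0.
by rewrite frobn_mul // mulnC frobn_mul.
Qed.

Lemma frobn_bij i : bijective (frobn i).
Proof.
have h x : exists y, frobn i y == x.
  have [n n0 e] := frobn_periodic x.
  exists (frobn (n * i - i) x); rewrite -frobnD subnKC ?leq_pmull //.
  by rewrite frobn_mul.
exists (fun x => xchoose (h x)) => x; last exact/eqP/(xchooseP (h x)).
by apply: (@frobn_inj i); exact/eqP/(xchooseP (h _)).
Qed.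

Lemma frob_poly_descent (P : {poly K}) : map_poly (frobn 1) P = P ->
  exists P0, P = map_poly iota P0.
Proof.
move=> e.
have h i : exists c, P`_i == iota c.
  have [|c ->] := @frob1_fixed P`_i; last by exists c.
  by rewrite -[in RHS]e (coef_map (frobm 1)).
exists (\poly_(i < size P) xchoose (h i)); apply/polyP => i; rewrite coef_map coef_poly.
case: ltnP => hi; first exact/eqP/(xchooseP (h i)).
by rewrite nth_default //; exact/esym/(rmorph0 iota).
Qed.

(** Both coordinates are packed into the polynomial x + y X, so that one power of Frobenius serves
    for the two. The product over its Frobenius orbit has coefficients in F, hence is fixed by g,
    which therefore sends x + y X to a member of the orbit. *)
Lemma autom_frobn (g : {rmorphism K -> K}) x y : (forall c, g (iota c) = iota c) ->
  exists i, g x = frobn i x /\ g y = frobn i y.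
Proof.
move=> hg; have [n n0 [ex ey]] := frobn_periodic2 x y.
pose u i : {poly K} := (frobn i x)%:P + frobn i y *: 'X.
have ug i (h : {rmorphism K -> K}) : map_poly h (u i) = (h (frobn i x))%:P + h (frobn i y) *: 'X.
  by rewrite rmorphD /= map_polyC map_polyZ map_polyX.
pose P : {poly {poly K}} := \prod_(v <- [seq u i | i <- seq.iota 0 n]) ('X - v%:P).
have PE (h : {rmorphism K -> K}) :
    map_poly (map_poly h) P = \prod_(v <- [seq map_poly h (u i) | i <- seq.iota 0 n]) ('X - v%:P).
  rewrite rmorph_prod /= !big_map; apply: eq_bigr => i _.
  by rewrite rmorphB /= map_polyX map_polyC.
have fP : map_poly (map_poly (frobm 1)) P = P.
  rewrite PE; apply: perm_big.
  have -> : [seq map_poly (frobm 1) (u i) | i <- seq.iota 0 n] = [seq u i | i <- seq.iota 1 n].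
    rewrite -[1%N]addn0 iotaDl -map_comp; apply: eq_map => i.
    rewrite -[LHS]/(map_poly (frobm 1) (u i)) ug -[RHS]/(u (1 + i)%N) /u.
    by rewrite !frobnD.
  case: n n0 ex ey {P PE} => // n _ ex ey.
  rewrite (_ : seq.iota 1 n.+1 = seq.iota 1 n ++ [:: n.+1]); last by rewrite -(addn1 n) iotaD add1n addn1.
  rewrite map_cat perm_catC /=.
  by rewrite /u ex ey !frobn0.
have gP : map_poly (map_poly g) P = P.
  apply/polyP => i; rewrite coef_map; apply/polyP => j; rewrite coef_map /=.
  have [|c ->] := @frob1_fixed P`_i`_j; last by rewrite hg.
  by rewrite -[in RHS]fP 2!coef_map.
have : root (map_poly (map_poly g) P) (map_poly g (u 0%N)).
  apply: rmorph_root; rewrite root_prod_XsubC; apply/mapP; exists 0%N => //.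
  by rewrite mem_iota.
rewrite gP root_prod_XsubC => /mapP[i _]; rewrite ug !frobn0 => e.
exists i; split.
  by have := congr1 (coefp 0) e; rewrite /= !coefD !coefC !coefZ !coefX /= !mulr0 !addr0.
by have := congr1 (coefp 1) e; rewrite /= !coefD !coefC !coefZ !coefX /= !mulr1 !add0r.
Qed.

End Frobenius.

(** * Group law on short Weierstrass curves *)

Record swcurve (K : fieldType) := SWCurve {
  swA : K; swB : K;
  sw_two : 2%:R != 0 :> K;
  sw_disc : 4%:R * swA ^+ 3 + 27%:R * swB ^+ 2 != 0 }.

Section GroupLaw.
Variables (K : fieldType) (C : swcurve K).
Local Notation A := (swA C).
Local Notation B := (swB C).
Local Notation pt := (option (K * K)).

Let two0 : 2%:R != 0 :> K := sw_two C.

Definition swf (x : K) := x ^+ 3 + A * x + B.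
Definition swon (P : pt) := if P is Some (x, y) then y ^+ 2 == swf x else true.

Lemma sw_smooth x : swf x = 0 -> 3%:R * x ^+ 2 + A != 0.
Proof.
move=> h; apply/eqP => h'; have := sw_disc C.
have -> : B = - x ^+ 3 - A * x by apply/eqP; rewrite -opprD -addr_eq0 addrC -/(swf x) h.
have -> : A = - (3%:R * x ^+ 2) by apply/eqP; rewrite -addr_eq0 addrC h'.
by case/eqP; ring.
Qed.

Definition swneg (P : pt) : pt := omap (fun P => (P.1, - P.2)) P.

Definition swslope (x1 y1 x2 y2 : K) :=
  if x1 == x2 then (3%:R * x1 ^+ 2 + A) / (2%:R * y1) else (y1 - y2) / (x1 - x2).

Definition swadd (P Q : pt) : pt :=
  match P, Q with
  | None, _ => Q
  | _, None => P
  | Some (x1, y1), Some (x2, y2) =>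
    if (x1 == x2) && (y1 == - y2) then None else
    let l := swslope x1 y1 x2 y2 in
    let x3 := l ^+ 2 - x1 - x2 in Some (x3, l * (x1 - x3) - y1)
  end.

(* The line y = l x + c meets the curve at P, Q, R: this is the polynomial
   identity x^3 + A x + B - (l x + c)^2 = (x - x1)(x - x2)(x - x3). *)
Definition coll (P Q R : K * K) := exists l c,
  [/\ l ^+ 2 = P.1 + Q.1 + R.1,
      A - 2%:R * l * c = P.1 * Q.1 + P.1 * R.1 + Q.1 * R.1,
      B - c ^+ 2 = - (P.1 * Q.1 * R.1)
    & [/\ P.2 = l * P.1 + c, Q.2 = l * Q.1 + c & R.2 = l * R.1 + c]].

Lemma collC P Q R : coll P Q R -> coll Q P R.
Proof.
move=> [l [c [h1 h2 h3 [p q r]]]]; exists l, c; split=> //;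
  by [rewrite h1; ring | rewrite h2; ring | rewrite h3; ring].
Qed.

Lemma coll_rot P Q R : coll P Q R -> coll Q R P.
Proof.
move=> [l [c [h1 h2 h3 [p q r]]]]; exists l, c; split=> //;
  by [rewrite h1; ring | rewrite h2; ring | rewrite h3; ring].
Qed.

Lemma collN P Q R : coll P Q R -> coll (P.1, - P.2) (Q.1, - Q.2) (R.1, - R.2).
Proof.
move=> [l [c [h1 h2 h3 [p q r]]]]; exists (- l), (- c); split => //=.
- by rewrite -h1; ring.
- by rewrite -h2; ring.
- by rewrite -h3; ring.
by rewrite p q r; split; ring.
Qed.

(** The polynomial identity in [coll] covers chords and tangents alike. It excludes opposite points:
    a common point of ordinate 0 would be a singular root of the cubic. *)
Lemma coll_addE x1 y1 x2 y2 x3 y3 : coll (x1, y1) (x2, y2) (x3, y3) ->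
  swadd (Some (x1, y1)) (Some (x2, y2)) = Some (x3, - y3).
Proof.
move=> [l [c /= [h1 h2 h3 [p q r]]]].
have tang : x1 = x2 -> 3%:R * x1 ^+ 2 + A = 2%:R * l * y1.
  move=> e; have eA : A = x1 * x2 + x1 * x3 + x2 * x3 + 2%:R * l * c by rewrite -h2 subrK.
  rewrite eA p -e mulrDr; transitivity (2%:R * l ^+ 2 * x1 + 2%:R * l * c); last by ring.
  by rewrite h1 -e; ring.
case: ifP => [/andP[/eqP e /eqP ey]|hne].
  have y0 : y1 = 0.
    have : y1 + y1 = 0 by rewrite {1}ey q p e addNr.
    by move/eqP; rewrite -mulr2n -mulr_natl mulf_eq0 (negPf two0) => /eqP.
  have fx : swf x1 = 0.
    have : swf x1 = y1 ^+ 2 + (x1 - x1) * (x1 - x2) * (x1 - x3).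
      have eA : A = x1 * x2 + x1 * x3 + x2 * x3 + 2%:R * l * c by rewrite -h2 subrK.
      have eB : B = - (x1 * x2 * x3) + c ^+ 2 by rewrite -h3 subrK.
      have e3 : x3 = l ^+ 2 - x1 - x2 by rewrite h1; ring.
      by rewrite /swf eA eB p e3; ring.
    by rewrite y0 subrr expr2 !mul0r addr0.
  by have := sw_smooth fx; rewrite tang // y0 mulr0 eqxx.
have el : swslope x1 y1 x2 y2 = l.
  rewrite /swslope; case: eqP => [e|/eqP ne].
    have y0 : y1 != 0.
      apply: contraFneq hne => y0; rewrite e eqxx /=.
      by rewrite q -e -p y0 oppr0.
    by rewrite tang //; field; rewrite y0 two0.
  by rewrite p q opprD addrACA subrr addr0 -mulrBr mulfK // subr_eq0.
rewrite el h1 /=; congr (Some (_, _)); first by ring.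
by rewrite p r; ring.
Qed.

Lemma swon_same_x x y y' : swon (Some (x, y)) -> swon (Some (x, y')) -> y' = y \/ y' = - y.
Proof.
rewrite /= => /eqP <-; rewrite eqf_sqr => /orP[] /eqP ->; by [left | right].
Qed.

Lemma coll_exists x1 y1 x2 y2 : swon (Some (x1, y1)) -> swon (Some (x2, y2)) ->
  ~~ ((x1 == x2) && (y1 == - y2)) ->
  exists x3 y3, coll (x1, y1) (x2, y2) (x3, y3) /\ swon (Some (x3, y3)).
Proof.
move=> on1 on2 hne.
suff [l [c [eA eB]]] : exists l c, let x3 := l ^+ 2 - x1 - x2 in
    [/\ A - 2%:R * l * c = x1 * x2 + x1 * x3 + x2 * x3,
      B - c ^+ 2 = - (x1 * x2 * x3), y1 = l * x1 + c & y2 = l * x2 + c].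
  move=> e1 e2; exists (l ^+ 2 - x1 - x2), (l * (l ^+ 2 - x1 - x2) + c); split.
    by exists l, c; split => //=; ring.
  have eA' := etrans (esym (subrK (2%:R * l * c) A)) (congr1 (+%R^~ _) eA).
  have eB' := etrans (esym (subrK (c ^+ 2) B)) (congr1 (+%R^~ _) eB).
  by rewrite /= /swf eA' eB'; apply/eqP; ring.
have [e|ne] := eqVneq x1 x2.
  subst x2; have [ey|ey] := swon_same_x on1 on2; last by rewrite ey opprK !eqxx in hne.
  subst y2; have y0 : y1 != 0.
    by apply: contraNneq hne => ->; rewrite eqxx oppr0 eqxx.
  pose l := (3%:R * x1 ^+ 2 + A) / (2%:R * y1); exists l, (y1 - l * x1).
  have hl : 2%:R * l * y1 = 3%:R * x1 ^+ 2 + A by rewrite /l mulrAC mulrC divfK // mulf_neq0.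
  have eB : B = y1 ^+ 2 - x1 ^+ 3 - A * x1 by rewrite (eqP on1) /swf; ring.
  have eA : A = 2%:R * l * y1 - 3%:R * x1 ^+ 2 by rewrite hl; ring.
  by clearbody l; split; rewrite ?eB ?eA; ring.
pose l := (y1 - y2) / (x1 - x2); exists l, (y1 - l * x1).
have ne0 : x1 - x2 != 0 by rewrite subr_eq0.
have hl : y2 = y1 - l * (x1 - x2) by rewrite /l divfK //; ring.
have e1 : x1 ^+ 3 + A * x1 + B = y1 ^+ 2 by rewrite (eqP on1).
have e2 : x2 ^+ 3 + A * x2 + B = (y1 - l * (x1 - x2)) ^+ 2 by rewrite -hl (eqP on2).
have eA : A = 2%:R * l * y1 - l ^+ 2 * (x1 - x2) - x1 ^+ 2 - x1 * x2 - x2 ^+ 2.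
  apply: (mulIf ne0); apply/eqP; rewrite -subr_eq0; apply/eqP.
  transitivity ((x1 ^+ 3 + A * x1 + B) - (x2 ^+ 3 + A * x2 + B) - (y1 ^+ 2 - (y1 - l * (x1 - x2)) ^+ 2)).
    by ring.
  by rewrite e1 e2 subrr.
have eB : B = y1 ^+ 2 - x1 ^+ 3 - A * x1 by rewrite -e1; ring.
by clearbody l; split; rewrite ?eB ?eA ?hl; ring.
Qed.

Lemma swneg_on P : swon (swneg P) = swon P.
Proof. by case: P => [[x y]|] //=; rewrite sqrrN. Qed.

Lemma swnegK : involutive swneg.
Proof. by case=> [[x y]|] //=; rewrite opprK. Qed.

Lemma swadd_on P Q : swon P -> swon Q -> swon (swadd P Q).
Proof.
case: P Q => [[x1 y1]|] [[x2 y2]|] // h1 h2.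
have [h|h] := boolP ((x1 == x2) && (y1 == - y2)); first by rewrite /swadd h.
have [x3 [y3 [c h3]]] := coll_exists h1 h2 h.
by rewrite (coll_addE c) -[Some _]/(swneg (Some (x3, y3))) swneg_on.
Qed.

Lemma swaddN P : swadd (swneg P) P = None.
Proof. by case: P => [[x y]|] //=; rewrite !eqxx. Qed.

Lemma opposite_sym (x1 y1 x2 y2 : K) :
  ((x1 == x2) && (y1 == - y2)) = ((x2 == x1) && (y2 == - y1)).
Proof. by rewrite eq_sym; congr (_ && _); rewrite [RHS]eq_sym eqr_oppLR. Qed.

Lemma swaddC P Q : swon P -> swon Q -> swadd P Q = swadd Q P.
Proof.
case: P Q => [[x1 y1]|] [[x2 y2]|] // h1 h2.
have [h|h] := boolP ((x1 == x2) && (y1 == - y2)).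
  by rewrite /swadd h -opposite_sym h.
have [x3 [y3 [c h3]]] := coll_exists h1 h2 h.
by rewrite (coll_addE c) (coll_addE (collC c)).
Qed.

Lemma swaddNK P Q : swon P -> swon Q -> swadd (swneg P) (swadd P Q) = Q.
Proof.
case: P Q => [[x1 y1]|] [[x2 y2]|] // h1 h2; last exact: swaddN.
have [h|h] := boolP ((x1 == x2) && (y1 == - y2)).
  by rewrite {2}/swadd h /=; case/andP: h => /eqP -> /eqP ->; rewrite opprK.
have [x3 [y3 [c h3]]] := coll_exists h1 h2 h.
rewrite (coll_addE c) -[swneg _]/(Some (x1, - y1)).
by rewrite (coll_addE (collN (coll_rot (collC c)))) /= opprK.
Qed.

(* The parabola y = t0 + t1 x + t x^2 meets the curve at P, Q, R, S. *)
Definition quad (P Q R S : K * K) := exists t0 t1 t, t != 0 /\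
  [/\ 2%:R * t * t1 - 1 = - t ^+ 2 * (P.1 + Q.1 + R.1 + S.1),
      t1 ^+ 2 + 2%:R * t * t0 = t ^+ 2 * (P.1 * Q.1 + P.1 * R.1 + P.1 * S.1
         + Q.1 * R.1 + Q.1 * S.1 + R.1 * S.1),
      2%:R * t0 * t1 - A = - t ^+ 2 * (P.1 * Q.1 * R.1 + P.1 * Q.1 * S.1
         + P.1 * R.1 * S.1 + Q.1 * R.1 * S.1),
      t0 ^+ 2 - B = t ^+ 2 * (P.1 * Q.1 * R.1 * S.1)
    & [/\ P.2 = t0 + t1 * P.1 + t * P.1 ^+ 2, Q.2 = t0 + t1 * Q.1 + t * Q.1 ^+ 2,
          R.2 = t0 + t1 * R.1 + t * R.1 ^+ 2 & S.2 = t0 + t1 * S.1 + t * S.1 ^+ 2]].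

Lemma quad_rot P Q R S : quad P Q R S -> quad Q R P S.
Proof.
move=> [t0 [t1 [t [tn [h1 h2 h3 h4 [p q r s]]]]]]; exists t0, t1, t; split => //; split=> //;
  by [rewrite h1; ring | rewrite h2; ring | rewrite h3; ring | rewrite h4; ring].
Qed.

(* The line through -(P + Q) and R, S is 1/t (x - x_{P+Q}) - L, where L is the
   line through P and Q. *)
Lemma quad_addE P Q R S : quad P Q R S ->
  swadd (swadd (Some P) (Some Q)) (Some R) = Some (S.1, - S.2).
Proof.
case: P Q R S => [x1 y1] [x2 y2] [x3 y3] [x4 y4] [t0 [t1 [t [tn [h1 h2 h3 h4 [p q r s]]]]]].
rewrite /= in h1 h2 h3 h4 p q r s.
have e1 : t1 = (1 - t ^+ 2 * (x1 + x2 + x3 + x4)) / (2%:R * t).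
  apply: (mulIf (mulf_neq0 two0 tn)); rewrite divfK ?mulf_neq0 //.
  by rewrite mulrC -[LHS](subrK 1) h1; ring.
have e0 : t0 = (t ^+ 2 * (x1 * x2 + x1 * x3 + x1 * x4 + x2 * x3 + x2 * x4 + x3 * x4) - t1 ^+ 2)
     / (2%:R * t).
  apply: (mulIf (mulf_neq0 two0 tn)); rewrite divfK ?mulf_neq0 //.
  by rewrite -h2; ring.
have eA : A = 2%:R * t0 * t1 + t ^+ 2 * (x1 * x2 * x3 + x1 * x2 * x4 + x1 * x3 * x4 + x2 * x3 * x4).
  by apply/eqP; rewrite eq_sym -subr_eq0; apply/eqP;
     rewrite -[RHS](subrr (2%:R * t0 * t1 - A)) {2}h3; ring.
have eB : B = t0 ^+ 2 - t ^+ 2 * (x1 * x2 * x3 * x4) by rewrite -h4; ring.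
pose l := t1 + t * (x1 + x2); pose c := t0 - t * x1 * x2.
pose xs := l ^+ 2 - x1 - x2; pose ys := l * xs + c.
have c1 : coll (x1, y1) (x2, y2) (xs, ys).
  exists l, c; split => /=.
  - by rewrite /xs; ring.
  - by rewrite /xs /l /c eA e0 e1; field; rewrite tn two0.
  - by rewrite /xs /l /c eB e0 e1; field; rewrite tn two0.
  by split; rewrite ?p ?q /ys /l /c //; ring.
rewrite (coll_addE c1).
have c2 : coll (xs, - ys) (x3, y3) (x4, y4).
  exists (t^-1 - l), (- c - xs / t); split => /=.
  - by rewrite /xs /l /c e1; field; rewrite tn two0.
  - by rewrite /xs /l /c eA e0 e1; field; rewrite tn two0.
  - by rewrite /xs /l /c eB e0 e1; field; rewrite tn two0.
  split; first by rewrite /ys; field.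
  - by rewrite r /xs /l /c e0 e1; field; rewrite tn two0.
  by rewrite s /xs /l /c e0 e1; field; rewrite tn two0.
exact: coll_addE c2.
Qed.

Lemma quad_exists x1 y1 x2 y2 x3 y3 :
  swon (Some (x1, y1)) -> swon (Some (x2, y2)) -> swon (Some (x3, y3)) ->
  ~~ ((x1 == x2) && (y1 == - y2)) -> ~~ ((x2 == x3) && (y2 == - y3)) ->
  ~~ ((x1 == x3) && (y1 == - y3)) ->
  coll (x1, y1) (x2, y2) (x3, y3) \/
  exists S, quad (x1, y1) (x2, y2) (x3, y3) S.
Proof.
move=> on1 on2 on3 n12 n23 n13.
have [xs [ys [[l [c /= [h1 h2 h3 [p q r]]]] ons]]] := coll_exists on1 on2 n12.
have eA : A = x1 * x2 + x1 * xs + x2 * xs + 2%:R * l * c by rewrite -h2 subrK.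
have eB : B = c ^+ 2 - x1 * x2 * xs by rewrite addrC -h3 subrK.
have es : xs = l ^+ 2 - x1 - x2 by rewrite h1; ring.
pose L3 := l * x3 + c; pose g3 := (x3 - x1) * (x3 - x2).
(* On y = l x + c + t (x - x1) (x - x2), the cubic minus y^2 is (x - x1) (x - x2) times a quadratic
   factor, which must vanish at x3. If x3 differs from x1 and x2, passing through R determines t and
   the vanishing follows; if R equals P or Q, the vanishing expresses tangency and determines t. *)
have [t [ht1 ht2]] : exists t, y3 = L3 + t * g3 /\ x3 - xs - 2%:R * t * L3 - t ^+ 2 * g3 = 0.
  have f3 : y3 ^+ 2 - L3 ^+ 2 = g3 * (x3 - xs).
    by rewrite (eqP on3) /swf eA eB /L3 /g3 es; ring.
  have [g0|g0] := eqVneq g3 0; last first.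
    exists ((y3 - L3) / g3); split; first by rewrite divfK //; ring.
    apply: (mulIf g0); rewrite mul0r !mulrBl -[x3 * g3 - xs * g3]mulrBl [(x3 - xs) * g3]mulrC -f3.
    by field.
  have [ey y0] : y3 = L3 /\ y3 != 0.
    move/eqP: g0; rewrite mulf_eq0 !subr_eq0 => /orP[] /eqP e.
      have e13 : y3 = y1.
        have := on3; rewrite e => on3'; have [//|e'] := swon_same_x on1 on3'.
        by rewrite e e' opprK !eqxx in n13.
      split; first by rewrite /L3 e e13.
      by apply: contraNneq n13; rewrite e e13 => ->; rewrite eqxx oppr0 eqxx.
    have e23 : y3 = y2.
      have := on3; rewrite e => on3'; have [//|e'] := swon_same_x on2 on3'.
      by rewrite e e' opprK !eqxx in n23.
    split; first by rewrite /L3 e e23.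
    by apply: contraNneq n23; rewrite e e23 => ->; rewrite eqxx oppr0 eqxx.
  exists ((x3 - xs) / (2%:R * y3)); rewrite g0 !mulr0 addr0 subr0 -ey; split => //.
  by field; rewrite y0 two0.
have [t0|tn] := eqVneq t 0.
  left; move: ht1 ht2; rewrite t0 mul0r addr0 mulr0 mul0r expr0n mul0r !subr0 => ht1 /eqP.
  by rewrite subr_eq0 => /eqP e; rewrite -e in h1 h2 h3; exists l, c.
right; pose x4 := (1 - 2%:R * t * l) / t ^+ 2 + x1 + x2 - x3.
pose u1 := l - t * (x1 + x2); pose u0 := c + t * x1 * x2.
exists (x4, u0 + u1 * x4 + t * x4 ^+ 2), u0, u1, t; split => //=.
have hx4 : t ^+ 2 * (x3 + x4) = 1 - 2%:R * t * l + t ^+ 2 * (x1 + x2).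
  by rewrite /x4; field.
have hx34 : t ^+ 2 * (x3 * x4) = xs + 2%:R * t * c + t ^+ 2 * (x1 * x2).
  have -> : t ^+ 2 * (x3 * x4) = x3 * (t ^+ 2 * (x3 + x4)) - t ^+ 2 * x3 ^+ 2 by ring.
  rewrite hx4; apply/eqP; rewrite -subr_eq0 -ht2; apply/eqP.
  by rewrite /g3 /L3; ring.
split.
- transitivity (- (t ^+ 2 * (x3 + x4)) - t ^+ 2 * (x1 + x2)); last by ring.
  by rewrite hx4 /u1; ring.
- transitivity (t ^+ 2 * (x1 * x2) + (x1 + x2) * (t ^+ 2 * (x3 + x4)) + t ^+ 2 * (x3 * x4)); last by ring.
  by rewrite hx4 hx34 /u1 /u0 es; ring.
- transitivity (- (x1 * x2) * (t ^+ 2 * (x3 + x4)) - (x1 + x2) * (t ^+ 2 * (x3 * x4))); last by ring.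
  by rewrite hx4 hx34 /u1 /u0 eA es; ring.
- transitivity (x1 * x2 * (t ^+ 2 * (x3 * x4))); last by ring.
  by rewrite hx34 /u0 eB es; ring.
split.
- by rewrite p /u1 /u0; ring.
- by rewrite q /u1 /u0; ring.
- by rewrite ht1 /L3 /g3 /u1 /u0; ring.
by [].
Qed.

(** If two of the points are opposite, cancellation suffices. Otherwise the sum is read off from a
    line or a parabola through the three points, which may be permuted cyclically. *)
Lemma swaddA P Q R : swon P -> swon Q -> swon R ->
  swadd P (swadd Q R) = swadd (swadd P Q) R.
Proof.
move=> h1 h2 h3.
case: P Q R h1 h2 h3 => [[x1 y1]|] [[x2 y2]|] [[x3 y3]|] // h1 h2 h3; last first.
  by rewrite [RHS]swaddC // swadd_on.
have on12 := swadd_on h1 h2; have on23 := swadd_on h2 h3.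
have [n12|n12] := boolP ((x1 == x2) && (y1 == - y2)).
  have e : Some (x1, y1) = swneg (Some (x2, y2)) by case/andP: n12 => /eqP -> /eqP ->.
  by rewrite e swaddNK // swaddN.
have [n23|n23] := boolP ((x2 == x3) && (y2 == - y3)).
  have e : Some (x3, y3) = swneg (Some (x2, y2)).
    by move: n23; rewrite opposite_sym => /andP[/eqP -> /eqP ->].
  have h2' : swon (swneg (Some (x2, y2))) by rewrite swneg_on.
  by rewrite e [in LHS](swaddC h2 h2') swaddN [RHS](swaddC on12 h2') (swaddC h1 h2) swaddNK.
have [n13|n13] := boolP ((x1 == x3) && (y1 == - y3)).
  have e : Some (x3, y3) = swneg (Some (x1, y1)).
    by move: n13; rewrite opposite_sym => /andP[/eqP -> /eqP ->].
  have h1' : swon (swneg (Some (x1, y1))) by rewrite swneg_on.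
  rewrite e [RHS](swaddC on12 h1') swaddNK // (swaddC h2 h1').
  by have := swaddNK h1' h2; rewrite swnegK.
have [c|[S s]] := quad_exists h1 h2 h3 n12 n23 n13.
  rewrite (coll_addE c) (coll_addE (coll_rot c)).
  by rewrite -[Some (x3, - y3)]/(swneg (Some (x3, y3))) swaddN swaddC //= ?sqrrN // !eqxx.
rewrite (quad_addE s) swaddC // (quad_addE (quad_rot s)) //.
Qed.

End GroupLaw.

Record swpoint (K : fieldType) (C : swcurve K) := SwPoint {
  swval :> option (K * K); swvalP : swon C swval }.

HB.instance Definition _ (K : fieldType) (C : swcurve K) := [isSub for @swval K C].
HB.instance Definition _ (K : fieldType) (C : swcurve K) := [Choice of swpoint C by <:].

Section SwZmod.
Variables (K : fieldType) (C : swcurve K).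
Implicit Types P Q : swpoint C.

Definition swp0 : swpoint C := @SwPoint K C None isT.
Definition swpN P : swpoint C := @SwPoint K C (swneg P) (etrans (swneg_on C P) (swvalP P)).
Definition swpD P Q : swpoint C := SwPoint (swadd_on (swvalP P) (swvalP Q)).

Lemma swpDA : associative swpD.
Proof. by move=> P Q R; apply: val_inj; exact: swaddA (swvalP P) (swvalP Q) (swvalP R). Qed.
Lemma swpDC : commutative swpD.
Proof. by move=> P Q; apply: val_inj; exact: swaddC (swvalP P) (swvalP Q). Qed.
Lemma swp0D : left_id swp0 swpD.
Proof. by move=> P; apply: val_inj. Qed.
Lemma swpND : left_inverse swp0 swpN swpD.
Proof. by move=> P; apply: val_inj; exact: swaddN. Qed.

End SwZmod.

HB.instance Definition _ (K : fieldType) (C : swcurve K) :=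
  GRing.isZmodule.Build (swpoint C) (@swpDA K C) (@swpDC K C) (@swp0D K C) (@swpND K C).

(** * Abscissas of multiples *)

Section Multiplication.
Variables (K : closedFieldType) (C : swcurve K).
Local Notation A := (swA C).
Local Notation B := (swB C).

Let two0 : 2%:R != 0 :> K := sw_two C.

(* (a : b) is the x-coordinate of P in the projective line. *)
Definition xrel (P : option (K * K)) (a b : K) :=
  if P is Some (x, _) then b * x = a else b = 0.

(* With (a : b) = x(R) and x = x(P), the roots of bqC T^2 - bqS T + bqP are
   x(R + P) and x(R - P). *)
Definition bqC (x a b : K) := (a - x * b) ^+ 2.
Definition bqS (x a b : K) := 2%:R * ((a + x * b) * (A * b + a * x) + 2%:R * B * b ^+ 2).
Definition bqP (x a b : K) := (A * b - a * x) ^+ 2 - 4%:R * B * b * (a + x * b).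

Lemma swvalN (P : swpoint C) x y : swval P = Some (x, y) -> swval (- P) = Some (x, - y).
Proof. by move=> e; rewrite -[swval (- P)]/(swneg (swval P)) e. Qed.

Lemma swvalD (P Q : swpoint C) : swval (P + Q) = swadd C (swval P) (swval Q).
Proof. by []. Qed.

(** Differential addition on abscissas. Homogeneous coordinates of R + P are scaled against those of
    R - P so that the three relations are equalities and not merely proportionalities; this allows
    them to be read as polynomial identities in x. *)
Lemma biquad (R P : swpoint C) x y a b a' b' : swval P = Some (x, y) ->
  xrel (swval R) a b -> (a, b) != (0, 0) ->
  xrel (swval (R - P)) a' b' -> (a', b') != (0, 0) ->
  exists a1 b1, [/\ xrel (swval (R + P)) a1 b1, (a1, b1) != (0, 0),
    bqC x a b = b1 * b', bqS x a b = a1 * b' + a' * b1 & bqP x a b = a1 * a'].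
Proof.
rewrite !xpair_eqE => eP hR nR hRP nRP.
have onP : y ^+ 2 = swf C x by have := swvalP P; rewrite eP => /eqP.
rewrite !swvalD in hRP *; rewrite (swvalN eP) eP in hRP *.
have onR := swvalP R.
case: (swval R) hR hRP onR => [[X Y]|] /=; last first.
  move=> b0 hx _; subst b.
  have a0 : a != 0 by move: nR; rewrite eqxx andbT.
  have b'0 : b' != 0 by apply: contraNneq nRP => e; rewrite -hx e mul0r eqxx.
  exists (a ^+ 2 * x / b'), (a ^+ 2 / b'); split.
  - by field.
  - by rewrite xpair_eqE negb_and orbC mulf_neq0 ?invr_eq0 ?expf_neq0.
  - by rewrite /bqC; field.
  - by rewrite /bqS -hx; field.
  by rewrite /bqP -hx; field.
move=> ea hRP /eqP onR; subst a.
have b0 : b != 0 by apply: contraNneq nR => ->; rewrite mul0r eqxx.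
have eB : B = Y ^+ 2 - X ^+ 3 - A * X by rewrite onR /swf; ring.
have [eX|neX] := eqVneq X x; last first.
  rewrite (negPf neX) /= in hRP *.
  have d0 : X - x != 0 by rewrite subr_eq0.
  have eA : A = (Y ^+ 2 - y ^+ 2) / (X - x) - X ^+ 2 - X * x - x ^+ 2.
    apply: (mulIf d0).
    transitivity ((Y ^+ 2 - y ^+ 2) - (X ^+ 2 + X * x + x ^+ 2) * (X - x)); last by field.
    by rewrite onR onP /swf; ring.
  move: hRP; rewrite /swslope (negPf neX) opprK => hRP.
  have b'0 : b' != 0 by apply: contraNneq nRP => e; rewrite -hRP e mul0r eqxx.
  pose x1 := ((Y - y) / (X - x)) ^+ 2 - X - x.
  exists (b ^+ 2 * (X - x) ^+ 2 / b' * x1), (b ^+ 2 * (X - x) ^+ 2 / b'); split.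
  - by rewrite /x1.
  - have nz : b ^+ 2 * (X - x) ^+ 2 / b' != 0 by rewrite !mulf_neq0 ?invr_eq0 ?expf_neq0.
    by rewrite xpair_eqE negb_and nz orbT.
  - by rewrite /bqC; field.
  - by rewrite /bqS -hRP /x1 eB eA; field; rewrite d0 b'0.
  by rewrite /bqP -hRP /x1 eB eA; field; rewrite d0 b'0.
subst X; rewrite eqxx /= in hRP *.
have S4 : bqS x (b * x) b = 4%:R * b ^+ 2 * y ^+ 2 by rewrite /bqS onP /swf; ring.
have C0 : bqC x (b * x) b = 0 by rewrite /bqC; ring.
have four0 : 4%:R != 0 :> K by rewrite (_ : 4%:R = 2%:R * 2%:R :> K) ?mulf_neq0 // -natrM.
have dbl z : z != 0 -> z ^+ 2 = y ^+ 2 ->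
    4%:R * b ^+ 2 * y ^+ 2 * (swslope C x z x z ^+ 2 - x - x) = bqP x (b * x) b.
  move=> z0 zy; have := onP; rewrite -zy => h.
  have eB' : B = z ^+ 2 - x ^+ 3 - A * x by rewrite h /swf; ring.
  by rewrite /swslope eqxx /bqP eB'; field; rewrite z0 two0.
have : (Y - y) * (Y + y) = 0.
  by rewrite -subr_sqr onR onP subrr.
move/eqP; rewrite mulf_eq0 subr_eq0 addr_eq0.
have [y0|y0] := eqVneq y 0.
  move: hRP; rewrite y0 !oppr0 orbb => hRP /eqP eY; move: hRP.
  rewrite eY eqxx /= => hb'; subst b'.
  have a'0 : a' != 0 by move: nRP; rewrite eqxx andbT.
  have fx : swf C x = 0 by rewrite -onP y0 expr0n.
  have pE : bqP x (b * x) b = b ^+ 2 * (3%:R * x ^+ 2 + A) ^+ 2.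
    have eB' : B = - x ^+ 3 - A * x by rewrite eB eY expr0n sub0r.
    by rewrite /bqP eB'; ring.
  have p0 : bqP x (b * x) b != 0 by rewrite pE mulf_neq0 ?expf_neq0 // sw_smooth.
  exists (bqP x (b * x) b / a'), 0; split => //.
  - by rewrite xpair_eqE eqxx andbT mulf_neq0 ?invr_eq0.
  - by rewrite C0 mul0r.
  - by rewrite S4 y0; ring.
  by rewrite divfK.
have s0 : 4%:R * b ^+ 2 * y ^+ 2 != 0 by rewrite !mulf_neq0 ?expf_neq0.
have nyy : (y == - y) = false.
  by apply: contraNF y0 => /eqP e; rewrite -(mulrI_eq0 _ (mulfI two0)) mulr_natl mulr2n {2}e addrN.
case/orP => /eqP eY; subst Y.
  move: hRP; rewrite opprK eqxx nyy /= => hb'; subst b'.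
  have a'0 : a' != 0 by move: nRP; rewrite eqxx andbT.
  exists (bqP x (b * x) b / a'), (bqS x (b * x) b / a'); split.
  - by rewrite -(dbl y) // S4; field.
  - by rewrite xpair_eqE negb_and orbC mulf_neq0 ?invr_eq0 // S4.
  - by rewrite C0 mulr0.
  - by rewrite mulr0 add0r; field.
  by rewrite divfK.
move: hRP; rewrite opprK eq_sym nyy eqxx /= => hRP.
have ny0 : - y != 0 by rewrite oppr_eq0.
have b'0 : b' != 0 by apply: contraNneq nRP => e; rewrite -hRP e mul0r eqxx.
exists (bqS x (b * x) b / b'), 0; split => //.
- by rewrite xpair_eqE eqxx andbT mulf_neq0 ?invr_eq0 // S4.
- by rewrite C0 mul0r.
- by rewrite divfK // mulr0 addr0.
by rewrite -(dbl (- y)) ?sqrrN // -hRP S4; field.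
Qed.

Lemma point_above x : exists (P : swpoint C) y, swval P = Some (x, y).
Proof.
have /closed_rootP[y] : size ('X^2 - (swf C x)%:P : {poly K}) != 1%N.
  by rewrite size_polyDl size_polyXn // size_polyN (leq_ltn_trans (size_polyC_leq1 _)).
rewrite /root !hornerE subr_eq0 => h.
have on : swon C (Some (x, y)) by [].
by exists (SwPoint on), y.
Qed.

Lemma poly_ext (r s : {poly K}) : (forall x, r.[x] = s.[x]) -> r = s.
Proof.
move=> h; apply/eqP; rewrite -subr_eq0; apply/negPn/negP => /closed_nonrootP[x].
by rewrite /root !hornerE h subrr eqxx.
Qed.

(** Multiplication by n on abscissas as a fraction N / D in lowest terms, of degree n^2. *)
Definition xpoly n (N D : {poly K}) := [/\ N \is monic, size N = (n ^ 2).+1,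
  (size D <= n ^ 2)%N, (forall x, (N.[x], D.[x]) != (0, 0))
  & forall (P : swpoint C) x y, swval P = Some (x, y) -> xrel (swval (P *+ n)) N.[x] D.[x]].

(** The relations are applied to R = (n + 1) P, with R - P = n P already known. The old fraction is
    a root of the quadratic with coefficients [Cp], [Sp], [Pp]; being in lowest terms, it forces the
    divisibilities that produce the other root. *)
Lemma xpoly_step n N D N' D' : xpoly n N' D' -> xpoly n.+1 N D ->
  exists N2 D2, xpoly n.+2 N2 D2.
Proof.
move=> [mN' sN' sD' cop' h'] [mN sN sD cop h].
have N'0 := monic_neq0 mN'.
pose Cp := (N - 'X * D) ^+ 2.
pose Sp := 2%:R *: ((N + 'X * D) * (A *: D + N * 'X) + (2%:R * B) *: D ^+ 2).
pose Pp := (A *: D - N * 'X) ^+ 2 - (4%:R * B) *: (D * (N + 'X * D)).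
have CE x : Cp.[x] = bqC x N.[x] D.[x] by rewrite /Cp /bqC !hornerE.
have SE x : Sp.[x] = bqS x N.[x] D.[x] by rewrite /Sp /bqS !hornerE.
have PE x : Pp.[x] = bqP x N.[x] D.[x] by rewrite /Pp /bqP !hornerE /=; ring.
have bq (P : swpoint C) x y : swval P = Some (x, y) ->
    exists a1 b1, [/\ xrel (swval (P *+ n.+2)) a1 b1, (a1, b1) != (0, 0),
    Cp.[x] = b1 * D'.[x], Sp.[x] = a1 * D'.[x] + N'.[x] * b1 & Pp.[x] = a1 * N'.[x]].
  move=> eP; rewrite CE SE PE mulrSr; apply: (biquad eP (h _ _ _ eP) (cop x) _ (cop' x)).
  by rewrite mulrSr addrK; exact: h' eP.
have gen (c s r u v : {poly K}) x : (c * u ^+ 2 - s * u * v + r * v ^+ 2).[x] =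
    c.[x] * u.[x] ^+ 2 - s.[x] * u.[x] * v.[x] + r.[x] * v.[x] ^+ 2.
  by rewrite !(hornerE, horner_exp).
have idn : Cp * N' ^+ 2 - Sp * N' * D' + Pp * D' ^+ 2 = 0.
  apply: poly_ext => x; have [P [y eP]] := point_above x.
  have [a1 [b1 [_ _ e1 e2 e3]]] := bq P x y eP.
  by rewrite horner0 gen e1 e2 e3; ring.
have cp : coprimep N' D'.
  apply: Pdiv.ClosedField.root_coprimep => x /eqP rx; apply/eqP => dx.
  by move: (cop' x); rewrite rx dx eqxx.
have dP : N' %| Pp.
  rewrite -(Gauss_dvdpl _ (coprimep_expr 2 cp)).
  have -> : Pp * D' ^+ 2 = N' * (Sp * D' - Cp * N').
    by apply/eqP; rewrite -subr_eq0 -idn; apply/eqP; ring.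
  exact: dvdp_mulIl.
pose N2 := Pp %/ N'.
have eN2 : N2 * N' = Pp by rewrite divpK.
have idn2 : D' * (Sp - N2 * D') = Cp * N'.
  apply: (mulIf N'0); apply/eqP; rewrite -subr_eq0; apply/eqP.
  by rewrite -[RHS]oppr0 -idn -eN2; ring.
have dS : N' %| Sp - N2 * D'.
  by rewrite -(Gauss_dvdpr _ cp) idn2 dvdp_mulIr.
(* Obtained from the sum of the roots rather than as [Cp %/ D'], because D' is 0 when n = 0. *)
pose D2 := (Sp - N2 * D') %/ N'.
have eD2 : D2 * N' = Sp - N2 * D' by rewrite divpK.
have eC : D2 * D' = Cp.
  by apply: (mulIf N'0); rewrite -mulrA [D' * N']mulrC mulrA eD2 mulrC idn2.
have sNX : size (N * 'X) = (n.+1 ^ 2).+2 by rewrite size_mulX ?monic_neq0 // sN.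
have sXD : (size ('X * D)%R <= (n.+1 ^ 2).+1)%N.
  by apply: leq_trans (size_polyMleq _ _) _; rewrite size_polyX.
have sNXD : (size (N + 'X * D)%R <= (n.+1 ^ 2).+1)%N.
  by apply: leq_trans (size_polyD _ _) _; rewrite geq_max sN leqnn.
have sAD c : (size (c *: D)%R <= n.+1 ^ 2)%N by apply: leq_trans (size_scale_leq _ _) _.
have mNX : N * 'X \is monic by rewrite monicMr // monicX.
have [mP sP] : Pp \is monic /\ size Pp = (2 * n.+1 ^ 2 + 3)%N.
  have e1 : (A *: D - N * 'X) ^+ 2 = (N * 'X - A *: D) ^+ 2 by rewrite -opprB sqrrN.
  have s1 : size (N * 'X - A *: D) = (n.+1 ^ 2).+2.
    by rewrite size_polyDl ?sNX // size_polyN (leq_ltn_trans (sAD _)) // ltnW.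
  have m1 : N * 'X - A *: D \is monic.
    rewrite monicE lead_coefDl -?monicE // size_polyN sNX.
    by rewrite (leq_ltn_trans (sAD _)) // ltnW.
  have s2 : size ((N * 'X - A *: D) ^+ 2) = (2 * n.+1 ^ 2 + 3)%N.
    by rewrite expr2 size_monicM // ?monic_neq0 // s1; lia.
  have s3 : (size (- ((4%:R * B) *: (D * (N + 'X * D))))%R < 2 * n.+1 ^ 2 + 3)%N.
    rewrite size_polyN; apply: leq_ltn_trans (size_scale_leq _ _) _.
    apply: leq_ltn_trans (size_polyMleq _ _) _; move: sD sNXD; clear.
    by move: (size _) (size _) (n.+1 ^ 2)%N => u v w; lia.
  rewrite /Pp e1; split; last by rewrite size_polyDl s2.
  by rewrite monicE lead_coefDl ?s2 // -monicE monic_exp.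
have mN2 : N2 \is monic by move: mP; rewrite -eN2 monicMr.
have sN2 : size N2 = (n.+2 ^ 2).+1.
  have : size (N2 * N') = (2 * n.+1 ^ 2 + 3)%N by rewrite eN2.
  by rewrite size_monicM // sN'; move: (size N2) => u; clear; nia.
have sS : (size Sp <= 2 * n.+1 ^ 2 + 2)%N.
  apply: leq_trans (size_scale_leq _ _) _; apply: leq_trans (size_polyD _ _) _.
  rewrite geq_max; apply/andP; split.
    apply: leq_trans (size_polyMleq _ _) _.
    have : (size (A *: D + N * 'X)%R <= (n.+1 ^ 2).+2)%N.
      apply: leq_trans (size_polyD _ _) _; rewrite geq_max sNX leqnn andbT.
      by apply: leq_trans (sAD _) _; rewrite ltnW.
    move: sNXD; clear.
    by move: (size _) (size _) (n.+1 ^ 2)%N => u v w; lia.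
  apply: leq_trans (size_scale_leq _ _) _; rewrite expr2.
  apply: leq_trans (size_polyMleq _ _) _; move: sD; clear.
  by move: (size _) (n.+1 ^ 2)%N => u w; lia.
have sND : (size (N2 * D')%R <= 2 * n.+1 ^ 2 + 2)%N.
  apply: leq_trans (size_polyMleq _ _) _; rewrite sN2; move: sD'; clear.
  by move: (size _) => u; nia.
have sD2 : (size D2 <= n.+2 ^ 2)%N.
  have [->|D20] := eqVneq D2 0; first by rewrite size_poly0.
  have : (size (D2 * N')%R <= 2 * n.+1 ^ 2 + 2)%N.
    rewrite eD2; apply: leq_trans (size_polyD _ _) _.
    by rewrite size_polyN geq_max sS.
  by rewrite size_mul // sN'; move: (size D2) => u; clear; nia.
have main (P : swpoint C) x y : swval P = Some (x, y) ->
    xrel (swval (P *+ n.+2)) N2.[x] D2.[x] /\ (N2.[x], D2.[x]) != (0, 0).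
  move=> eP; have [a1 [b1 [r nz e1 e2 e3]]] := bq P x y eP.
  suff [-> ->] : N2.[x] = a1 /\ D2.[x] = b1 by [].
  have f1 : D2.[x] * D'.[x] = b1 * D'.[x] by rewrite -e1 -eC hornerM.
  have f3 : N2.[x] * N'.[x] = a1 * N'.[x] by rewrite -e3 -eN2 hornerM.
  have f2 : N2.[x] * D'.[x] + N'.[x] * D2.[x] = a1 * D'.[x] + N'.[x] * b1.
    by rewrite -e2 -[Sp](subrK (N2 * D')) -eD2 !hornerE; ring.
  have [d0|d0] := eqVneq D'.[x] 0.
    have n0 : N'.[x] != 0 by move: (cop' x); rewrite d0 xpair_eqE eqxx andbT.
    split; first exact: (mulIf n0).
    by move: f2; rewrite d0 !mulr0 !add0r => /(mulfI n0).
  have e : D2.[x] = b1 by exact: (mulIf d0).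
  by split => //; apply: (mulIf d0); move: f2; rewrite e => /addIr.
exists N2, D2; split => //.
  by move=> x; have [P [y eP]] := point_above x; case: (main P x y eP).
by move=> P x y eP; case: (main P x y eP).
Qed.

Lemma xpoly_exists n : exists N D, xpoly n N D.
Proof.
suff [//] : (exists N D, xpoly n N D) /\ (exists N D, xpoly n.+1 N D).
elim: n => [|n [[N' [D' h']] [N [D h]]]]; last first.
  by split; [exists N, D | exact: xpoly_step h' h].
split.
  exists 1, 0; split; rewrite ?monic1 ?size_poly1 ?size_poly0 //.
    by move=> x; rewrite !hornerE xpair_eqE oner_eq0.
  by move=> P x y _; rewrite mulr0n /= horner0.
exists 'X, 1; split; rewrite ?monicX ?size_polyX ?size_poly1 //.
  by move=> x; rewrite !hornerE xpair_eqE oner_eq0 andbF.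
by move=> P x y eP; rewrite mulr1n eP /= !hornerE.
Qed.

End Multiplication.

(** * Hasse invariant *)

Section HasseInvariant.
Variables (K : closedFieldType) (p : nat).
Hypotheses (hp : p \in [pchar K]) (p2 : odd p).

Let pr : prime p. Proof. exact: pcharf_prime hp. Qed.
Let p_gt0 : (0 < p)%N. Proof. exact: prime_gt0. Qed.

(* Modulo p, the trace of Frobenius of y^2 = f(x) over the field with Q elements. *)
Definition hasse (f : {poly K}) (Q : nat) : K := (f ^+ Q.-1./2)`_Q.-1.

Lemma polyX_pchar (g : {poly K}) : g ^+ p = \sum_(i < size g) (g`_i ^+ p) *: 'X^(p * i).
Proof.
have hpP : p \in [pchar {poly K}] by rewrite pchar_poly.
rewrite -[g in LHS]coefK poly_def -(pFrobenius_autE hpP) rmorph_sum /=.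
apply: eq_bigr => i _; rewrite pFrobenius_autE exprZn.
by congr (_ *: _); rewrite -exprM mulnC.
Qed.

(** The exponent splits as (p Q - 1)/2 = (p - 1)/2 + p (Q - 1)/2. The second factor is a p-th power,
    with exponents multiple of p, and the first has degree below 2 p - 1; a single product of terms
    reaches degree p Q - 1. *)
Lemma hasse_step (f : {poly K}) (Q : nat) : (size f <= 4)%N -> odd Q ->
  hasse f (p * Q) = hasse f p * hasse f Q ^+ p.
Proof.
move=> sf oQ; rewrite /hasse.
have eN : ((p * Q).-1./2 = p.-1./2 + Q.-1./2 * p)%N.
  have := odd_double_half p; have := odd_double_half Q; rewrite p2 oQ !add1n => <- <-.
  rewrite /= !doubleK; move: (p./2) (Q./2) => u v; nia.
rewrite eN exprD exprM; set h := f ^+ p.-1./2; set g := f ^+ Q.-1./2.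
have sh : (size h <= p + p.-1)%N.
  apply: leq_trans (size_poly_exp_leq _ _) _.
  have := odd_double_half p; rewrite p2 add1n => e.
  have : ((size f).-1 <= 3)%N by lia.
  by rewrite -e /= doubleK; move: (size f).-1 (p./2) => u v; clear; nia.
rewrite polyX_pchar mulr_sumr coef_sum.
under eq_bigr => i _ do rewrite -scalerAr coefZ coefMXn.
have Q0 : (0 < Q)%N by case: Q oQ {eN g}.
have main i : (if ((p * Q).-1 < p * i)%N then 0 else h`_((p * Q).-1 - p * i)) =
    if i == Q.-1 then h`_p.-1 else 0.
  have [->|ne] := eqVneq i Q.-1.
    have -> : ((p * Q).-1 - p * Q.-1 = p.-1)%N by case: Q Q0 {oQ eN g} => // Q' _; rewrite mulnS /=; lia.
    by rewrite ltnNge (_ : p * Q.-1 <= (p * Q).-1)%N //; case: Q Q0 {oQ eN g} => // Q' _; rewrite mulnS /=; lia.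
  case: ltnP => // hle; apply: nth_default; apply: leq_trans sh _.
  have : (i < Q.-1)%N.
    rewrite ltn_neqAle ne /=; have : (p * i < p * Q)%N.
      by apply: leq_ltn_trans hle _; rewrite prednK // muln_gt0 p_gt0.
    by rewrite ltn_pmul2l //; lia.
  by move: p_gt0 Q0; clear; nia.
under eq_bigr => i _ do rewrite main.
have [sg|sg] := ltnP Q.-1 (size g).
  rewrite (bigD1 (Ordinal sg)) //= eqxx big1 ?addr0; first by rewrite mulrC.
  by move=> i; rewrite -val_eqE /= => /negPf ->; rewrite mulr0.
rewrite [g`_Q.-1]nth_default // expr0n (gtn_eqF p_gt0) mulr0 big1 // => i _.
by rewrite ltn_eqF ?mulr0 // (leq_trans (ltn_ord i)).
Qed.

Lemma hasse_pow (f : {poly K}) n : (size f <= 4)%N ->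
  (hasse f (p ^ n.+1) == 0) = (hasse f p == 0).
Proof.
move=> sf; elim: n => [|n IH]; first by rewrite expn1.
rewrite expnS hasse_step // ?oddX ?p2 ?orbT // mulf_eq0 expf_eq0 p_gt0 /= IH orbb //.
Qed.

Section CountQ.
Variable J : nat.
Hypothesis J0 : (0 < J)%N.
Local Notation Q := (p ^ J)%N.

Let oQ : odd Q. Proof. by rewrite oddX p2 orbT. Qed.
Let Q1 : (1 < Q)%N. Proof. by rewrite -(expn0 p) ltn_exp2l ?prime_gt1. Qed.
Let QK : Q%:R = 0 :> K.
Proof. by rewrite natrX (pcharf0 hp) expr0n gtn_eqF. Qed.

Lemma fixed_list : exists xs : seq K, [/\ uniq xs, size xs = Q
  & forall x, (x \in xs) = (x ^+ Q == x)].
Proof.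
have [xs exs] := closed_field_poly_normal ('X^Q - 'X : {poly K}).
have sX : size ('X^Q - 'X : {poly K}) = Q.+1.
  by rewrite size_polyDl size_polyXn // size_polyN size_polyX ltnS.
have lX : lead_coef ('X^Q - 'X : {poly K}) = 1.
  by rewrite lead_coefDl ?lead_coefXn // size_polyXn size_polyN size_polyX.
rewrite lX scale1r in exs; exists xs; split.
- rewrite -separable_prod_XsubC -exs unlock derivB derivXn derivX -scaler_nat QK scale0r.
  by rewrite sub0r -(scaleN1r (1 : {poly K})) coprimepZr ?oppr_eq0 ?oner_eq0 // coprimep1.
- by have := congr1 (fun r : {poly K} => size r) exs; rewrite sX size_prod_XsubC => -[].
by move=> x; rewrite -root_prod_XsubC -exs /root !hornerE subr_eq0.
Qed.

Variables (xs : seq K).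
Hypotheses (uxs : uniq xs) (sxs : size xs = Q) (mxs : forall x, (x \in xs) = (x ^+ Q == x)).

Let Qodd : (Q = (Q.-1./2).*2.+1)%N.
Proof. by have := odd_double_half Q; rewrite oQ add1n => e; rewrite -[in RHS]e /= doubleK e. Qed.

Lemma fixed_unit x : x != 0 -> (x \in xs) = (x ^+ Q.-1 == 1).
Proof.
move=> x0; have e : x ^+ Q = x * x ^+ Q.-1 by rewrite -exprS prednK // ltnW.
by rewrite mxs e -[X in (_ == X) = _]mulr1 (inj_eq (mulfI x0)).
Qed.

Lemma power_sum_lt i : (i < Q.-1)%N -> \sum_(x <- xs) x ^+ i = 0.
Proof.
case: i => [|i] hi.
  by rewrite (eq_bigr (fun _ => 1)) // big_const_seq count_predT sxs iter_addr_0 -mulr_natr mul1r QK.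
have [w [w0 wxs wi]] : exists w, [/\ w != 0, w \in xs & w ^+ i.+1 != 1].
  have : ~~ all (root ('X^(i.+1) - 1)) (rem 0 xs).
    apply/negP => h.
    have X0 : 'X^(i.+1) - 1 != 0 :> {poly K}.
      by rewrite -size_poly_eq0 size_polyDl size_polyXn // size_polyN size_poly1.
    have := max_poly_roots X0 h (rem_uniq _ uxs).
    rewrite size_polyDl size_polyXn ?size_polyN ?size_poly1 // size_rem ?sxs.
      by move=> h'; have := leq_trans hi (ltnSE h'); rewrite ltnn.
    by rewrite mxs expr0n gtn_eqF // ltnW.
  case/allPn => w; rewrite mem_rem_uniq // !inE => /andP[w0 wx] h; exists w; split => //.
  by move: h; rewrite /root !hornerE subr_eq0.
have pe : perm_eq [seq w * x | x <- xs] xs.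
  apply: uniq_perm => // [|y].
    by rewrite map_inj_uniq //; exact: mulfI.
  apply/mapP/idP => [[x hx ->]|hy].
    by move: hx wxs; rewrite !mxs exprMn => /eqP -> /eqP ->.
  exists (w^-1 * y); last by rewrite mulVKf.
  by move: hy wxs; rewrite !mxs exprMn exprVn => /eqP -> /eqP ->.
have e : \sum_(x <- xs) x ^+ i.+1 = w ^+ i.+1 * \sum_(x <- xs) x ^+ i.+1.
  rewrite -[LHS](perm_big _ pe) big_map mulr_sumr.
  by apply: eq_bigr => x _; rewrite exprMn.
have : (w ^+ i.+1 - 1) * \sum_(x <- xs) x ^+ i.+1 = 0.
  by rewrite mulrBl -e mul1r subrr.
by move/eqP; rewrite mulf_eq0 subr_eq0 (negPf wi) => /eqP.
Qed.

Lemma power_sum_eq : \sum_(x <- xs) x ^+ Q.-1 = -1.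
Proof.
have z : 0 \in xs by rewrite mxs expr0n gtn_eqF // ltnW.
rewrite (big_rem 0) //= expr0n gtn_eqF; last by rewrite -subn1 subn_gt0.
rewrite add0r (eq_big_seq (fun _ => 1)).
  rewrite big_const_seq count_predT size_rem // sxs iter_addr_0.
  by rewrite -subn1 mulrnBr ?QK ?sub0r // ltnW.
move=> x; rewrite mem_rem_uniq // !inE => /andP[x0 hx].
by apply/eqP; rewrite -fixed_unit.
Qed.

Lemma power_sum_gt i : (Q.-1 < i)%N -> (i < Q.-1.*2)%N -> \sum_(x <- xs) x ^+ i = 0.
Proof.
move=> h1 h2; rewrite (eq_big_seq (fun x => x ^+ (i - Q.-1))).
  by rewrite power_sum_lt // ltn_subLR ?(ltnW h1) // addnn.
move=> x hx; have [->|x0] := eqVneq x 0.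
  rewrite !expr0n; congr (_%:R); rewrite gtn_eqF ?(leq_ltn_trans _ h1) //.
  by rewrite gtn_eqF // subn_gt0.
move: hx; rewrite fixed_unit // => /eqP e.
by rewrite -{1}(subnKC (ltnW h1)) exprD e mul1r.
Qed.

(** A power sum over the field is nonzero only for exponents that are positive multiples of Q - 1;
    the size bound leaves Q - 1 alone. *)
Lemma sum_eval (g : {poly K}) : (size g <= Q.-1.*2)%N -> \sum_(x <- xs) g.[x] = - g`_Q.-1.
Proof.
move=> sg; have e1 x : g.[x] = \sum_(i < Q.-1.*2) g`_i * x ^+ i.
  by rewrite (horner_coef_wide _ sg).
rewrite (eq_bigr _ (fun x _ => e1 x)) exchange_big /=.
under eq_bigr => i _ do rewrite -mulr_sumr.
have hQ : (Q.-1 < Q.-1.*2)%N by rewrite -addnn -{1}[Q.-1]addn0 ltn_add2l -subn1 subn_gt0.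
rewrite (bigD1 (Ordinal hQ)) //= power_sum_eq mulrN1 big1 ?addr0 // => i.
rewrite -val_eqE /= => ne; case: (ltngtP i Q.-1) ne => // h _.
  by rewrite power_sum_lt ?mulr0.
by rewrite power_sum_gt ?mulr0.
Qed.

(** Euler's criterion, read in K: the power of c is 1, 0 or -1 according to whether there are two,
    one or no square roots. *)
Lemma sqrt_count c : c \in xs ->
  (size [seq y <- xs | y ^+ 2 == c])%:R = 1 + c ^+ Q.-1./2.
Proof.
have Q12 : (Q.-1 = (Q.-1./2) * 2)%N by rewrite [in LHS]Qodd /= muln2.
have Qh : (0 < Q.-1./2)%N by have := Q1; rewrite Qodd; case: (_./2).
have two : 2%:R != 0 :> K.
  by rewrite -(dvdn_pcharf hp) dvdn_prime2 ?pr //; apply: contraTneq p2 => ->.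
move=> hc; have [->|c0] := eqVneq c 0.
  rewrite expr0n gtn_eqF // addr0 (_ : [seq _ <- _ | _] = [seq y <- xs | pred1 0 y]).
    by rewrite size_filter (count_uniq_mem _ uxs) mxs expr0n gtn_eqF ?eqxx // ltnW.
  by apply: eq_filter => y; rewrite sqrf_eq0.
have [z ez] : exists z, z ^+ 2 = c.
  have /closed_rootP[z] : size ('X^2 - c%:P : {poly K}) != 1%N.
    by rewrite size_polyDl size_polyXn // size_polyN (leq_ltn_trans (size_polyC_leq1 _)).
  by rewrite /root !hornerE subr_eq0 => /eqP; exists z.
have z0 : z != 0 by apply: contraNneq c0 => z0; rewrite -ez z0 expr0n.
have ecz : c ^+ Q.-1./2 = z ^+ Q.-1 by rewrite -ez -exprM mulnC -Q12.
have [zx|zx] := boolP (z \in xs).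
  have -> : size [seq y <- xs | y ^+ 2 == c] = size [:: z; - z].
    apply: perm_size; apply: uniq_perm; first exact: filter_uniq.
      rewrite /= inE andbT -addr_eq0 -mulr2n -mulr_natl mulf_eq0 negb_or two //.
    move=> y; rewrite mem_filter -ez eqf_sqr !inE.
    apply/andP/orP => [[/orP[] -> _]|[] /eqP ->]; [by left | by right | |].
      by rewrite eqxx.
    rewrite eqxx orbT mxs exprNn -signr_odd oQ expr1 mulN1r.
    by move: zx; rewrite mxs => /eqP ->.
  by move: zx; rewrite fixed_unit // -ecz => /eqP ->; rewrite -natr1 addrC.
have -> : [seq y <- xs | y ^+ 2 == c] = [::].
  apply/eqP; rewrite -(negbK (_ == _)) -has_filter; apply/hasPn => y hy; apply/negP.
  rewrite -ez eqf_sqr => /orP[] /eqP e; first by rewrite -e hy in zx.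
  case/negP: zx; rewrite -[z]opprK -e mxs exprNn -signr_odd oQ expr1 mulN1r.
  by move: hy; rewrite mxs => /eqP ->.
have : (z ^+ Q.-1) ^+ 2 = 1.
  by rewrite -exprM mulnC exprM ez; apply/eqP; rewrite -fixed_unit.
move/eqP; rewrite sqrf_eq1 -fixed_unit // (negPf zx) /= => /eqP e.
by rewrite ecz e subrr.
Qed.

Lemma point_count (f : {poly K}) : (size f <= 4)%N -> (forall x, x \in xs -> f.[x] \in xs) ->
  (size [seq P <- [seq (x, y) | x <- xs, y <- xs] | P.2 ^+ 2 == f.[P.1]])%:R = - hasse f Q.
Proof.
move=> sf hf.
have -> s : size [seq P <- [seq (x, y) | x <- s, y <- xs] | P.2 ^+ 2 == f.[P.1]] =
   (\sum_(x <- s) size [seq y <- xs | y ^+ 2 == f.[x]])%N.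
  elim: s => [|x s IH] /=; first by rewrite big_nil.
  rewrite filter_cat size_cat IH big_cons; congr (_ + _)%N.
  by rewrite filter_map size_map.
rewrite natr_sum (eq_big_seq (fun x => 1 + (f ^+ Q.-1./2).[x])); last first.
  by move=> x /hf h; rewrite sqrt_count // horner_exp.
rewrite big_split /= big_const_seq count_predT sxs iter_addr_0 -mulr_natr mul1r QK add0r.
rewrite sum_eval //; apply: leq_trans (size_poly_exp_leq _ _) _.
have : ((size f).-1 <= 3)%N by lia.
have := Q1; rewrite Qodd /= doubleK; move: (size f).-1 (_./2) => u v; clear; nia.
Qed.

End CountQ.

Lemma pchar_bin_neq0 n k : (n < p)%N -> (k <= n)%N -> 'C(n, k)%:R != 0 :> K.
Proof.
move=> np kn; rewrite -(dvdn_pcharf hp); apply/negP => h.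
have : (p %| n`!)%N by rewrite -(bin_fact kn) dvdn_mulr.
elim: n np {kn h} => [|n IH] np; first by rewrite fact0 dvdn1 gtn_eqF // prime_gt1.
by rewrite factS Euclid_dvdM // gtnNdvd //= => /(IH (ltnW np)).
Qed.

Lemma coef_XnDC_exp (c : K) d n j : (0 < d)%N -> (j <= n)%N ->
  (('X^d + c%:P) ^+ n)`_(d * j) = c ^+ (n - j) *+ 'C(n, j).
Proof.
move=> d0 jn; rewrite addrC exprDn coef_sum.
have e (i : 'I_n.+1) : ((c%:P ^+ (n - i) * 'X^d ^+ i) *+ 'C(n, i))`_(d * j) =
    if i == j :> nat then c ^+ (n - j) *+ 'C(n, j) else 0.
  rewrite coefMn -rmorphXn -exprM coefCM coefXn eqn_mul2l gtn_eqF //= eq_sym.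
  by case: eqP => [->|_]; rewrite ?mulr1 // mulr0 mul0rn.
rewrite (eq_bigr _ (fun i _ => e i)) (bigD1 (Ordinal (jn : j < n.+1)%N)) //= eqxx big1 ?addr0 //.
by move=> i; rewrite -val_eqE /= => /negPf ->.
Qed.

(** With p = 4 k + 1, the coefficient of X^(4k) in X^(2k) (X^2 + c)^(2k) is binomial(2k, k) c^k, and
    p does not divide the binomial because 2 k < p. *)
Lemma hasse_1728 c : c != 0 -> p = 1 %[mod 4] -> hasse ('X^3 + c *: 'X) p != 0.
Proof.
move=> c0 p4; rewrite /hasse.
have [k ek] : exists k, p = (4 * k).+1.
  exists (p %/ 4)%N; rewrite {1}(divn_eq p 4) p4 mulnC addn1 //.
have eh : (p.-1./2 = 2 * k)%N by rewrite ek /= -[(4 * k)%N]/((2 * 2) * k)%N -mulnA mul2n doubleK.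
have -> : 'X^3 + c *: 'X = 'X * ('X^2 + c%:P) by rewrite -mul_polyC; ring.
rewrite exprMn coefXnM eh ifF; last by rewrite ek /=; lia.
have -> : (p.-1 - 2 * k = 2 * k)%N by rewrite ek /=; lia.
rewrite coef_XnDC_exp //; last by lia.
by rewrite -mulr_natr mulf_neq0 ?expf_neq0 // pchar_bin_neq0 ?ek; lia.
Qed.

(** With p = 6 k + 1, the coefficient of X^(6k) in (X^3 + c)^(3k) is binomial(3k, 2k) c^k, and 3 k <
    p. *)
Lemma hasse_0 c : c != 0 -> p = 1 %[mod 3] -> hasse ('X^3 + c%:P) p != 0.
Proof.
move=> c0 p3; rewrite /hasse.
have [k ek] : exists k, p = (6 * k).+1.
  exists (p %/ 6)%N; have := p2; have := divn_eq p 6; have := divn_eq p 3; rewrite p3.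
  have := ltn_pmod p (isT : 0 < 6)%N.
  move: (p %/ 3)%N (p %/ 6)%N (p %% 6)%N => u v w; clear; lia.
have eh : (p.-1./2 = 3 * k)%N by rewrite ek /= -[(6 * k)%N]/((2 * 3) * k)%N -mulnA mul2n doubleK.
rewrite eh; have -> : (p.-1 = 3 * (2 * k))%N by rewrite ek mulnA.
rewrite coef_XnDC_exp //; last by lia.
by rewrite -mulr_natr mulf_neq0 ?expf_neq0 // pchar_bin_neq0 ?ek; lia.
Qed.

End HasseInvariant.

(** * Supersingular curves *)

(** Lagrange's theorem for a set that is stable under translation by H: whole cosets are removed one
    at a time. *)
Lemma coset_dvd (V : zmodType) (H s : seq V) : uniq H -> uniq s -> 0 \in H ->
  (forall h h', h \in H -> h' \in H -> h - h' \in H) ->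
  (forall x h, x \in s -> h \in H -> x + h \in s) -> (size H %| size s)%N.
Proof.
move=> uH us H0 HB; have [n] := ubnP (size s); elim: n s us => // n IH s us; rewrite ltnS => hn hs.
case: s => [|x s0] in us hn hs *; first by rewrite dvdn0.
set s := x :: s0 in us hn hs *.
pose t := [seq x + h | h <- H]; pose s' := [seq y <- s | y \notin t].
have ts : {subset t <= s} by move=> _ /mapP[h hh ->]; apply: hs => //; exact: mem_head.
have ut : uniq t by rewrite map_inj_uniq //; exact: addrI.
have pe : perm_eq s (t ++ s').
  apply: uniq_perm => // [|y].
    rewrite cat_uniq ut filter_uniq // andbT /=; apply/hasPn => y.
    by rewrite mem_filter => /andP[].
  rewrite mem_cat mem_filter; case: (boolP (y \in t)) => //= /ts ->.
  by [].
have sE : size s = (size H + size s')%N by rewrite (perm_size pe) size_cat size_map.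
have H1 : (0 < size H)%N by case: (H) H0.
rewrite sE dvdn_addr //; apply: IH; first exact: filter_uniq.
  by apply: leq_trans hn; rewrite sE -{1}[size s']add0n ltn_add2r.
move=> y h; rewrite !mem_filter => /andP[yt ys] hh; rewrite hs // andbT.
apply: contra yt => /mapP[h0 hh0 e]; apply/mapP; exists (h0 - h); first exact: HB.
by rewrite addrA -e addrK.
Qed.

Lemma invol_even (T : eqType) (s : seq T) (nu : T -> T) : uniq s ->
  (forall x, x \in s -> [/\ nu x \in s, nu (nu x) = x & nu x != x]) -> ~~ odd (size s).
Proof.
have [n] := ubnP (size s); elim: n s => // n IH [|x s] //= hn /andP[xs us] h.
have [nx nnx nxx] := h x (mem_head _ _).
have nxs : nu x \in s by move: nx; rewrite inE (negPf nxx).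
have sr : size s = (size (rem (nu x) s)).+1 by rewrite size_rem // prednK //; case: s nxs {hn xs us h nx}.
rewrite sr /= negbK; apply: IH; first by move: hn; rewrite sr; lia.
  exact: rem_uniq.
move=> y; rewrite mem_rem_uniq // inE => /andP[ynx ys].
have [ny nny nyy] := h y (mem_behead (s := x :: s) ys).
have nyx : nu y != x by apply: contraNneq ynx => e; rewrite -nny e.
split=> //; rewrite mem_rem_uniq // inE; apply/andP; split.
  by apply: contraNneq xs => /(congr1 nu); rewrite nny nnx => <-.
by move: ny; rewrite inE (negPf nyx).
Qed.

Section CubicPolynomial.
Variables (K : fieldType) (C : swcurve K).

Definition swpoly : {poly K} := 'X^3 + (swA C *: 'X + (swB C)%:P).

Lemma size_swpoly_tail : (size (swA C *: 'X + (swB C)%:P)%R < 4)%N.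
Proof.
rewrite ltnS; apply: leq_trans (size_polyD _ _) _; rewrite geq_max.
rewrite (leq_trans (size_polyC_leq1 _)) // andbT.
by rewrite (leq_trans (size_scale_leq _ _)) ?size_polyX.
Qed.

Lemma size_swpoly : size swpoly = 4%N.
Proof. by rewrite size_polyDl size_polyXn // size_swpoly_tail. Qed.

Lemma monic_swpoly : swpoly \is monic.
Proof. by rewrite monicE lead_coefDl ?lead_coefXn // size_polyXn size_swpoly_tail. Qed.

Lemma horner_swpoly x : swpoly.[x] = swf C x.
Proof. by rewrite /swpoly /swf !hornerE /=. Qed.

End CubicPolynomial.

Section ShortCurve.
Variables (F : finFieldType) (p m : nat).
Hypotheses (hp : p \in [pchar F]) (hq : #|F| = (p ^ m)%N).
Variables (K : closedFieldType) (iota : {rmorphism F -> K}).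
Hypothesis hK : integralRange iota.
Hypothesis p2 : odd p.
Variable C : swcurve F.
Local Notation q := #|F|.

Let hpK : p \in [pchar K]. Proof. by rewrite (fmorph_pchar iota). Qed.
Let pr : prime p. Proof. exact: pcharf_prime hp. Qed.
Let m_gt0 : (0 < m)%N. Proof. exact: exponent_gt0 hq. Qed.

Lemma swmap_two : 2%:R != 0 :> K.
Proof. by rewrite -(rmorph_nat iota) fmorph_eq0 sw_two. Qed.

Lemma swmap_disc : 4%:R * iota (swA C) ^+ 3 + 27%:R * iota (swB C) ^+ 2 != 0.
Proof.
rewrite -!(rmorph_nat iota) -!rmorphXn -!rmorphM -rmorphD fmorph_eq0; exact: sw_disc.
Qed.

Definition swmap : swcurve K := SWCurve swmap_two swmap_disc.
Local Notation CK := swmap.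
Local Notation V := (swpoint CK).
Local Notation fpoly := (swpoly CK).

Lemma swadd_map (g : {rmorphism K -> K}) (P Q : option (K * K)) :
  g (swA CK) = swA CK ->
  let gP := omap (fun P => (g P.1, g P.2)) in
  swadd CK (gP P) (gP Q) = gP (swadd CK P Q).
Proof.
move=> gA /=; case: P Q => [[x1 y1]|] [[x2 y2]|] //=.
rewrite -rmorphN !(inj_eq (fmorph_inj g)); case: ifP => // _ /=.
have sl : swslope CK (g x1) (g y1) (g x2) (g y2) = g (swslope CK x1 y1 x2 y2).
  rewrite /swslope (inj_eq (fmorph_inj g)); case: ifP => _; rewrite fmorph_div.
    by rewrite rmorphD rmorphM rmorphXn rmorphM !rmorph_nat gA.
  by rewrite !rmorphB.
by rewrite sl; congr (Some (_, _)); rewrite !(rmorphB, rmorphXn, rmorphM).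
Qed.

Lemma swon_map (g : {rmorphism K -> K}) (P : option (K * K)) :
  g (swA CK) = swA CK -> g (swB CK) = swB CK ->
  swon CK (omap (fun P => (g P.1, g P.2)) P) = swon CK P.
Proof.
move=> gA gB; case: P => [[x y]|] //=; rewrite /swf -gA -gB -!rmorphXn -rmorphM -!rmorphD.
rewrite (inj_eq (fmorph_inj g)); move: gA gB => /= -> -> //.
Qed.

Definition swfrob_val i (P : option (K * K)) := omap (fun P => (frobn F i P.1, frobn F i P.2)) P.

Lemma frobm_swA i : frobm hp hq iota i (swA CK) = swA CK. Proof. exact: frobn_iota. Qed.
Lemma frobm_swB i : frobm hp hq iota i (swB CK) = swB CK. Proof. exact: frobn_iota. Qed.

Lemma swfrob_on i (P : V) : swon CK (swfrob_val i (swval P)).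
Proof.
by rewrite -[swfrob_val i _]/(omap (fun P => (frobm hp hq iota i P.1, frobm hp hq iota i P.2)) _)
   swon_map ?frobm_swA ?frobm_swB // swvalP.
Qed.

Definition swfrob i (P : V) : V := SwPoint (swfrob_on i P).

Lemma swfrobD i : {morph swfrob i : P Q / P + Q}.
Proof.
move=> P Q; apply: val_inj.
exact: (esym (swadd_map (swval P) (swval Q) (frobm_swA i))).
Qed.

Lemma swfrob0 i : swfrob i 0 = 0. Proof. exact: val_inj. Qed.

Lemma swfrobN i P : swfrob i (- P) = - swfrob i P.
Proof. by apply/eqP; rewrite -addr_eq0 -swfrobD addNr swfrob0. Qed.

Lemma swfrob_periodic P : exists2 j, (0 < j)%N & swfrob j P = P.
Proof.
case e : (swval P) => [[x y]|]; last by exists 1%N => //; apply: val_inj; rewrite /= e.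
have [n n0 [ex ey]] := frobn_periodic2 hp hq hK x y.
by exists n => //; apply: val_inj; rewrite /= e /= ex ey.
Qed.

(** The points over the extension of degree i, realised over K as fixed points of Frobenius. The
    count holds modulo p: the affine points give minus the Hasse coefficient and infinity gives
    1. *)
Lemma fixed_points i : (0 < i)%N -> exists s : seq V, [/\ uniq s,
  forall P, (P \in s) = (swfrob i P == P)
  & (size s)%:R = 1 - hasse fpoly (q ^ i) :> K].
Proof.
move=> i0; have eQ : (q ^ i = p ^ (m * i))%N by rewrite hq expnM.
have J0 : (0 < m * i)%N by rewrite muln_gt0 m_gt0.
have [xs [uxs sxs mxs']] := fixed_list hpK J0; have mxs := mxs'; rewrite -eQ in mxs.
pose pairs := [seq P <- [seq (x, y) | x <- xs, y <- xs] | P.2 ^+ 2 == fpoly.[P.1]].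
have mpairs x y : ((x, y) \in pairs) = [&& x \in xs, y \in xs & y ^+ 2 == fpoly.[x]].
  rewrite mem_filter /= andbC andbA; congr (_ && _).
  apply/allpairsP/andP => [[[u v] /= [hu hv [-> ->]]]//|[hx hy]]; by exists (x, y).
have upairs : uniq pairs.
  by apply: filter_uniq; apply: allpairs_uniq => // -[? ?] [? ?] _ _ [-> ->].
pose s0 := None :: [seq Some P | P <- pairs].
have us0 : uniq s0.
  rewrite /= map_inj_uniq ?upairs ?andbT; last by move=> ? ? [].
  by apply/mapP => -[].
pose s : seq V := pmap insub s0.
exists s; split; first exact: pmap_sub_uniq.
  move=> P; rewrite mem_pmap_sub /s0 inE -val_eqE /=.
  have onP := swvalP P; case: (swval P) onP => [[x y]|] //= onP.
  have -> : (Some (x, y) \in [seq Some P | P <- pairs]) = ((x, y) \in pairs).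
    by rewrite mem_map // => ? ? [].
  rewrite mpairs !mxs horner_swpoly onP andbT -xpair_eqE /frobn /=.
  by apply/eqP/eqP => [e|[e1 e2]]; [congr Some | congr (_, _)].
have -> : size s = (size pairs).+1.
  rewrite /s size_pmap_sub /= count_map; congr _.+1.
  apply/eqP; rewrite -all_count; apply/allP => -[x y]; rewrite mpairs => /and3P[_ _].
  by rewrite horner_swpoly.
rewrite -natr1 addrC (point_count hpK p2 J0 uxs sxs mxs') ?size_swpoly ?eQ //.
move=> x; rewrite !mxs => /eqP ex; apply/eqP.
rewrite horner_swpoly -[_ ^+ _]/(frobm hp hq iota i (swf CK x)) /swf !rmorphD rmorphXn rmorphM.
by rewrite frobm_swA frobm_swB /= /frobn ex.
Qed.

Hypothesis super : hasse fpoly p = 0.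

(* A p-torsion point would make p divide the number of points over some finite
   extension, and this number is 1 modulo p. *)
Lemma no_ptorsion (P : V) : P *+ p = 0 -> P = 0.
Proof.
move=> eP; apply/eqP/negPn/negP => P0.
have [j j0 ej] := swfrob_periodic P.
have [s [us ms ss]] := fixed_points j0.
have h0 : hasse fpoly (q ^ j) = 0.
  rewrite hq -expnM; have : (0 < m * j)%N by rewrite muln_gt0 m_gt0.
  case: (m * j)%N => // n _; apply/eqP.
  by rewrite (hasse_pow hpK p2) ?size_swpoly // super.
pose H := [seq P *+ i | i <- seq.iota 0 p].
have inH k : P *+ k \in H.
  apply/mapP; exists (k %% p)%N; first by rewrite mem_iota ltn_mod prime_gt0.
  by rewrite {1}(divn_eq k p) mulrnDr mulnC mulrnA eP mul0rn add0r.
have PN k : - (P *+ k) = P *+ (k * p.-1).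
  apply/eqP; rewrite eq_sym -addr_eq0 -mulrnDr -mulnSr prednK ?prime_gt0 //.
  by rewrite mulnC mulrnA eP mul0rn.
have dv : (size H %| size s)%N.
  apply: coset_dvd => //.
  - rewrite map_inj_in_uniq ?iota_uniq // => i k; rewrite !mem_iota !add0n /=.
    wlog ik : i k / (i <= k)%N.
      by move=> W hi hk e; case: (leqP i k) => h; [exact: W | apply/esym/W => //; exact: ltnW].
    move=> hi hk e; apply/eqP; rewrite eqn_leq ik /= leqNgt; apply/negP => lt.
    have d0 : P *+ (k - i) = 0 by rewrite mulrnBr // e subrr.
    have cp : coprime (k - i) p.
      by rewrite coprime_sym prime_coprime // gtnNdvd ?subn_gt0 // (leq_ltn_trans (leq_subr _ _)).
    have [u _ /dvdnP[k' ek]] := Bezoutl (k - i) (prime_gt0 pr).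
    case/negP: P0; apply/eqP; move/eqP: cp; rewrite gcdnC => cp.
    have := congr1 (GRing.natmul P) ek; rewrite cp mulrnDr mulr1n.
    by rewrite mulnC mulrnA d0 mul0rn addr0 mulnC mulrnA eP mul0rn.
  - by rewrite -(mulr0n P) inH.
  - by move=> _ _ /mapP[i _ ->] /mapP[k _ ->]; rewrite PN -mulrnDr inH.
  - move=> Q _ hQ /mapP[i _ ->]; move: hQ; rewrite !ms swfrobD => /eqP ->.
    suff -> : swfrob j (P *+ i) = P *+ i by [].
    by elim: i => [|i IH]; rewrite ?swfrob0 // mulrS swfrobD ej IH.
move: dv ss; rewrite size_map size_iota (dvdn_pcharf hpK) => /eqP ->.
by rewrite h0 subr0 => /eqP; rewrite eq_sym oner_eq0.
Qed.

(** Without p-torsion, D has no root, hence is constant, and N is injective, since [p]P = [p]P' or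
    -[p]P' forces P = P' or -P'. So N - N(0) is monic of degree p^2 with 0 as its only root. *)
Lemma mulp_Frobenius : exists d c, d != 0 /\ xpoly CK p ('X^(p ^ 2) + c%:P) d%:P.
Proof.
have [N [D [mN sN sD cop rel]]] := xpoly_exists CK p.
have pP0 (P : V) x y : swval P = Some (x, y) -> exists u v, swval (P *+ p) = Some (u, v).
  move=> eP; case e : (swval (P *+ p)) => [[u v]|]; first by exists u, v.
  have := @no_ptorsion P; move=> h; have : P *+ p = 0 by apply: val_inj.
  by move/h => P0; rewrite P0 in eP.
have rD x : ~~ root D x.
  apply/negP => /eqP hx; have [P [y eP]] := point_above CK x.
  have [u [v euv]] := pP0 _ _ _ eP; have := rel _ _ _ eP; rewrite euv hx /= mul0r => h.
  by have := cop x; rewrite -h hx eqxx.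
have [d d0 eD] : exists2 d, d != 0 & D = d%:P.
  apply/size_poly1P; apply/negPn/negP => /closed_rootP[x]; by rewrite (negPf (rD x)).
have injN x x' : N.[x] = N.[x'] -> x = x'.
  move=> e; have [P [y eP]] := point_above CK x; have [P' [y' eP']] := point_above CK x'.
  have [u [v euv]] := pP0 _ _ _ eP; have [u' [v' euv']] := pP0 _ _ _ eP'.
  have := rel _ _ _ eP; have := rel _ _ _ eP'; rewrite euv euv' eD !hornerC /= e => <-.
  move/(mulfI d0) => eu; subst u'.
  have onp := swvalP (P *+ p); have onp' := swvalP (P' *+ p); rewrite euv in onp; rewrite euv' in onp'.
  case: (swon_same_x onp onp') => ev; subst v'.
    have : P *+ p = P' *+ p by apply: val_inj; rewrite /= euv euv'.
    move/eqP; rewrite -subr_eq0 -mulrnBl => /eqP/no_ptorsion/eqP; rewrite subr_eq0 => /eqP eq.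
    by move: eP'; rewrite -eq eP => -[].
  have : P *+ p = - (P' *+ p) by apply: val_inj; rewrite [RHS](swvalN euv') opprK [LHS]euv.
  move/eqP; rewrite -addr_eq0 -mulrnDl => /eqP/no_ptorsion/eqP; rewrite addr_eq0 => /eqP eq.
  by move: eP; rewrite eq (swvalN eP') => -[].
exists d, N.[0]; split => //; rewrite -eD.
suff -> : 'X^(p ^ 2) + (N.[0])%:P = N by [].
have sc : (size (- (N.[0])%:P) < size N)%N.
  by rewrite size_polyN (leq_ltn_trans (size_polyC_leq1 _)) // sN ltnS expn_gt0 prime_gt0.
have [r er] := closed_field_poly_normal (N - (N.[0])%:P).
rewrite lead_coefDl // (monicP mN) scale1r in er.
have r0 z : z \in r -> z = 0.
  move=> zr; apply: injN; apply/eqP; rewrite -subr_eq0.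
  by have : root (N - (N.[0])%:P) z; [rewrite er root_prod_XsubC | rewrite /root !hornerE].
have eX : \prod_(z <- r) ('X - z%:P) = 'X^(size r) :> {poly K}.
  rewrite big_seq (eq_bigr (fun=> 'X)) => [|z /r0 ->]; last by rewrite subr0.
  by rewrite -big_seq big_const_seq count_predT iter_mulr_1.
rewrite eX in er; have := congr1 (size \o val) er; rewrite /= size_polyDl // sN size_polyXn => -[] ->.
by rewrite -er subrK.
Qed.

(** As p is odd, [p] fixes the 2-torsion points, and the formula for x([p]P) becomes a relation
    between e and e^(p^2). *)
Lemma two_torsion_Frobenius : exists d c, forall e, swf CK e = 0 -> e ^+ (p ^ 2) = d * e + c.
Proof.
have [d [c [d0 [mN sN sD cop rel]]]] := mulp_Frobenius; exists d, (- c) => e he.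
have on : swon CK (Some (e, 0)) by rewrite /= he expr0n.
pose T : V := SwPoint on.
have T2 : T *+ 2 = 0 by apply: val_inj; rewrite /= oppr0 !eqxx.
have Tp : T *+ p = T.
  by rewrite -(odd_double_half p) p2 -muln2 mulnC mulrnDr mulrnA T2 mul0rn addr0.
have := rel T e 0 erefl; rewrite Tp /= !hornerE => ->.
by rewrite addrK.
Qed.

Lemma two_torsion_Frobenius_iter k :
  exists d c, forall e, swf CK e = 0 -> e ^+ (p ^ (2 * k)) = d * e + c.
Proof.
elim: k => [|k [d [c h]]]; first by exists 1, 0 => e _; rewrite mul1r addr0.
have [d1 [c1 h1]] := two_torsion_Frobenius.
exists (d ^+ (p ^ 2) * d1), (d ^+ (p ^ 2) * c1 + c ^+ (p ^ 2)) => e he.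
rewrite mulnS addnC expnD exprM h // exprDn_pchar; last first.
  by rewrite (eq_pnat _ (pcharf_eq hpK)) pnatX pnat_id.
by rewrite exprMn (h1 e he) mulrDr mulrA addrA.
Qed.

End ShortCurve.

Section CubicRoots.
Variables (K : closedFieldType) (C : swcurve K).

Definition cubic_roots e1 e2 e3 := [/\ e1 + e2 + e3 = 0,
  swA C = e1 * e2 + e1 * e3 + e2 * e3, swB C = - (e1 * e2 * e3) & uniq [:: e1; e2; e3]].

Lemma cubic_roots_rot e1 e2 e3 : cubic_roots e1 e2 e3 -> cubic_roots e2 e3 e1.
Proof.
move=> [h1 h2 h3 /= u]; split; rewrite ?h2 ?h3; try ring.
  by rewrite -h1; ring.
by move: u; rewrite /= !inE !negb_or !andbT (eq_sym e2 e1) (eq_sym e3 e1) => /andP[/andP[-> ->] ->].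
Qed.

Lemma cubic_roots_swap e1 e2 e3 : cubic_roots e1 e2 e3 -> cubic_roots e1 e3 e2.
Proof.
move=> [h1 h2 h3 /= u]; split; rewrite ?h2 ?h3; try ring.
  by rewrite -h1; ring.
by move: u; rewrite /= !inE !negb_or !andbT (eq_sym e3 e2) => /andP[/andP[-> ->] ->].
Qed.

Lemma cubic_rootsE e1 e2 e3 x : cubic_roots e1 e2 e3 ->
  (swf C x == 0) = (x \in [:: e1; e2; e3]).
Proof.
move=> [h1 h2 h3 _]; have -> : swf C x = (x - e1) * ((x - e2) * (x - e3)).
  rewrite /swf h2 h3; have -> : e3 = - e1 - e2 by apply/eqP; rewrite -subr_eq0 -h1; apply/eqP; ring.
  ring.
by rewrite !mulf_eq0 !subr_eq0 !inE.
Qed.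

Lemma cubic_roots_root e1 e2 e3 : cubic_roots e1 e2 e3 ->
  [/\ swf C e1 = 0, swf C e2 = 0 & swf C e3 = 0].
Proof. by move=> r; split; apply/eqP; rewrite (cubic_rootsE _ r) !inE eqxx ?orbT. Qed.

Lemma cubic_roots_exist : exists e1 e2 e3, cubic_roots e1 e2 e3.
Proof.
have [r er] := closed_field_poly_normal (swpoly C).
rewrite (monicP (monic_swpoly C)) scale1r in er.
have sr : size r = 3%N.
  by have := congr1 (size \o val) er; rewrite /= size_swpoly size_prod_XsubC => -[].
case: r sr er => [|e1 [|e2 [|e3 [|? ?]]]] // _; rewrite !big_cons big_nil => er.
have fc x : swf C x = (x - e1) * ((x - e2) * (x - e3)).
  by have := congr1 (horner^~ x) er; rewrite horner_swpoly => ->; rewrite !hornerE /=; ring.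
have ef : swpoly C = 'X^3 - (e1 + e2 + e3) *: 'X^2 + (e1 * e2 + e1 * e3 + e2 * e3) *: 'X - (e1 * e2 * e3)%:P.
  by rewrite er -!mul_polyC !(polyCD, polyCM) mulr1; ring.
pose simp := (mulr1, mulr0, add0r, addr0, subr0, sub0r, oppr0).
have h1 : e1 + e2 + e3 = 0.
  have := congr1 (fun g : {poly K} => g`_2) ef; rewrite /swpoly !coefE /= !simp => /eqP.
  by rewrite eq_sym oppr_eq0 => /eqP.
have h2 : swA C = e1 * e2 + e1 * e3 + e2 * e3.
  by have := congr1 (fun g : {poly K} => g`_1) ef; rewrite /swpoly !coefE /= !simp.
have h3 : swB C = - (e1 * e2 * e3).
  by have := congr1 (fun g : {poly K} => g`_0) ef; rewrite /swpoly !coefE /= !simp.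
exists e1, e2, e3; split=> //.
have root_neq a b c : (forall x, swf C x = (x - a) * ((x - b) * (x - c))) ->
   a + b + c = 0 -> swA C = a * b + a * c + b * c -> a != b.
  move=> fab s0 sA; apply/eqP => ab; subst b.
  have := @sw_smooth _ C a; rewrite fab subrr mul0r => /(_ erefl) /eqP; apply.
  rewrite sA; have -> : c = - a - a by apply/eqP; rewrite -subr_eq0 -s0; apply/eqP; ring.
  ring.
rewrite /= !inE negb_or !andbT.
rewrite (root_neq e1 e2 e3) // (root_neq e1 e3 e2) ?(root_neq e2 e3 e1) //;
  by [move=> x; rewrite fc; ring | rewrite -h1; ring | rewrite h2; ring].
Qed.

End CubicRoots.

(** * Frobenius on the 2-torsion when p divides the trace *)

Section Endgame.
Variables (F : finFieldType) (p m : nat).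
Hypotheses (hp : p \in [pchar F]) (hq : #|F| = (p ^ m)%N).
Variables (K : closedFieldType) (iota : {rmorphism F -> K}).
Hypothesis hK : integralRange iota.
Hypotheses (p2 : odd p) (p3 : p != 3).
Variable C : swcurve F.
Local Notation q := #|F|.
Local Notation CK := (swmap iota C).
Local Notation V := (swpoint CK).
Local Notation frob1 := (swfrob hp hq (iota := iota) (C := C) 1).
Local Notation phi := (frobm hp hq iota 1).
Local Notation fpoly := (swpoly CK).

Let hpK : p \in [pchar K]. Proof. by rewrite (fmorph_pchar iota). Qed.
Let pr : prime p. Proof. exact: pcharf_prime hp. Qed.
Let m_gt0 : (0 < m)%N. Proof. exact: exponent_gt0 hq. Qed.

Variable s : seq V.
Hypotheses (us : uniq s) (ms : forall P, (P \in s) = (frob1 P == P)).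
Hypotheses (m_even : ~~ odd m) (s1 : (size s)%:R = 1 :> K).

Let three : 3%:R != 0 :> K.
Proof. by rewrite -(dvdn_pcharf hpK) dvdn_prime2. Qed.

(** The hypothesis on [size s] says that p divides the trace, and the point count modulo p is 1
    minus the Hasse coefficient for q. *)
Lemma hasse_vanish : hasse fpoly p = 0.
Proof.
have [s' [us' ms' ss']] := fixed_points hp hq iota p2 C (ltnSn 0).
have e : perm_eq s s' by apply: uniq_perm => // P; rewrite ms ms'.
move: ss'; rewrite -(perm_size e) s1 expn1 hq => /eqP.
rewrite -subr_eq0 opprB addrC subrK => /eqP; case: (m) m_gt0 => // n _ /eqP.
by rewrite (hasse_pow hpK p2) ?size_swpoly // => /eqP.
Qed.

Lemma phi_root e : swf CK e = 0 -> swf CK (phi e) = 0.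
Proof.
move=> he; have := rmorph0 phi; rewrite -{1}he /swf !rmorphD rmorphXn rmorphM.
by rewrite frobm_swA frobm_swB.
Qed.

Lemma phi_affine : exists d c, forall e, swf CK e = 0 -> phi e = d * e + c.
Proof.
have [d [c h]] := two_torsion_Frobenius_iter hp hq hK p2 hasse_vanish m./2.
exists d, c => e he; rewrite -h // -[phi e]/(e ^+ (q ^ 1)) expn1 hq.
by rewrite -{1}(odd_double_half m) (negPf m_even) add0n -mul2n.
Qed.

Lemma root_point e : swf CK e = 0 -> exists2 T : V, swval T = Some (e, 0) & T + T = 0.
Proof.
move=> he; have on : swon CK (Some (e, 0)) by rewrite /= he expr0n.
by exists (SwPoint on) => //; apply: val_inj; rewrite /= oppr0 !eqxx.
Qed.

Lemma fixed_closed P Q : P \in s -> Q \in s -> P + Q \in s.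
Proof. by rewrite !ms => /eqP hP /eqP hQ; rewrite swfrobD hP hQ. Qed.

Lemma root_in_s e (T : V) : swval T = Some (e, 0) -> (T \in s) = (phi e == e).
Proof.
move=> eT; rewrite ms -val_eqE /= eT /= -[frobn F 1 0]/(phi 0) rmorph0.
by apply/eqP/eqP => [[]|->].
Qed.

Lemma rational_root_even e : swf CK e = 0 -> phi e = e -> (2 %| size s)%N.
Proof.
move=> he pe; have [T eT T2] := root_point he.
have Ts : T \in s by rewrite (root_in_s eT) pe.
have T0 : T != 0 by apply/eqP => h; rewrite h in eT.
apply: (@coset_dvd _ [:: 0; T]) => //.
- by rewrite /= inE eq_sym T0.
- have NT : - T = T by apply/eqP; rewrite eq_sym -addr_eq0 T2.
  by move=> h h'; rewrite !inE => /orP[] /eqP -> /orP[] /eqP ->;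
    rewrite ?subrr ?sub0r ?subr0 ?NT ?eqxx ?orbT.
- by move=> x h xs; rewrite !inE => /orP[] /eqP ->; apply: fixed_closed.
Qed.

Lemma two_torsion_root (P : V) : P != 0 -> - P = P ->
  exists2 x, swval P = Some (x, 0) & swf CK x = 0.
Proof.
move=> P0 PP; case eP : (swval P) => [[x y]|]; last by case/eqP: P0; apply: val_inj; rewrite /= eP.
have := swvalN eP; rewrite PP eP => -[/eqP].
rewrite -addr_eq0 -mulr2n -mulr_natl mulf_eq0 (negPf (sw_two CK)) /= => /eqP y0; subst y.
by exists x => //; have := swvalP P; rewrite eP /= expr0n eq_sym => /eqP.
Qed.

(** Negation acts on the nonzero rational points, an odd number of them, so it fixes one, which is a
    2-torsion point. *)
Lemma rational_root_exists : ~~ odd (size s) -> exists2 e, swf CK e = 0 & phi e = e.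
Proof.
move=> es; have s0 : 0 \in s by rewrite ms swfrob0.
have [/hasP[P Ps /andP[P0 PP]]|/hasPn h] := boolP (has (fun P => (P != 0) && (- P == P)) s).
  have [x eP hx] := two_torsion_root P0 (eqP PP).
  by exists x => //; apply/eqP; rewrite -(root_in_s eP).
have: ~~ odd (size (rem 0 s)).
  apply: (@invol_even _ _ -%R); first exact: rem_uniq.
  move=> P; rewrite !mem_rem_uniq // !inE oppr_eq0 opprK => /andP[P0 Ps]; split=> //.
    by rewrite P0 ms swfrobN; move: Ps; rewrite ms => /eqP ->; rewrite eqxx.
  by have := h _ Ps; rewrite P0.
rewrite size_rem //; case: (s) s0 es => // x s' _ /=; by rewrite negbK => ->.
Qed.

Lemma rational_roots_4dvd e1 e2 e3 : cubic_roots CK e1 e2 e3 ->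
  phi e1 = e1 -> phi e2 = e2 -> phi e3 = e3 -> (4 %| size s)%N.
Proof.
move=> r f1 f2 f3.
have [r1 r2 r3] := cubic_roots_root r; have [h1 h2 h3 u] := r.
have [T1 eT1 TT1] := root_point r1; have [T2 eT2 TT2] := root_point r2.
have [T3 eT3 TT3] := root_point r3.
have in1 : T1 \in s by rewrite (root_in_s eT1) f1.
have in2 : T2 \in s by rewrite (root_in_s eT2) f2.
have in3 : T3 \in s by rewrite (root_in_s eT3) f3.
have in0 : 0 \in s by rewrite ms swfrob0.
have sval_eq (P Q : V) : (P == Q) = (swval P == swval Q) by [].
have uH : uniq [:: 0; T1; T2; T3].
  move: u; rewrite /= !inE !sval_eq eT1 eT2 eT3 /= !negb_or !andbT.
  by move=> /andP[/andP[n12 n13] n23]; rewrite !(inj_eq Some_inj) !xpair_eqE eqxx !andbT n12 n13 n23.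
have tors P : P + P = 0 -> P \in [:: 0; T1; T2; T3].
  have [->|P0] := eqVneq P 0; first by rewrite mem_head.
  move/eqP; rewrite addr_eq0 eq_sym => /eqP/(two_torsion_root P0)[x eP /eqP].
  rewrite (cubic_rootsE _ r) !inE !sval_eq eP eT1 eT2 eT3.
  by rewrite !(inj_eq Some_inj) !xpair_eqE eqxx !andbT.
have torsE h : h \in [:: 0; T1; T2; T3] -> h + h = 0 /\ h \in s.
  by rewrite !inE => /or4P[] /eqP ->; rewrite ?addr0.
apply: (@coset_dvd _ [:: 0; T1; T2; T3]) => //.
  move=> h h' /torsE[hh _] /torsE[hh' _]; apply: tors.
  by rewrite addrACA hh -opprD hh' oppr0 addr0.
by move=> x h xs /torsE[_ hs]; apply: fixed_closed.
Qed.

(** Here q + 1 is 2 modulo 4: being even, it gives a rational 2-torsion abscissa; not being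
    divisible by 4, it prevents all three from being rational. *)
Lemma supersingular_1mod4 : p = 1 %[mod 4] -> size s <> q.+1.
Proof.
move=> p4 sq; have q4 : (q %% 4 = 1)%N.
  by rewrite hq -modnXm p4 modnXm exp1n.
have ev : ~~ odd (size s) by rewrite sq; clear -q4; lia.
have n4 : ~~ (4 %| size s)%N by rewrite sq; clear -q4; lia.
have [e0 he0 pe0] := rational_root_exists ev.
have [e1 [e2 [e3 [r pe1]]]] : exists e1 e2 e3, cubic_roots CK e1 e2 e3 /\ phi e1 = e1.
  have [e1 [e2 [e3 r]]] := cubic_roots_exist CK.
  move/eqP: he0; rewrite (cubic_rootsE _ r) !inE => /or3P[] /eqP e; subst e0.
  - by exists e1, e2, e3.
  - by exists e2, e3, e1; split=> //; apply: cubic_roots_rot.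
  - by exists e3, e1, e2; split=> //; do 2!apply: cubic_roots_rot.
have [h1 h2 h3 u] := r.
have [r1 r2 r3] := cubic_roots_root r.
move: u; rewrite /= !inE negb_or !andbT => /andP[/andP[n12 n13] n23].
have img e : swf CK e = 0 -> phi e \in [:: e1; e2; e3].
  by move=> he; rewrite -(cubic_rootsE _ r) phi_root.
have inj := fmorph_inj phi.
have ne e : e1 != e -> phi e == e1 = false.
  by move=> ne; rewrite -[X in _ == X]pe1 (inj_eq inj) eq_sym (negPf ne).
have := img _ r3; have := img _ r2; rewrite !inE !ne // !orFb.
move=> /orP[/eqP f2|/eqP f2] /orP[/eqP f3|/eqP f3].
- by move: n23; rewrite -(inj_eq inj) f2 f3 eqxx.
- by rewrite (rational_roots_4dvd r) in n4.
- have [d [c aff]] := phi_affine.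
  have a1 := aff _ r1; have a2 := aff _ r2; have a3 := aff _ r3.
  rewrite pe1 in a1; rewrite f2 in a2; rewrite f3 in a3.
  (* The transposition negates e2 - e3, and the affine map multiplies it by d. *)
  have d1 : d = -1.
    have : (d + 1) * (e2 - e3) = 0.
      have -> : (d + 1) * (e2 - e3) = (d * e2 + c) - (d * e3 + c) + (e2 - e3) by ring.
      by rewrite -a2 -a3; ring.
    by move/eqP; rewrite mulf_eq0 [e2 - e3 == 0]subr_eq0 (negPf n23) orbF addr_eq0 => /eqP.
  (* With d = -1 the sum of a root and its image is the constant c: 2 e1 = c = e2 + e3 = - e1. *)
  have e10 : e1 = 0.
    have : 3%:R * e1 = 0.
      have -> : 3%:R * e1 = e1 + e1 - (e2 + e3) + (e1 + e2 + e3) by ring.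
      by rewrite h1 {1}a1 a2 d1; ring.
    by move/eqP; rewrite mulf_eq0 (negPf three) => /eqP.
  have B0 : swB CK = 0 by rewrite h3 e10 !mul0r oppr0.
  have A0 : swA CK != 0.
    by apply/eqP => A0; have := sw_disc CK; rewrite A0 B0 !expr0n !mulr0 addr0 eqxx.
  have := hasse_1728 hpK p2 A0 p4.
  have -> : 'X^3 + swA CK *: 'X = fpoly by rewrite /swpoly B0 addr0.
  by rewrite hasse_vanish eqxx.
- by move: n23; rewrite -(inj_eq inj) f2 f3 eqxx.
Qed.

Lemma supersingular_1mod3 : p = 1 %[mod 3] -> ~~ odd (size s).
Proof.
move=> p31; apply/negP => os.
have norat e : swf CK e = 0 -> phi e != e.
  by move=> he; apply/eqP => /(rational_root_even he); rewrite dvdn2 os.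
have inj := fmorph_inj phi.
have [e1 [e2 [e3 [r pe1]]]] : exists e1 e2 e3, cubic_roots CK e1 e2 e3 /\ phi e1 = e2.
  have [e1 [e2 [e3 r]]] := cubic_roots_exist CK.
  have r1 : swf CK e1 = 0 by apply/eqP; rewrite (cubic_rootsE _ r) mem_head.
  have := phi_root r1; move/eqP; rewrite (cubic_rootsE _ r) !inE (negPf (norat _ r1)) /=.
  move=> /orP[] /eqP h; first by exists e1, e2, e3.
  by exists e1, e3, e2; split=> //; apply: cubic_roots_swap.
have [h1 h2 h3 u] := r.
have [r1 r2 r3] := cubic_roots_root r.
move: u; rewrite /= !inE negb_or !andbT => /andP[/andP[n12 n13] n23].
have img e : swf CK e = 0 -> phi e \in [:: e1; e2; e3].
  by move=> he; rewrite -(cubic_rootsE _ r) phi_root.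
have f3 : phi e3 = e1.
  have := img _ r3; rewrite !inE (negPf (norat _ r3)) orbF => /orP[/eqP //|].
  by rewrite -[X in _ == X]pe1 (inj_eq inj) eq_sym (negPf n13).
have f2 : phi e2 = e3.
  have := img _ r2; rewrite !inE (negPf (norat _ r2)) /= => /orP[|/eqP //].
  by rewrite -f3 (inj_eq inj) (negPf n23).
have [d [c aff]] := phi_affine.
have a1 := aff _ r1; have a2 := aff _ r2; have a3 := aff _ r3.
rewrite pe1 in a1; rewrite f2 in a2; rewrite f3 in a3.
(* The 3-cycle multiplies each difference by d, and the three differences add up to 0; hence 1 + d +
   d^2 = 0. *)
have v : e2 - e3 = d * (e1 - e2) by rewrite {1}a1 a2; ring.
have w : e3 - e1 = d ^+ 2 * (e1 - e2).
  by rewrite expr2 -mulrA -v {1}a2 {1}a3; ring.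
have d3 : 1 + d + d ^+ 2 = 0.
  have : (1 + d + d ^+ 2) * (e1 - e2) = 0 by rewrite !mulrDl -v -w; ring.
  by move/eqP; rewrite mulf_eq0 [e1 - _ == 0]subr_eq0 (negPf n12) orbF => /eqP.
(* 6 A is twice the square of the sum of the roots minus the sum of the squared differences. The
   latter is (1 + d^2 + d^4) (e1 - e2)^2, and 1 + d + d^2 divides 1 + d^2 + d^4. *)
have A0 : swA CK = 0.
  have : 2%:R * 3%:R * swA CK = 0.
    have -> : 2%:R * 3%:R * swA CK = 2%:R * (e1 + e2 + e3) ^+ 2 - (e1 - e2) ^+ 2 - (e2 - e3) ^+ 2 - (e3 - e1) ^+ 2.
      by rewrite h2; ring.
    rewrite h1 v w.
    have -> : 2%:R * 0 ^+ 2 - (e1 - e2) ^+ 2 - (d * (e1 - e2)) ^+ 2 - (d ^+ 2 * (e1 - e2)) ^+ 2 =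
      (1 + d + d ^+ 2) * (- (1 - d + d ^+ 2) * (e1 - e2) ^+ 2) :> K by ring.
    by rewrite d3 mul0r.
  by move/eqP; rewrite !mulf_eq0 (negPf three) (negPf (sw_two CK)) => /eqP.
have B0 : swB CK != 0.
  by apply/eqP => B0; have := sw_disc CK; rewrite A0 B0 !expr0n !mulr0 addr0 eqxx.
have := hasse_0 hpK p2 B0 p31.
have -> : 'X^3 + (swB CK)%:P = fpoly by rewrite /swpoly A0 scale0r add0r.
by rewrite hasse_vanish eqxx.
Qed.

End Endgame.

(** * Short Weierstrass form in characteristic at least 5 *)

Section ShortForm.
Variables (F : fieldType) (E : elliptic_curve F).
Hypotheses (two : 2%:R != 0 :> F) (three : 3%:R != 0 :> F).

Let b2 := wa1 E ^+ 2 + 4%:R * wa2 E.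
Let b4 := 2%:R * wa4 E + wa1 E * wa3 E.
Let b6 := wa3 E ^+ 2 + 4%:R * wa6 E.

(** The usual b2 / 12, which removes the square term of the cubic once the square in y is
    completed. *)
Definition short_shift := b2 / 2%:R / 2%:R / 3%:R.
Local Notation c := short_shift.
Definition shortA := b4 / 2%:R - 3%:R * c ^+ 2.
Definition shortB := 2%:R * c ^+ 3 - c * b4 / 2%:R + b6 / 2%:R / 2%:R.

Lemma short_disc : 4%:R * shortA ^+ 3 + 27%:R * shortB ^+ 2 != 0.
Proof.
have : wdisc E != 0 by exact: ec_smooth.
have -> : wdisc E = - 16%:R * (4%:R * shortA ^+ 3 + 27%:R * shortB ^+ 2).
  rewrite /wdisc /shortA /shortB /c /b2 /b4 /b6; case: E => -[a1 a2 a3 a4 a6] _ /=.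
  by field; rewrite two three.
by rewrite mulf_eq0 negb_or => /andP[].
Qed.

Definition short_form : swcurve F := SWCurve two short_disc.

Definition to_short (P : F * F) := (P.1 + c, P.2 + (wa1 E * P.1 + wa3 E) / 2%:R).

Lemma to_short_inj : injective to_short.
Proof. by move=> [x y] [x' y'] [/addIr -> /addIr ->]. Qed.

Lemma to_short_surj Q : exists P, to_short P = Q.
Proof.
case: Q => u v; exists (u - c, v - (wa1 E * (u - c) + wa3 E) / 2%:R).
by rewrite /to_short /= !subrK.
Qed.

Lemma to_short_on P : swon short_form (Some (to_short P)) = on_curve idfun E (Some P).
Proof.
case: P => x y; rewrite /= -[LHS]subr_eq0 -[RHS]subr_eq0; congr (_ == 0).
rewrite /swf /= /shortA /shortB /c /b2 /b4 /b6.
by field; rewrite two three.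
Qed.

End ShortForm.

Section RationalPoints.
Variables (F : finFieldType) (p m : nat).
Hypotheses (hp : p \in [pchar F]) (hq : #|F| = (p ^ m)%N).
Variables (K : closedFieldType) (iota : {rmorphism F -> K}).
Hypothesis hK : integralRange iota.
Variable E : elliptic_curve F.
Hypotheses (p2 : odd p) (p3 : p != 3).

Let pr : prime p. Proof. exact: pcharf_prime hp. Qed.
Let two : 2%:R != 0 :> F.
Proof. by rewrite -(dvdn_pcharf hp) dvdn_prime2 //; apply: contraTneq p2 => ->. Qed.
Let three : 3%:R != 0 :> F.
Proof. by rewrite -(dvdn_pcharf hp) dvdn_prime2. Qed.

Local Notation C := (short_form E two three).
Local Notation CK := (swmap iota C).

Lemma swon_iota P : swon CK (omap (fun P => (iota P.1, iota P.2)) P) = swon C P.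
Proof.
case: P => [[x y]|] //=; rewrite /swf /= -!rmorphXn -rmorphM -!rmorphD.
exact: (inj_eq (fmorph_inj iota)).
Qed.

(** Pairs off the curve fall on the default value 0; only points of E are enumerated. *)
Definition rational_point (P : option (F * F)) : swpoint CK :=
  insubd (0 : swpoint CK) (omap (fun P => (iota P.1, iota P.2)) (omap (to_short E) P)).

Lemma swval_rational_point P : on_curve idfun E P ->
  swval (rational_point P) = omap (fun P => (iota P.1, iota P.2)) (omap (to_short E) P).
Proof.
move=> h; rewrite /rational_point -[LHS]/(val _) val_insubd swon_iota.
suff -> : swon C (omap (to_short E) P) by [].
by case: P h => // P; rewrite -(to_short_on E two three).
Qed.

Lemma rational_points_short : exists s : seq (swpoint CK), [/\ uniq s,
  forall P, (P \in s) = (swfrob hp hq 1 P == P) & size s = #|on_curve idfun E|].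
Proof.
exists [seq rational_point P | P <- enum (on_curve idfun E)]; split.
- rewrite map_inj_in_uniq ?enum_uniq // => P Q; rewrite !mem_enum => hP hQ.
  move/(congr1 (@swval _ _)); rewrite !swval_rational_point //.
  have ii : injective (fun P : F * F => (iota P.1, iota P.2)).
    by move=> [x y] [x' y'] /= [/fmorph_inj -> /fmorph_inj ->].
  by move/(inj_omap ii)/(inj_omap (@to_short_inj _ E)).
- move=> P; apply/mapP/eqP => [[Q]|].
    rewrite mem_enum => hQ ->; apply: val_inj.
    rewrite /= swval_rational_point //; case: Q hQ => [[x y]|] //= _.
    by rewrite !frobn_iota.
  case eP : (swval P) => [[x y]|] /(congr1 (@swval _ _)); rewrite /= eP /=; last first.
    by move=> _; exists None; [rewrite mem_enum | apply: val_inj; rewrite /= swval_rational_point].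
  case=> e1 e2; have [u eu] := frob1_fixed iota e1; have [v ev] := frob1_fixed iota e2.
  have [Q eQ] := to_short_surj E (u, v).
  have hQ : on_curve idfun E (Some Q).
    rewrite -(to_short_on E two three) eQ -swon_iota.
    by have := swvalP P; rewrite eP eu ev.
  exists (Some Q); first by rewrite mem_enum.
  apply: val_inj; rewrite [RHS](swval_rational_point hQ) [LHS]eP.
  by rewrite -[omap (to_short E) _]/(Some (to_short E Q)) eQ eu ev.
by rewrite size_map cardE.
Qed.

End RationalPoints.

(** * Characteristic two *)

Lemma card_on_curve (F : finFieldType) (E : elliptic_curve F) :
  #|on_curve idfun E| = (\sum_x #|[pred y | on_curve idfun E (Some (x, y))]|).+1.
Proof.
rewrite (cardD1 None) -[_ \in _]/true add1n; congr _.+1.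
pose A := [pred P | on_curve idfun E (Some P)].
have -> : #|[predD1 on_curve idfun E & None]| = #|[seq Some P | P in A]|.
  apply: eq_card => -[P|].
    by rewrite (mem_image (@Some_inj _)) !inE.
  by rewrite !inE; apply/esym/mapP => -[].
rewrite fintype.card_image; last exact: Some_inj.
rewrite -sum1_card; under [RHS]eq_bigr do rewrite -sum1_card.
by rewrite pair_big_dep /=; apply: eq_bigl => -[x y]; rewrite !inE.
Qed.

Section Char2.
Variables (F : finFieldType).
Hypothesis h2 : 2%N \in [pchar F].

Let add2 (x : F) : x + x = 0. Proof. by rewrite -mulr2n -mulr_natl (pcharf0 h2) mul0r. Qed.
Let opp2 (x : F) : - x = x. Proof. by apply/eqP; rewrite eq_sym -addr_eq0 add2. Qed.
Let sqrD2 (x y : F) : (x + y) ^+ 2 = x ^+ 2 + y ^+ 2.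
Proof. by rewrite sqrrD mulr2n add2 addr0. Qed.

Section ArtinSchreier.

Definition ash (z : F) := z ^+ 2 + z.
Definition ash_fiber u := [pred z | ash z == u].
Definition ash_image := [set ash z | z : F].
(* The map ash is additive with a kernel of order 2, so its image has index 2 and
   psi is an additive character. *)
Definition psi (u : F) : int := if u \in ash_image then 1 else -1.

Lemma ashD x y : ash (x + y) = ash x + ash y.
Proof. by rewrite /ash sqrD2; ring. Qed.

Lemma ash_imageD u v : u \in ash_image -> v \in ash_image -> u + v \in ash_image.
Proof. by move=> /imsetP[x _ ->] /imsetP[y _ ->]; rewrite -ashD imset_f. Qed.

Lemma card_ash_fiber u : #|ash_fiber u| = if u \in ash_image then 2%N else 0%N.
Proof.
case: ifPn => [/imsetP[z _ ->]|h].
  have -> : #|ash_fiber (ash z)| = #|[set z; z + 1]|.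
    apply: eq_card => x; rewrite !inE -subr_eq0 opp2 -ashD.
    have -> : ash (x + z) = (x + z) * (x + (z + 1)) by rewrite /ash; ring.
    rewrite mulf_eq0.
    by rewrite !addr_eq0 !opp2.
  by rewrite cards2 -subr_eq0 opprD addNKr oppr_eq0 oner_eq0.
apply: eq_card0 => z.
by apply: contraNF h => /eqP <-; apply: imset_f.
Qed.

Lemma card_ash_image : (#|ash_image| * 2)%N = #|F|.
Proof.
rewrite -[RHS]sum1_card (partition_big ash (mem ash_image)) /=; last by move=> z _; apply: imset_f.
rewrite -sum_nat_const; apply: eq_bigr => u hu.
by rewrite sum1_card -[LHS]/(if true then 2 else 0)%N -hu -card_ash_fiber.
Qed.

Lemma ash_imageU u v : u \notin ash_image -> v \notin ash_image -> u + v \in ash_image.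
Proof.
move=> hu hv; have hT : ash_image :|: [set u + h | h in ash_image] = setT.
  apply/eqP; rewrite eqEcard subsetT /= cardsU cardsT (card_imset _ (@addrI _ u)).
  rewrite addnn -muln2 card_ash_image.
  suff -> : ash_image :&: [set u + h | h in ash_image] = set0 by rewrite cards0 subn0.
  apply/setP => x; rewrite !inE; apply/andP => -[hx /imsetP[h hh e]].
  by case/negP: hu; rewrite -[u](addrK h) -e opp2 ash_imageD.
have : v \in [set: F] by [].
rewrite -hT inE (negPf hv) => /imsetP[h hh ->].
by rewrite addrA add2 add0r.
Qed.

Lemma psiD u v : psi (u + v) = psi u * psi v.
Proof.
rewrite /psi; case: ifPn => [h|h]; case: (boolP (u \in _)) => hu; case: (boolP (v \in _)) => hv //.
- by case/negP: hv; rewrite -[v]add0r -(add2 u) -addrA ash_imageD.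
- by case/negP: hu; rewrite -[u]addr0 -(add2 v) addrA ash_imageD.
- by rewrite ash_imageD in h.
- by rewrite ash_imageU in h.
Qed.

(** If the composite character is trivial the sum is q; otherwise translating by an x0 where it
    takes the value -1 negates the sum. *)
Lemma psi_sum (L : F -> F) : {morph L : x y / x + y} ->
  (#|F|%:Z %| \sum_x psi (L x))%Z.
Proof.
move=> LD; have [/forallP h|/forallPn[x0 hx0]] := boolP [forall x, L x \in ash_image].
  rewrite (eq_bigr (fun=> 1)) => [|x _]; last by rewrite /psi h.
  by rewrite sumr_const natz.
suff -> : \sum_x psi (L x) = 0 by rewrite dvdz0.
have e : \sum_x psi (L x) = - \sum_x psi (L x).
  rewrite {1}(reindex_inj (addIr x0)) -sumrN; apply: eq_bigr => x _ /=.
  by rewrite LD psiD {2}/psi (negPf hx0) mulrN1.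
by move: e; move: (\sum_x _) => t; clear; lia.
Qed.

(** The square is a double sum over x and x + h. In characteristic 2, adding the values of a cubic
    at x and x + h leaves an additive function of x plus a constant, so each inner sum is a multiple
    of q. *)
Lemma psi_sum_cubic (a b c d : F) :
  (#|F|%:Z %| ((\sum_x psi (a * (x ^+ 3 + b * x ^+ 2 + c * x + d))) ^+ 2)%R)%Z.
Proof.
rewrite expr2 mulr_suml.
under eq_bigr => x _.
  rewrite (reindex_inj (addIr x)) mulr_sumr.
  under eq_bigr do rewrite -psiD.
  over.
rewrite exchange_big /=; apply: rpred_sum => h _.
pose L x := a * (x ^+ 2 * h + x * h ^+ 2).
have e x : a * (x ^+ 3 + b * x ^+ 2 + c * x + d) + a * ((h + x) ^+ 3 + b * (h + x) ^+ 2 + c * (h + x) + d)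
    = L x + a * (h ^+ 3 + b * h ^+ 2 + c * h).
  apply/eqP; rewrite -subr_eq0 /L; apply/eqP.
  transitivity (2%:R * (a * (x ^+ 3 + b * x ^+ 2 + c * x + d + b * h * x + x ^+ 2 * h + x * h ^+ 2))); first by ring.
  by rewrite (pcharf0 h2) mul0r.
under eq_bigr do rewrite e psiD.
rewrite -mulr_suml dvdz_mulr // psi_sum // => x y.
by rewrite /L sqrD2; ring.
Qed.

End ArtinSchreier.

Variable E : elliptic_curve F.
Variable m : nat.
Hypothesis hq : #|F| = (2 ^ m)%N.

Let m_gt0 : (0 < m)%N.
Proof. by have := finRing_gt1 F; rewrite hq; case: m => //. Qed.

(** Negation is (x, y) -> (x, y + a1 x + a3). It fixes exactly O and one point of abscissa a3 / a1,
    whose ordinate is unique because squaring is bijective. *)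
Lemma ordinary_even : wa1 E != 0 -> ~~ odd #|on_curve idfun E|.
Proof.
move=> a1.
pose nu (P : option (F * F)) := omap (fun P => (P.1, P.2 + wa1 E * P.1 + wa3 E)) P.
have nuon P : on_curve idfun E (nu P) = on_curve idfun E P.
  case: P => [[x y]|] //=; rewrite -[LHS]subr_eq0 -[RHS]subr_eq0; congr (_ == 0).
  apply/eqP; rewrite -subr_eq0; apply/eqP.
  transitivity (2%:R * (wa1 E * x + wa3 E) * (y + wa1 E * x + wa3 E)); first by ring.
  by rewrite (pcharf0 h2) !mul0r.
have nuK : involutive nu.
  case=> [[x y]|] //=; congr (Some (_, _)).
  transitivity (y + 2%:R * (wa1 E * x + wa3 E)); first by ring.
  by rewrite (pcharf0 h2) mul0r addr0.
have sq_inj : injective (fun x : F => x ^+ 2).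
  by move=> x y /eqP; rewrite -subr_eq0 opp2 -sqrD2 expf_eq0 /= addr_eq0 opp2 => /eqP.
pose x0 := wa3 E / wa1 E.
have [sqr _ sqrK] := injF_bij sq_inj.
pose y0 := sqr (x0 ^+ 3 + wa2 E * x0 ^+ 2 + wa4 E * x0 + wa6 E).
have fx x y : (nu (Some (x, y)) == Some (x, y)) = (x == x0).
  rewrite /= (inj_eq Some_inj) xpair_eqE eqxx /= -[X in _ == X]addr0 -addrA (inj_eq (addrI y)).
  by rewrite addr_eq0 opp2 -[RHS](inj_eq (mulfI a1)) /x0 mulrCA divff // mulr1.
pose s := enum (on_curve idfun E).
have -> : #|on_curve idfun E| = size s by rewrite cardE.
have us : uniq s by exact: enum_uniq.
have ms P : (P \in s) = on_curve idfun E P by rewrite mem_enum.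
clearbody s.
have -> : size s = (size [seq P <- s | nu P == P] + size [seq P <- s | nu P != P])%N.
  by rewrite -(count_predC (fun P => nu P == P) s) -!size_filter.
rewrite oddD.
have -> : size [seq P <- s | nu P == P] = size [:: None; Some (x0, y0)].
  apply: perm_size; apply: uniq_perm => //; first by rewrite filter_uniq.
  case=> [[x y]|]; rewrite mem_filter ms ?fx !inE //.
  rewrite (inj_eq Some_inj) xpair_eqE; case: (eqVneq x x0) => [->|//].
  rewrite /=.
  have -> : wa1 E * x0 * y = wa3 E * y by rewrite /x0 mulrCA divff // mulr1.
  by rewrite -addrA add2 addr0 -(inj_eq sq_inj y y0) /y0 sqrK.
rewrite /= ; apply: (@invol_even _ _ nu); first by rewrite filter_uniq.
move=> P; rewrite !mem_filter !ms => /andP[nP hP]; split=> //.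
by rewrite nuK eq_sym nP nuon.
Qed.

(** The substitution y = a3 z gives z^2 + z = f(x) / a3^2, whose fibre above x has 1 + psi points.
    If a3 vanished as well, the discriminant would be a multiple of 2. *)
Lemma trace_char_sum : wa1 E = 0 ->
  ec_trace E = - \sum_x psi ((wa3 E) ^- 2 * (x ^+ 3 + wa2 E * x ^+ 2 + wa4 E * x + wa6 E)).
Proof.
move=> a1; have a3 : wa3 E != 0.
  apply/eqP => a3; have := ec_smooth E; move: a1 a3; case: (ec_weierstrass E) => /= A1 A2 A3 A4 A6 -> ->.
  case/eqP; have h : 2%:R = 0 :> F by exact: pcharf0 h2.
  transitivity (2%:R * (- 8%:R * A2 ^+ 2 * (4%:R * A2 * A6 - A4 ^+ 2) - 32%:R * A4 ^+ 3 - 216%:R * A6 ^+ 2 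
     + 144%:R * A2 * A4 * A6)); first by ring.
  by rewrite h mul0r.
rewrite /ec_trace card_on_curve.
have fib x : #|[pred y | on_curve idfun E (Some (x, y))]|%:Z =
   1 + psi ((wa3 E) ^- 2 * (x ^+ 3 + wa2 E * x ^+ 2 + wa4 E * x + wa6 E)).
  set u := (_ ^- 2 * _).
  have -> : #|[pred y | on_curve idfun E (Some (x, y))]| = #|ash_fiber u|.
    rewrite -!sum1_card (reindex_inj (mulfI a3)); apply: eq_bigl => z; rewrite !inE /= a1.
    rewrite -[RHS](inj_eq (mulfI (expf_neq0 2 a3))) /u mulVKf ?expf_neq0 // /ash.
    by congr (_ == _); ring.
  by rewrite card_ash_fiber /psi; case: ifP.
rewrite -[X in X.+1]addn0 -addnS PoszD -[Posz (\sum_x _)]natz natr_sum.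
under eq_bigr do rewrite natz fib.
by rewrite big_split /= sumr_const natz; ring.
Qed.

Lemma trace2_char2 : ec_trace E = 2 -> (m <= 2)%N.
Proof.
move=> ht; have [a1|a1] := eqVneq (wa1 E) 0; last first.
  have := ordinary_even a1; move: ht; rewrite /ec_trace hq; case: m m_gt0 => // n _.
  by rewrite expnS; move: (2 ^ n)%N #|_| => u v; clear; lia.
have := psi_sum_cubic ((wa3 E) ^- 2) (wa2 E) (wa4 E) (wa6 E).
have -> : \sum_x psi ((wa3 E) ^- 2 * (x ^+ 3 + wa2 E * x ^+ 2 + wa4 E * x + wa6 E)) = - ec_trace E.
  by rewrite trace_char_sum // opprK.
rewrite ht hq sqrrN; change (2 ^ m %| 2 ^ 2 -> m <= 2)%N.
by rewrite dvdn_Pexp2l.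
Qed.

End Char2.

From mathcomp Require Import finmap.
From mathcomp Require Import all_classical all_reals all_analysis.
Import Order.TTheory GRing.Theory Num.Theory.
Import numFieldNormedType.Exports.
Local Open Scope classical_set_scope.
Local Open Scope ring_scope.

(** * Closed points *)

Definition bpol (F : fieldType) (E : weierstrass F) : {poly F} :=
  wa1 E *: 'X + (wa3 E)%:P.
Definition fpol (F : fieldType) (E : weierstrass F) : {poly F} :=
  'X^3 + (wa2 E *: 'X^2 + wa4 E *: 'X + (wa6 E)%:P).

Lemma size_bpol (F : fieldType) (E : weierstrass F) : (size (bpol E) <= 2)%N.
Proof.
apply: leq_trans (size_polyD _ _) _; rewrite geq_max.
rewrite (leq_trans (size_scale_leq _ _)) ?size_polyX //=.
exact: leq_trans (size_polyC_leq1 _) _.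
Qed.

Lemma size_fpol_tail (F : fieldType) (E : weierstrass F) :
  (size (wa2 E *: 'X^2 + wa4 E *: 'X + (wa6 E)%:P)%R < 4)%N.
Proof.
rewrite ltnS; apply: leq_trans (size_polyD _ _) _; rewrite geq_max.
rewrite (leq_trans (size_polyC_leq1 _)) // andbT.
apply: leq_trans (size_polyD _ _) _; rewrite geq_max.
by rewrite !(leq_trans (size_scale_leq _ _)) ?size_polyX ?size_polyXn.
Qed.

Lemma size_fpol (F : fieldType) (E : weierstrass F) : size (fpol E) = 4%N.
Proof. by rewrite size_polyDl size_polyXn // size_fpol_tail. Qed.

Lemma monic_fpol (F : fieldType) (E : weierstrass F) : fpol E \is monic.
Proof. by rewrite monicE lead_coefDl ?lead_coefXn // size_polyXn size_fpol_tail. Qed.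

Section Curve.
Variables (F K : fieldType) (iota : {rmorphism F -> K}) (E : elliptic_curve F).
Let bK := map_poly iota (bpol E).
Let fK := map_poly iota (fpol E).

Lemma bpolE x : bK.[x] = iota (wa1 E) * x + iota (wa3 E).
Proof. by rewrite /bK /bpol rmorphD /= map_polyZ map_polyX map_polyC !hornerE. Qed.

Lemma fpolE x : fK.[x] = x ^+ 3 + iota (wa2 E) * x ^+ 2 + iota (wa4 E) * x + iota (wa6 E).
Proof.
by rewrite /fK /fpol !rmorphD /= !map_polyZ map_polyX !map_polyXn map_polyC !hornerE.
Qed.

Lemma on_curveE x y : on_curve iota E (Some (x, y)) =
  (y ^+ 2 + bK.[x] * y == fK.[x]).
Proof. by rewrite /= bpolE fpolE mulrDl addrA. Qed.

(** At a ramification point 2 y + b = 0, so the derivative of the norm reduces to b' y - f'. A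
    double root would make the point singular; eliminating a3, a4 and a6 then shows that the
    discriminant is 0. *)
Lemma smooth_wpol (t : {poly K}) x : root (wpol bK fK t) x -> t.[x] = - t.[x] - bK.[x] ->
  ~~ (('X - x%:P) ^+ 2 %| wpol bK fK t).
Proof.
move=> rx e; apply/negP => /dvdpP[r er].
have d0 : (wpol bK fK t)^`().[x] = 0.
  rewrite er expr2 !derivM derivXsubC !hornerE subrr /=; ring.
move: rx; rewrite /root /wpol !hornerE => /eqP hx.
have db : bK^`().[x] = iota (wa1 E).
  by rewrite /bK /bpol rmorphD /= map_polyZ map_polyX map_polyC derivD derivZ derivX derivC !hornerE.
have df : fK^`().[x] = x ^+ 2 *+ 3 + iota (wa2 E) * (x *+ 2) + iota (wa4 E).
  rewrite /fK /fpol !rmorphD /= !map_polyZ map_polyX !map_polyXn map_polyC.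
  rewrite !derivD !derivZ !derivXn derivX derivC !hornerE /=; ring.
move: d0; rewrite /wpol derivB derivD expr2 !derivM !hornerE db df.
move: hx e; rewrite bpolE fpolE.
set y := t.[x]; set y' := (t^`()).[x]; move: (ec_smooth E).
case: E => -[a1 a2 a3 a4 a6] /= _; rewrite /wdisc => hd hx e h'.
move: hd; rewrite -(fmorph_eq0 iota).
rewrite !(rmorphB, rmorphD, rmorphN, rmorphM, rmorphXn, rmorph_nat) /=.
move: hx e h'; move: (iota a1) (iota a2) (iota a3) (iota a4) (iota a6) => A1 A2 A3 A4 A6 hx e h'.
have e3 : A3 = - (y + y) - A1 * x.
  by apply/eqP; rewrite -subr_eq0 -(subrr y) {2}e; apply/eqP; ring.
have e4 : A4 = A1 * y - x ^+ 2 *+ 3 - A2 * (x *+ 2).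
  apply/eqP; rewrite -subr_eq0; apply/eqP; rewrite -[RHS]oppr0 -h' e3; ring.
have e6 : A6 = y ^+ 2 + A1 * x * y + A3 * y - x ^+ 3 - A2 * x ^+ 2 - A4 * x.
  by apply/eqP; rewrite -subr_eq0; apply/eqP; rewrite -[RHS]oppr0 -hx; ring.
move/negP; apply; apply/eqP; rewrite e6 e4 e3; ring.
Qed.

End Curve.

Section ClosedPointsFrobenius.
Variables (F : finFieldType) (p m : nat).
Hypotheses (hp : p \in [pchar F]) (hq : #|F| = (p ^ m)%N).
Variables (K : closedFieldType) (iota : {rmorphism F -> K}).
Hypothesis hK : integralRange iota.
Variable E : elliptic_curve F.
Local Notation q := #|F|.
Local Notation frobn := (@frobn F K).
Local Notation pt := (option (K * K)).
Local Notation cpt := (closed_points iota E).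

Definition frobP (i : nat) (P : pt) : pt :=
  omap (fun xy => (frobn i xy.1, frobn i xy.2)) P.

Lemma frobP0 P : frobP 0 P = P.
Proof. by case: P => [[x y]|] //=; rewrite !frobn0. Qed.

Lemma frobPD i j P : frobP (i + j) P = frobP i (frobP j P).
Proof. by case: P => [[x y]|] //=; rewrite !frobnD. Qed.

Lemma frobP_inj i : injective (frobP i).
Proof.
by move=> [[x y]|] [[x' y']|] //= [] /(frobn_inj hp hq iota)-> /(frobn_inj hp hq iota)->.
Qed.

Lemma frobP_periodic P : exists2 n, (0 < n)%N & frobP n P = P.
Proof.
case: P => [[x y]|]; last by exists 1%N.
by have [n n0 [ex ey]] := frobn_periodic2 hp hq hK x y; exists n => //=; rewrite ex ey.
Qed.

Lemma frobP_inv i P : exists j, frobP j (frobP i P) = P.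
Proof.
have [n n0 e] := frobP_periodic P.
have en k : frobP (n * k) P = P.
  by elim: k => [|k IH]; rewrite ?muln0 ?frobP0 // mulnS frobPD IH.
by exists (n * i - i)%N; rewrite -frobPD subnK ?leq_pmull.
Qed.

Lemma galois_orbitE P : galois_orbit iota P = range (frobP^~ P).
Proof.
apply/seteqP; split => [Q [g [_ gi ->]]|_ [i _ <-]].
  case: P => [[x y]|]; last by exists 0%N.
  by have [i [ex ey]] := autom_frobn hp hq hK x y gi; exists i => //=; rewrite ex ey.
exists (frobm hp hq iota i); split => //.
- exact: (frobn_bij hp hq hK).
- by move=> c; exact: frobn_iota.
Qed.

Lemma frobP_on_curve i P : on_curve iota E (frobP i P) = on_curve iota E P.
Proof.
case: P => [[x y]|] //; rewrite /on_curve /=.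
pose g := frobm hp hq iota i.
have gi c : g (iota c) = iota c by exact: frobn_iota.
have gE z : frobn i z = g z by [].
by rewrite -[RHS](inj_eq (fmorph_inj g)) !(rmorphD g, rmorphM g, rmorphXn g) !gi !gE.
Qed.

Lemma cpt_proof P : on_curve iota E P -> galois_orbit iota P \in closed_points iota E.
Proof. by move=> h; apply/mem_set; exists P. Qed.

Definition cls P (h : on_curve iota E P) : cpt :=
  exist (fun S => S \in closed_points iota E) _ (cpt_proof h).

Lemma cptP (C : cpt) : exists P (h : on_curve iota E P), C = cls h.
Proof.
case: C => S hS; have /set_mem[P h eS] := hS.
by exists P, h; apply: val_inj.
Qed.

Lemma mem_cls P (h : on_curve iota E P) : P \in val (cls h).
Proof. by rewrite /= galois_orbitE; apply/mem_set; exists 0%N => //; rewrite frobP0. Qed.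

Lemma orbit_frobP i P : galois_orbit iota (frobP i P) = galois_orbit iota P.
Proof.
rewrite !galois_orbitE; apply/seteqP; split => _ [j _ <-].
  by exists (j + i)%N => //; rewrite frobPD.
have [k e] := frobP_inv i P.
by exists (j + k)%N => //; rewrite frobPD e.
Qed.

Lemma mem_cpt P (C : cpt) : P \in val C ->
  exists h : on_curve iota E P, C = cls h.
Proof.
have [Q [h ->]] := cptP C; move=> /set_mem /=; rewrite galois_orbitE => -[i _ e].
have h' : on_curve iota E P by rewrite -e frobP_on_curve.
by exists h'; apply: val_inj; rewrite /= -e orbit_frobP.
Qed.

Lemma mem_cpt_uniq P (C C' : cpt) : P \in val C -> P \in val C' -> C = C'.
Proof.
move=> /mem_cpt[h ->] /mem_cpt[h' ->].
by apply: val_inj.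
Qed.

Lemma orbit_seq P : exists2 n, (0 < n)%N & galois_orbit iota P = [set` [seq frobP i P | i <- seq.iota 0 n]].
Proof.
have [n n0 e] := frobP_periodic P; exists n => //; rewrite galois_orbitE.
apply/seteqP; split => [_ [i _ <-]|_ /mapP[i _ ->]]; last by exists i.
have en k : frobP (k * n) P = P.
  by elim: k => [|k IH]; rewrite ?mul0n ?frobP0 // mulSn addnC frobPD e.
apply/mapP; exists (i %% n)%N; first by rewrite mem_iota ltn_pmod.
by rewrite {1}(divn_eq i n) addnC frobPD en.
Qed.

Lemma finite_cpt (C : cpt) : finite_set (val C).
Proof. by have [P [h ->]] := cptP C; have [n _ /= ->] := orbit_seq P; exact: finite_seq. Qed.

Definition cpt_seq (C : cpt) : seq pt := enum_fset (fset_set (val C)).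

Lemma mem_cpt_seq (C : cpt) P : (P \in cpt_seq C) = (P \in val C).
Proof. exact: (in_fset_set (finite_cpt C) P). Qed.

Lemma size_cpt_seq (C : cpt) : size (cpt_seq C) = closed_point_deg C.
Proof. by []. Qed.

Lemma closed_point_deg_gt0 (C : cpt) : (0 < closed_point_deg C)%N.
Proof.
have [P [h ->]] := cptP C; rewrite -size_cpt_seq -has_predT; apply/hasP; exists P => //.
by rewrite mem_cpt_seq mem_cls.
Qed.

Lemma frobP_mem i P (C : cpt) : (frobP i P \in val C) = (P \in val C).
Proof.
apply/idP/idP => [/mem_cpt[h ->]|/mem_cpt[h ->]].
  by rewrite /= orbit_frobP; have [h'] : exists _ : on_curve iota E P, true; [by exists (etrans (esym (frobP_on_curve i P)) h)|move=> _; exact: (mem_cls h')].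
rewrite /= -(orbit_frobP i).
have h' : on_curve iota E (frobP i P) by rewrite frobP_on_curve.
exact: (mem_cls h').
Qed.

Lemma finite_roots (r : {poly K}) : r != 0 -> finite_set [set x | root r x].
Proof.
have [s ->] := closed_field_poly_normal r; rewrite scaler_eq0 negb_or => /andP[l0 _].
apply: (@sub_finite_set _ _ [set` s]); last exact: finite_seq.
by move=> x /=; rewrite rootZ // root_prod_XsubC.
Qed.

(** An orbit with at most n elements repeats among n + 1 successive Frobenius images, so the
    coordinates of its points are roots of one of finitely many polynomials X^(q^j) - X with 1 <= j
    <= n. *)
Lemma finite_cpt_deg n : finite_set [set C : cpt | (closed_point_deg C <= n)%N].
Proof.
pose X j : set K := [set x | root ('X^(q ^ j.+1) - 'X) x].
have fX j : finite_set (X j).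
  apply: finite_roots; rewrite -size_poly_eq0 size_polyDl ?size_polyXn // size_polyN size_polyX.
  by rewrite ltnS (leq_trans (q_gt1 F)) // -{1}(expn1 q) leq_exp2l // q_gt1.
pose U : set pt := None |` \bigcup_(j in `I_n) (Some @` (X j `*` X j)).
have fU : finite_set U.
  rewrite finite_setU; split; first exact: finite_set1.
  apply: bigcup_finite; first exact: finite_II.
  by move=> j _; apply: finite_image; apply: finite_setX.
have h0 : on_curve iota E None by [].
pose f (P : pt) : cpt := if pselect (on_curve iota E P) is left h then cls h else cls h0.
apply: (@sub_finite_set _ _ (f @` U)); last exact: finite_image.
move=> C hC; have [P [h eC]] := cptP C; exists P; last first.
  by rewrite /f; case: pselect => // h'; rewrite eC; apply: val_inj.
case: P h eC => [[x y]|] h eC; last by left.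
right; have : ~~ uniq [seq frobP i (Some (x, y)) | i <- seq.iota 0 n.+1].
  apply/negP => u; suff : (n.+1 <= n)%N by rewrite ltnn.
  apply: leq_trans hC; rewrite -size_cpt_seq -[n.+1](size_iota 0) -(size_map (frobP^~ (Some (x, y)))).
  apply: uniq_leq_size => // _ /mapP[i _ ->].
  by rewrite mem_cpt_seq frobP_mem eC mem_cls.
case/(uniqPn None) => i [j [ij]]; rewrite size_map size_iota => jn.
rewrite !(nth_map 0) ?size_iota ?(ltn_trans ij) // !nth_iota ?(ltn_trans ij) // !add0n => e.
have {}e : frobP (j - i) (Some (x, y)) = Some (x, y).
  by apply: (@frobP_inj i); rewrite -frobPD subnKC ?(ltnW ij).
exists (j - i).-1; first by rewrite /=; lia.
exists (x, y) => //; move: e; rewrite /= => -[ex ey].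
by split; rewrite /X /= prednK ?subn_gt0 // /root !hornerE subr_eq0 -/(frobn _ _) ?ex ?ey.
Qed.

End ClosedPointsFrobenius.

(** Compares sizes through a relation, so that a divisor and its triple can be matched by an
    existence statement without naming a function. *)
Lemma size_rel_leq (T U : eqType) (s : seq T) (s' : seq U) (R : T -> U -> Prop) :
  uniq s -> (forall x, x \in s -> exists2 y, y \in s' & R x y) ->
  (forall x x' y, x \in s -> x' \in s -> R x y -> R x' y -> x = x') ->
  (size s <= size s')%N.
Proof.
elim: s s' => [//|x s IH] s' /= /andP[xs us] h1 i1.
have [y ys' Rxy] := h1 x (mem_head _ _).
have s'0 : (0 < size s')%N by case: s' ys' {h1}.
suff : (size s <= size (rem y s'))%N by rewrite size_rem //; lia.
apply: IH => // [x' hx'|x' x'' y' hx' hx'' r r'].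
  have [|y' hy' r] := h1 x'; first by rewrite inE hx' orbT.
  exists y' => //; have ne : y' != y.
    apply/eqP => e; move: xs; rewrite (i1 x x' y) ?mem_head ?inE ?hx' ?orbT //.
    by rewrite -e.
  by move: (hy'); rewrite (perm_mem (perm_to_rem ys')) inE (negPf ne).
by apply: (i1 x' x'' y'); rewrite ?inE ?hx' ?hx'' ?orbT.
Qed.

Lemma mup_map (K L : fieldType) (g : {rmorphism K -> L}) x (r : {poly K}) : r != 0 ->
  mup (g x) (map_poly g r) = mup x r.
Proof.
move=> r0; have r0' : map_poly g r != 0 by rewrite map_poly_eq0.
have e n : (n <= mup (g x) (map_poly g r))%N = (n <= mup x r)%N.
  rewrite !mup_geq // -(dvdp_map g) rmorphXn /= rmorphB /= map_polyX map_polyC //.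
by apply/eqP; rewrite eqn_leq e leqnn -e leqnn.
Qed.

Lemma mup_leq_size (K : fieldType) (x : K) (r : {poly K}) : r != 0 ->
  (mup x r <= (size r).-1)%N.
Proof.
move=> r0; have : ('X - x%:P) ^+ mup x r %| r by rewrite -mup_geq.
by move/(dvdp_leq r0); rewrite size_exp_XsubC; case: (size r).
Qed.

(** * Galois-stable divisors and triples over F_q *)

Section DivisorCount.
Variables (F : finFieldType) (p m : nat).
Hypotheses (hp : p \in [pchar F]) (hq : #|F| = (p ^ m)%N).
Variables (K : closedFieldType) (iota : {rmorphism F -> K}).
Hypothesis hK : integralRange iota.
Variable E : elliptic_curve F.
Local Notation q := #|F|.
Local Notation cpt := (closed_points iota E).
Local Notation bF := (bpol E).
Local Notation fF := (fpol E).
Local Notation bK := (map_poly iota (bpol E)).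
Local Notation fK := (map_poly iota (fpol E)).
Local Notation frobm := (frobm hp hq iota).

Let smooth t x : root (wpol bK fK t) x -> t.[x] = conj_y bK (x, t.[x]) ->
  ~~ (('X - x%:P) ^+ 2 %| wpol bK fK t).
Proof. exact: smooth_wpol. Qed.

Definition tmap (L M : fieldType) (g : {rmorphism L -> M}) (T : {poly L} * ({poly L} * {poly L})) :=
  (map_poly g T.1, (map_poly g T.2.1, map_poly g T.2.2)).

Lemma map_wpol t : map_poly iota (wpol bF fF t) = wpol bK fK (map_poly iota t).
Proof. by rewrite /wpol rmorphB rmorphD rmorphXn rmorphM. Qed.

Lemma frob_map (r : {poly F}) i : map_poly (frobn F i) (map_poly iota r) = map_poly iota r.
Proof.
rewrite -[LHS]/(map_poly (frobm i) (map_poly iota r)) -map_poly_comp.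
by apply: eq_map_poly => c /=; rewrite frobn_iota.
Qed.

Lemma frob_wpol t i : map_poly (frobm i) (wpol bK fK t) = wpol bK fK (map_poly (frobm i) t).
Proof. by rewrite /wpol rmorphB rmorphD rmorphXn rmorphM /= !frob_map. Qed.

Definition frobA (i : nat) (P : K * K) := (frobn F i P.1, frobn F i P.2).

Lemma onc_on_curve P : onc bK fK P = on_curve iota E (Some P).
Proof. by case: P => x y; rewrite on_curveE. Qed.

Lemma frobA_onc i P : onc bK fK (frobA i P) = onc bK fK P.
Proof. by rewrite !onc_on_curve -(frobP_on_curve hp hq iota E i (Some P)). Qed.

Lemma horner_frob (r : {poly K}) x i : (map_poly (frobn F i) r).[frobn F i x] = frobn F i r.[x].
Proof. exact: (horner_map (frobm i)). Qed.

Lemma conj_frob x y i : conj_y bK (frobn F i x, frobn F i y) = frobn F i (conj_y bK (x, y)).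
Proof.
rewrite /conj_y /= -{1}(frob_map _ i) horner_frob.
by rewrite -[frobn F i (_ - _)]/(frobm i _) rmorphB rmorphN.
Qed.

Lemma pmult_frob T P i : T.1 != 0 -> T.2.1 != 0 ->
  pmult bK (tmap (frobm i) T) (frobA i P) = pmult bK T P.
Proof.
case: T P => [c [g t]] [x y] /= c0 g0; rewrite /pmult /= conj_frob horner_frob.
have fI := frobn_inj hp hq iota (i := i).
by rewrite !(inj_eq fI) (mup_map (frobm i) x c0) (mup_map (frobm i) x g0).
Qed.

Lemma tmap_frob T i : tmap (frobm i) (tmap iota T) = tmap iota T.
Proof. by case: T => [c [g t]]; rewrite /tmap /= !frob_map. Qed.

Lemma triple_okE n T : (T \in triples bF fF n) =
  triple_ok bK fK (tmap iota T) && (triple_deg (tmap iota T) == n).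
Proof.
case: T => [c [g t]]; rewrite (mem_triples (size_bpol E) (monic_fpol E) (size_fpol E)) /triple_ok /triple_deg /=.
by rewrite !map_monic !size_map_poly -map_wpol dvdp_map -!andbA.
Qed.

Lemma pmult_le_deg T P : T.1 != 0 -> T.2.1 != 0 -> (pmult bK T P <= triple_deg T)%N.
Proof.
case: T => [c [g t]] /= c0 g0; rewrite /pmult /triple_deg /=.
have := mup_leq_size P.1 c0; have := mup_leq_size P.1 g0.
move: (mup _ c) (mup _ g) (size c).-1 (size g).-1 (_ == _) (_ == _) => m1 m2 k1 k2 b1 b2.
by clear; move=> ? ?; rewrite -muln2; apply: leq_add; [case: b2 | case: b1 => /=]; lia.
Qed.

Definition cpt_aff (C : cpt) : seq (K * K) := pmap id (cpt_seq C).

Lemma mem_cpt_aff C P : (P \in cpt_aff C) = (Some P \in val C).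
Proof. by rewrite mem_pmap map_id (mem_cpt_seq hp hq hK). Qed.

Lemma uniq_cpt_aff C : uniq (cpt_aff C).
Proof.
by apply: (@pmap_uniq _ _ id Some) => [[]//|]; exact: fset_uniq.
Qed.

Lemma size_cpt_aff (C : cpt) : None \notin val C -> size (cpt_aff C) = closed_point_deg C.
Proof.
move=> h; rewrite size_pmap -size_cpt_seq; apply/eqP; rewrite -all_count.
apply/allP => -[P|] //; rewrite (mem_cpt_seq hp hq hK) => h'.
by rewrite h' in h.
Qed.

(** The bound is [n.+1] so that adding the point at infinity, of degree 1, gives exactly the closed
    points of degree at most n + 1, even for n = 0. The points of degree n + 1 do not affect
    coefficients up to n. *)
Definition affine_cpt n : {fset cpt} :=
  fset_set [set C : cpt | (closed_point_deg C <= n.+1)%N /\ None \notin val C].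

Lemma mem_affine_cpt n (C : cpt) :
  (C \in affine_cpt n) = (closed_point_deg C <= n.+1)%N && (None \notin val C).
Proof.
rewrite in_fset_set; first by apply/idP/andP => [/set_mem|h]; last apply/mem_set.
by apply: sub_finite_set (finite_cpt_deg hp hq hK E n.+1) => C' [].
Qed.

Section FixN.
Variable n : nat.
Local Notation D := (affine_cpt n).
(* Affine effective divisors supported on the closed points of degree at most n,
   with multiplicities at most n. *)
Local Notation dfun := {ffun D -> 'I_n.+1}.

Definition dfun_seq (f : dfun) : seq (K * K) :=
  flatten [seq flatten (nseq (f C) (cpt_aff (val C))) | C <- enum {: D}].

Definition dfun_deg (f : dfun) : nat := \sum_(C : D) f C * closed_point_deg (val C).

Lemma size_dfun_seq f : size (dfun_seq f) = dfun_deg f.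
Proof.
rewrite size_flatten /shape -map_comp sumnE big_map big_enum /=.
apply: eq_bigr => C _; rewrite size_flatten /shape map_nseq sumn_nseq mulnC size_cpt_aff //.
by have := valP C; rewrite mem_affine_cpt => /andP[].
Qed.

Lemma count_dfun_seq f P :
  count_mem P (dfun_seq f) = (\sum_(C : D) f C * (Some P \in val (val C)))%N.
Proof.
rewrite count_flatten -map_comp sumnE big_map big_enum /=.
apply: eq_bigr => C _; rewrite count_flatten map_nseq sumn_nseq mulnC.
by rewrite count_uniq_mem ?uniq_cpt_aff // mem_cpt_aff.
Qed.

Lemma count_dfun_mem f P (C : D) : Some P \in val (val C) ->
  count_mem P (dfun_seq f) = f C.
Proof.
move=> h; rewrite count_dfun_seq (bigD1 C) //= h muln1 big1 ?addn0 // => C' ne.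
case: (boolP (_ \in _)) => [h'|_]; last by rewrite muln0.
by case/eqP: ne; apply: val_inj; exact: (mem_cpt_uniq hp hq hK h' h).
Qed.

Lemma dfun_seq_onc f : all (onc bK fK) (dfun_seq f).
Proof.
apply/allP => P /flatten_mapP[C _ /flattenP[s]].
rewrite mem_nseq => /andP[_ /eqP ->]; rewrite mem_cpt_aff onc_on_curve.
by move/(mem_cpt hp hq hK) => [].
Qed.

Lemma count_dfun_frob f P i : count_mem (frobA i P) (dfun_seq f) = count_mem P (dfun_seq f).
Proof.
rewrite !count_dfun_seq; apply: eq_bigr => C _.
by rewrite -[Some (frobA i P)]/(frobP F i (Some P)) (frobP_mem hp hq hK).
Qed.

Definition dfun_rel (f : dfun) (T : {poly F} * ({poly F} * {poly F})) :=
  forall P, onc bK fK P -> count_mem P (dfun_seq f) = pmult bK (tmap iota T) P.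

(** The triple is found over K. Its Frobenius image has the same multiplicities, hence equals it by
    uniqueness, and its coefficients descend to F. *)
Lemma dfun_to_triple f : exists2 T, T \in triples bF fF (dfun_deg f) & dfun_rel f T.
Proof.
have [T [okT dT hT]] := pmult_exists (dfun_seq_onc f).
have [c0 g0] : T.1 != 0 /\ T.2.1 != 0.
  by case/and4P: (okT) => mc mg _ _; split; exact: monic_neq0.
have okT' : triple_ok bK fK (tmap (frobm 1) T).
  case/and4P: (okT) => mc mg st hd.
  have mc' : map_poly (frobm 1) T.1 \is monic by rewrite map_monic.
  have mg' : map_poly (frobm 1) T.2.1 \is monic by rewrite map_monic.
  have st' : (size (map_poly (frobm 1) T.2.2) < size (map_poly (frobm 1) T.2.1))%N.
    by rewrite !size_map_poly.
  have hd' : map_poly (frobm 1) T.2.1 %| wpol bK fK (map_poly (frobm 1) T.2.2).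
    by rewrite -frob_wpol dvdp_map.
  by apply/and4P.
have eT : tmap (frobm 1) T = T.
  apply: (pmult_inj smooth okT' okT) => P hP.
  have [h _ hK'] := frobn_bij hp hq hK 1.
  pose P' := (h P.1, h P.2).
  have eP : P = frobA 1 P' by rewrite /frobA /= !hK' -surjective_pairing.
  have hP' : onc bK fK P' by rewrite -(frobA_onc 1) -eP.
  clearbody P'; rewrite eP (pmult_frob _ _ c0 g0) -(hT _ hP') -(hT (frobA 1 P')).
    by rewrite count_dfun_frob.
  by rewrite frobA_onc.
case: T okT dT hT eT {c0 g0 okT'} => [c [g t]] okT dT hT [ec eg et].
have [c1 e1] := frob_poly_descent hp hq iota ec.
have [g1 e2] := frob_poly_descent hp hq iota eg.
have [t1 e3] := frob_poly_descent hp hq iota et.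
exists (c1, (g1, t1)); first by rewrite triple_okE /tmap /= -e1 -e2 -e3 okT dT size_dfun_seq eqxx.
by rewrite /dfun_rel /tmap /= -e1 -e2 -e3.
Qed.

(** Multiplicities are constant along Frobenius orbits, so the whole closed point lies in the
    support of T, which has at most deg T points. *)
Lemma cls_deg_le T P (C : cpt) : triple_ok bK fK (tmap iota T) -> onc bK fK P ->
  (0 < pmult bK (tmap iota T) P)%N -> Some P \in val C ->
  None \notin val C -> (closed_point_deg C <= triple_deg (tmap iota T))%N.
Proof.
move=> ok hP pos hC aC; rewrite -size_cpt_aff //.
have [c0 g0] : (tmap iota T).1 != 0 /\ (tmap iota T).2.1 != 0.
  by case/and4P: (ok) => mc mg _ _; split; exact: monic_neq0.
have hQ Q : Q \in cpt_aff C -> onc bK fK Q /\ (0 < pmult bK (tmap iota T) Q)%N.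
  rewrite mem_cpt_aff => hQ.
  have [h eC] := mem_cpt hp hq hK hC; move: hQ; rewrite eC /= => /set_mem.
  rewrite (galois_orbitE hp hq hK) => -[i _ /= [<-]].
  by rewrite -/(frobA i P) frobA_onc -(tmap_frob _ i) pmult_frob.
have [ych hy] := choice (fun x => exists_onc bK fK x).
case: (tmap iota T) ok c0 g0 hQ {pos} => [c [g t]] /and4P[/= mc mg st hd] c0 g0 hQ.
have [rc ec] := closed_field_poly_normal c; have [rg eg] := closed_field_poly_normal g.
rewrite (eqP mc) scale1r in ec; rewrite (eqP mg) scale1r in eg.
(* All candidates for the support: two points for each root of c and one for each root of g, hence 2
   deg c + deg g in all. *)
pose Z := [seq (x, ych x) | x <- rc] ++ [seq (x, conj_y bK (x, ych x)) | x <- rc]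
           ++ [seq (x, t.[x]) | x <- rg].
have -> : triple_deg (c, (g, t)) = size Z.
  by rewrite /triple_deg /= !size_cat !size_map addnA addnn ec eg !size_prod_XsubC.
apply: uniq_leq_size; first exact: uniq_cpt_aff.
move=> [x y] /hQ[hxy]; rewrite /pmult /= addn_gt0 !muln_gt0 => /orP[/andP[h _]|/andP[h1 h2]].
  have xc : x \in rc by rewrite -root_prod_XsubC -ec -mup_gt0.
  rewrite !mem_cat; have [->|->] := onc_same_x (hy x) hxy.
    by rewrite map_f.
  by rewrite (map_f (fun x => (x, conj_y bK (x, ych x)))) ?orbT.
have xg : x \in rg by rewrite -root_prod_XsubC -eg -mup_gt0.
move: h1; rewrite lt0b => /eqP <-.
by rewrite !mem_cat (map_f (fun x => (x, t.[x]))) ?orbT.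
Qed.

Lemma aff_of_onc P : onc bK fK P -> exists2 C : cpt, Some P \in val C & None \notin val C.
Proof.
move=> hP; have h : on_curve iota E (Some P) by rewrite -onc_on_curve.
exists (cls h); first exact: (mem_cls hp hq hK h).
by apply/negP => /set_mem /=; rewrite (galois_orbitE hp hq hK) => -[].
Qed.

Lemma triple_to_dfun i T : (i <= n)%N -> T \in triples bF fF i ->
  exists2 f, dfun_deg f = i & dfun_rel f T.
Proof.
move=> hi; rewrite triple_okE => /andP[okT /eqP dT].
have [c0 g0] : (tmap iota T).1 != 0 /\ (tmap iota T).2.1 != 0.
  by case/and4P: (okT) => mc mg _ _; split; exact: monic_neq0.
have rep (C : D) : exists P, Some P \in val (val C).
  have := valP C; rewrite mem_affine_cpt => /andP[_ nC].
  have := closed_point_deg_gt0 hp hq hK (val C); rewrite -size_cpt_aff //.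
  case e : (cpt_aff (val C)) => [//|P s] _.
  by exists P; rewrite -mem_cpt_aff e mem_head.
have [r hr] := choice rep.
(* One representative per orbit suffices. [inord] does not truncate, since a multiplicity is at most
   the degree of the triple, which is at most n. *)
pose f : dfun := [ffun C => inord (pmult bK (tmap iota T) (r C))].
have hf : dfun_rel f T.
  move=> P hP; have [C hC aC] := aff_of_onc hP.
  have [CD|CD] := boolP (C \in D).
    rewrite (@count_dfun_mem f P [` CD]%fset) // ffunE inordK; last first.
      by rewrite ltnS (leq_trans (pmult_le_deg _ _ _)) // dT.
    move: (r [` CD]%fset) (hr [` CD]%fset) => Q /= hQ.
    have [h eC] := mem_cpt hp hq hK hC; move: hQ; rewrite eC /= => /set_mem.
    rewrite (galois_orbitE hp hq hK) => -[j _ /= [<-]].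
    by rewrite -/(frobA j P) -[in LHS](tmap_frob _ j) pmult_frob.
  have -> : count_mem P (dfun_seq f) = 0%N.
    rewrite count_dfun_seq big1 // => C' _; case: (boolP (_ \in _)) => [h|_]; last by rewrite muln0.
    by move: CD; rewrite (mem_cpt_uniq hp hq hK hC h) (valP C').
  apply/esym/eqP; rewrite -leqn0 leqNgt; apply: contra CD => pos.
  rewrite mem_affine_cpt aC andbT.
  by rewrite (leq_trans (cls_deg_le okT hP pos hC aC)) // dT; apply: leqW.
exists f => //.
have [T' [okT' dT' hT']] := pmult_exists (dfun_seq_onc f).
suff e : T' = tmap iota T by rewrite -size_dfun_seq -dT' e.
by apply: (pmult_inj smooth okT' okT) => P hP; rewrite -hT' // hf.
Qed.

Lemma card_dfun i : (i <= n)%N -> #|[set f : dfun | dfun_deg f == i]%SET| = ntriples bF fF i.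
Proof.
move=> hi; rewrite cardE; set s := enum _.
have us : uniq s by exact: enum_uniq.
have ms f : (f \in s) = (dfun_deg f == i) by rewrite mem_enum inE.
have onP (C : D) P : Some P \in val (val C) -> onc bK fK P.
  by rewrite onc_on_curve => /(mem_cpt hp hq hK)[].
apply/eqP; rewrite eqn_leq; apply/andP; split.
  apply: (@size_rel_leq _ _ _ _ dfun_rel us) => [f|f f' T _ _ h h'].
    by rewrite ms => /eqP <-; exact: dfun_to_triple.
  apply/ffunP => C; apply: val_inj => /=.
  have := valP C; rewrite mem_affine_cpt => /andP[_ nC].
  have := closed_point_deg_gt0 hp hq hK (val C); rewrite -size_cpt_aff //.
  case e : (cpt_aff (val C)) => [//|P r] _.
  have hP : Some P \in val (val C) by rewrite -mem_cpt_aff e mem_head.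
  by rewrite -(count_dfun_mem f hP) -(count_dfun_mem f' hP) h ?h' //; exact: onP hP.
apply: (@size_rel_leq _ _ _ _ (fun T f => dfun_rel f T)); first exact: uniq_triples.
  by move=> T /(triple_to_dfun hi)[f df hf]; exists f => //; rewrite ms df.
move=> T T' f; rewrite !triple_okE => /andP[ok _] /andP[ok' _] h h'.
have : tmap iota T = tmap iota T'.
  by apply: (pmult_inj smooth ok ok') => P hP; rewrite -h // h'.
case: T T' {ok ok' h h'} => [c [g t]] [c' [g' t']] [] .
by do 3!move/(map_poly_inj iota)->.
Qed.

End FixN.
End DivisorCount.

(** * Recurrence for the Mertens function *)

Section Inversion.
Variables (F : finFieldType) (p m : nat).
Hypotheses (hp : p \in [pchar F]) (hq : #|F| = (p ^ m)%N).
Variables (K : closedFieldType) (iota : {rmorphism F -> K}).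
Hypothesis hK : integralRange iota.
Variable E : elliptic_curve F.
Local Notation q := #|F|.
Local Notation cpt := (closed_points iota E).
Local Notation bF := (bpol E).
Local Notation fF := (fpol E).
Local Notation D n := (affine_cpt iota E n).
Local Notation deg := (@closed_point_deg _ _ iota E).

(** The inverse zeta function of the affine curve, with its Euler product cut at degree n + 1. *)
Definition mobpol n : {poly int} := \prod_(C <- D n) (1 - 'X^(deg C)).

Lemma sum_dfun n : \sum_(f : {ffun D n -> 'I_n.+1}) 'X^(dfun_deg f) =
  \prod_(C : D n) \sum_(k < n.+1) ('X^(k * deg (val C)) : {poly int}).
Proof. by rewrite bigA_distr_bigA; apply: eq_bigr => f _; rewrite prodrXr. Qed.

(** Each truncated geometric series times its Euler factor telescopes to 1 - X^((n+1) deg C), which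
    is 1 up to degree n. *)
Lemma mobpol_sum_dfun n : exists R : {poly int},
  mobpol n * \sum_(f : {ffun D n -> 'I_n.+1}) 'X^(dfun_deg f) = 1 + 'X^(n.+1) * R.
Proof.
rewrite sum_dfun /mobpol big_seq_fsetE -big_split /=.
apply: (big_ind (fun r : {poly int} => exists R, r = 1 + 'X^(n.+1) * R)).
- by exists 0; rewrite mulr0 addr0.
- move=> _ _ [R1 ->] [R2 ->]; exists (R1 + R2 + R1 * 'X^(n.+1) * R2).
  by rewrite mulrDl !mulrDr !mul1r !mulr1 -!mulrA -!addrA; congr (_ + _); rewrite addrCA.
move=> C _; exists (- 'X^(n.+1 * (deg (val C)).-1)).
rewrite mulrN -exprD -mulnS prednK; last exact: (closed_point_deg_gt0 hp hq hK).
under eq_bigr => k _ do rewrite mulnC exprM.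
by rewrite -[RHS]opprK opprB mulnC exprM subrX1 -mulNr opprB.
Qed.

Lemma coef_sum_dfun n i : (i <= n)%N ->
  (\sum_(f : {ffun D n -> 'I_n.+1}) ('X^(dfun_deg f) : {poly int}))`_i
    = (ntriples bF fF i)%:Z.
Proof.
move=> hi; rewrite -(card_dfun hp hq hK E hi) coef_sum.
under eq_bigr => f _ do rewrite coefXn eq_sym.
rewrite -sum1_card -natz natr_sum /= big_mkcond [RHS]big_mkcond; apply: eq_bigr => f _ /=.
by rewrite inE; case: (_ == _).
Qed.

Lemma mobpol_conv n k : (k <= n)%N ->
  \sum_(i < k.+1) (mobpol n)`_i * (ntriples bF fF (k - i))%:Z = (k == 0)%N%:R.
Proof.
move=> hk; have [R eR] := mobpol_sum_dfun n.
have := congr1 (fun r : {poly int} => r`_k) eR.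
rewrite coefM coefD coefXnM ltnS hk addr0 coef1 => <-.
by apply: eq_bigr => i _; rewrite coef_sum_dfun // (leq_trans (leq_subr _ _)).
Qed.

Lemma none_on_curve : on_curve iota E None. Proof. by []. Qed.

Definition Ocpt : cpt := cls none_on_curve.

Lemma val_Ocpt : val Ocpt = [set None].
Proof.
rewrite /= (galois_orbitE hp hq hK); apply/seteqP; split => [_ [i _ <-]//|_ ->].
by exists 0%N.
Qed.

Lemma deg_Ocpt : deg Ocpt = 1%N.
Proof. by rewrite /closed_point_deg val_Ocpt fset_set1 cardfs1. Qed.

Lemma None_mem (C : cpt) : (None \in val C) = (C == Ocpt).
Proof.
apply/idP/eqP => [h|->]; last by rewrite val_Ocpt; apply/mem_set.
by apply: (mem_cpt_uniq hp hq hK h); rewrite val_Ocpt; apply/mem_set.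
Qed.

Definition allcpt n : {fset cpt} := (Ocpt |` D n)%fset.

Lemma mem_allcpt n C : (C \in allcpt n) = (deg C <= n.+1)%N.
Proof.
rewrite in_fset1U (mem_affine_cpt hp hq hK) None_mem.
by case: eqVneq => [->|_]; rewrite ?deg_Ocpt // andbT.
Qed.

Definition inddiv n (A : {set allcpt n}) : effective_divisor iota E :=
  [fsfun C in [fsetval C in A]%fset => 1%N].

Lemma mem_fsetval n (A : {set allcpt n}) (C : allcpt n) :
  (val C \in [fsetval C in A]%fset) = (C \in A).
Proof.
apply/imfsetP/idP => [[C' hC' /val_inj ->]//|h]; by exists C.
Qed.

Lemma inddivE n (A : {set allcpt n}) C : inddiv A C = (C \in [fsetval C in A]%fset).
Proof. by rewrite fsfun_fun; case: ifP. Qed.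

Lemma finsupp_inddiv n (A : {set allcpt n}) : finsupp (inddiv A) = [fsetval C in A]%fset.
Proof.
by apply/fsetP => C; rewrite mem_finsupp inddivE; case: (_ \in _).
Qed.

Lemma inddiv_inj n : injective (@inddiv n).
Proof.
move=> A A' e; apply/setP => C.
by rewrite -!mem_fsetval -!finsupp_inddiv e.
Qed.

Definition set_deg n (A : {set allcpt n}) : nat := \sum_(C in A) deg (val C).

Lemma inddiv_deg n (A : {set allcpt n}) : divisor_deg (inddiv A) = set_deg A.
Proof.
rewrite /divisor_deg finsupp_inddiv.
rewrite (eq_big_seq (fun C => deg C)); last by move=> C hC; rewrite inddivE hC mul1n.
rewrite big_imfset /=; last by move=> ? ? _ _; exact: val_inj.
by rewrite big_enum.
Qed.

Lemma inddiv_mobius n (A : {set allcpt n}) : ec_mobius (inddiv A) = (-1) ^+ #|A|.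
Proof.
rewrite /ec_mobius asboolF; last by move=> [C]; rewrite inddivE; case: (_ \in _).
rewrite finsupp_inddiv card_imfset; last exact: val_inj.
by rewrite -cardE.
Qed.

(** Only sums of distinct closed points contribute, and those of degree at most n have their support
    in [allcpt n]; they become subsets of this finite set. *)
Lemma ec_mertensE_sum n : ec_mertens iota E n.+1 =
  \sum_(A : {set allcpt n} | (set_deg A <= n)%N) (-1) ^+ #|A|.
Proof.
rewrite /ec_mertens subn1 /=.
pose r := [seq inddiv A | A <- enum {set allcpt n} & (set_deg A <= n)%N].
have rA N : N \in r -> (divisor_deg N <= n)%N.
  by move=> /mapP[A]; rewrite mem_filter => /andP[hS _] ->; rewrite inddiv_deg.
rewrite (fsbigE r); first last.
- move=> N /= hN; apply: contraNeq => hmu.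
  have N1 C : (N C <= 1)%N.
    rewrite leqNgt; apply: contraNN hmu => h.
    by rewrite /ec_mobius asboolT //; exists C.
  have hsupp : (finsupp N `<=` allcpt n)%fset.
    apply/fsubsetP => C hC; rewrite mem_allcpt leqW //; apply: leq_trans hN.
    rewrite /divisor_deg (big_fsetD1 C) //=; apply: leq_trans (leq_addr _ _).
    by rewrite leq_pmull // lt0n -mem_finsupp.
  have eN : N = inddiv (fsub (allcpt n) (finsupp N)).
    apply/fsfunP => C; rewrite inddivE fset_fsub // mem_finsupp.
    by have := N1 C; case: (N C) => [|[]].
  apply/mapP; exists (fsub (allcpt n) (finsupp N)) => //.
  by rewrite mem_filter mem_enum andbT -inddiv_deg -eN.
- by move=> N /= /rA.
- rewrite (map_inj_uniq (@inddiv_inj n)); exact/filter_uniq/enum_uniq.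
rewrite big_mkcond big_map big_filter big_enum_cond /=.
apply: eq_bigr => A hS; rewrite mem_set /=; last by rewrite inddiv_deg.
exact: inddiv_mobius.
Qed.

Lemma ec_mertens_coef n : ec_mertens iota E n.+1 = (mobpol n)`_n.
Proof.
rewrite ec_mertensE_sum.
have eP : (1 - 'X) * mobpol n = \sum_(A : {set allcpt n}) (-1) ^+ #|A| *: 'X^(set_deg A).
  have -> : (1 - 'X) * mobpol n = \prod_(C <- allcpt n) (1 - 'X^(deg C)).
    rewrite big_fsetU1 /= ?deg_Ocpt ?expr1 //.
    by rewrite (mem_affine_cpt hp hq hK) None_mem eqxx andbF.
  rewrite big_seq_fsetE /=.
  under eq_bigr => C _ do rewrite addrC.
  rewrite bigA_distr; apply: eq_bigr => A _.
  rewrite -[LHS]/(\prod_C _) (bigID (mem A)) /= [X in _ * X]big1 ?mulr1; last first.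
    by move=> C /negPf ->.
  rewrite (eq_bigr (fun C => (-1) * 'X^(deg (val C)))); last by move=> C ->; rewrite mulN1r.
  rewrite big_split /= prodr_const prodrXr.
  by rewrite -mul_polyC rmorphXn rmorphN1.
have eM : mobpol n = mobpol n.
  by [].
(* Partial sums of coefficients undo the factor 1 - X contributed by the point at infinity. *)
have hs k : \sum_(j < k.+1) ((1 - 'X) * mobpol n)`_j = (mobpol n)`_k.
  elim: k => [|k IH]; first by rewrite big_ord1 mulrBl mul1r coefB coefXM subr0.
  by rewrite big_ord_recr IH /= mulrBl mul1r coefB coefXM /= addrC subrK.
rewrite -hs eP.
under [RHS]eq_bigr => j _.
  rewrite coef_sum.
  under eq_bigr => A _ do rewrite coefZ coefXn.
  over.
rewrite exchange_big /= [LHS]big_mkcond; apply: eq_bigr => A _ /=.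
rewrite -big_distrr /=; case: leqP => hS.
  rewrite (bigD1 (Ordinal (hS : set_deg A < n.+1)%N)) //= eqxx big1 ?addr0 ?mulr1 //.
  by move=> j; rewrite -val_eqE /= => /negPf ->.
rewrite big1 ?mulr0 // => j _; case: eqP => // e.
by have := ltn_ord j; rewrite e ltnNge hS.
Qed.

End Inversion.

(* c_n = M(n+1): the power series inverse of the zeta function of the affine
   curve is (1 - q u) / (1 - a u + q u^2). *)
Fixpoint mseq (q a : int) (n : nat) {struct n} : int :=
  match n with
  | 0 => 1
  | n'.+1 => if n' is n''.+1 then a * mseq q a n' - q * mseq q a n'' else a - q
  end.

Lemma mseqSS q a n : mseq q a n.+2 = a * mseq q a n.+1 - q * mseq q a n.
Proof. by []. Qed.

Section Recurrence.
Variables (T : nat -> int) (q a : int).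
Hypotheses (T0 : T 0%N = 1) (T1 : T 1%N = q - a)
  (TSS : forall n, T n.+2 = q ^+ n.+1 * (q - a + 1)).

Lemma mseq_conv k : \sum_(i < k.+1) mseq q a i * T (k - i) = (k == 0)%N%:R.
Proof.
case: k => [|k]; first by rewrite big_ord1 T0 mulr1.
elim: k => [|k IH].
  by rewrite big_ord_recr big_ord1 /= subn0 subnn T0 T1; ring.
case: k IH => [|k] IH.
  rewrite !big_ord_recr big_ord0 /= !subSS !subn0 T0 T1 (TSS 0) expr1; ring.
(* From degree 2 on T is geometric of ratio q, and the recurrence absorbs the few remaining
   terms. *)
suff -> : \sum_(i < k.+4) mseq q a i * T (k.+3 - i) =
    q * \sum_(i < k.+3) mseq q a i * T (k.+2 - i) by rewrite IH mulr0.
rewrite [LHS]big_ord_recr [X in X + _ = _]big_ord_recr /=.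
rewrite big_ord_recr /= subnn T0 !mulr1.
rewrite [in RHS]big_ord_recr [in X in q * (X + _)]big_ord_recr /=.
have e2 : (k.+3 - k.+1 = 2)%N by lia.
have e1 : (k.+3 - k.+2 = 1)%N by lia.
have e1' : (k.+2 - k.+1 = 1)%N by lia.
rewrite e1 e1' e2 subnn T0 T1 (TSS 0).
have -> : \sum_(i < k.+1) mseq q a i * T (k.+3 - i) =
   q * \sum_(i < k.+1) mseq q a i * T (k.+2 - i).
  rewrite big_distrr; apply: eq_bigr => i _ /=.
  have -> : (k.+3 - i = (k - i).+3)%N by have := ltn_ord i; lia.
  have -> : (k.+2 - i = (k - i).+2)%N by have := ltn_ord i; lia.
  rewrite !TSS [in LHS]exprS; ring.
rewrite -/(mseq q a k.+1) -/(mseq q a k.+2) !mseqSS.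
move: (\sum_(i < _) _) (mseq q a k.+1) (mseq q a k) => s c1 c0; ring.
Qed.

Lemma conv_uniq (c : nat -> int) n :
  (forall k, (k <= n)%N -> \sum_(i < k.+1) c i * T (k - i) = (k == 0)%N%:R) ->
  forall k, (k <= n)%N -> c k = mseq q a k.
Proof.
move=> h; elim/ltn_ind => k IH hk.
have := h k hk; rewrite -(mseq_conv k) !big_ord_recr /= subnn T0 !mulr1.
rewrite (eq_bigr (fun i : 'I_k => mseq q a i * T (k - i))) ?[_ = _ + _]eq_sym.
  by move/addrI.
by move=> i _; rewrite IH // (leq_trans _ hk) // ltnW.
Qed.

End Recurrence.

Section MertensRecurrence.
Variables (F : finFieldType) (p m : nat).
Hypotheses (hp : p \in [pchar F]) (hq : #|F| = (p ^ m)%N).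
Variables (K : closedFieldType) (iota : {rmorphism F -> K}).
Hypothesis hK : integralRange iota.
Variable E : elliptic_curve F.
Local Notation q := #|F|.
Local Notation bF := (bpol E).
Local Notation fF := (fpol E).

Lemma card_points : #|on_curve idfun E| = (rmumf bF fF 1).+1.
Proof.
have bi (r : {poly F}) : map_poly idfun r = r by exact: map_poly_id.
have h x y : ((x, y) \in [pred P : F * F | on_curve idfun E (Some P)])
   = ('X - x%:P %| wpol bF fF y%:P).
  rewrite inE on_curveE dvdp_XsubCl /root /wpol !hornerE !bi subr_eq0.
  by rewrite !hornerE.
have -> : #|on_curve idfun E| = #|[pred P : F * F | on_curve idfun E (Some P)]|.+1.
  rewrite -(cardID (pred1 None)) (@fintype.eq_card1 _ None); last first.
    by move=> [P|]; rewrite !inE // andbF.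
  rewrite add1n; congr _.+1; rewrite -[RHS](fintype.card_image (@Some_inj _)).
  apply: fintype.eq_card => -[P|]; rewrite !inE /=; last by apply/esym/negbTE/fintype.imageP => -[].
  apply/idP/fintype.imageP => [h'|[P' hP' [->]]]; last by [].
  by exists P.
congr _.+1; rewrite cardE /rmumf /nmumf.
apply: (@size_bij _ _ _ _ (fun P : F * F => ('X - P.1%:P, P.2%:P))
   (fun gt : {poly F} * {poly F} => (- gt.1`_0, gt.2`_0))).
- exact: enum_uniq.
- exact: uniq_mumf.
- move=> [x y]; rewrite mem_enum h => hd; split; last first.
    by rewrite /= coefB coefX !coefC /= sub0r opprK.
  rewrite mem_mumf monicXsubC size_XsubC eqxx hd.
  by rewrite (leq_trans (size_polyC_leq1 _)).
move=> [g t]; rewrite mem_mumf => /and4P[mg /eqP sg st hd].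
have et : t = (t`_0)%:P by exact: size1_polyC.
have eg : g = 'X - (- g`_0)%:P.
  apply/polyP => -[|[|i]]; rewrite coefB coefX coefC /= ?polyCN ?coefN ?coefC /= ?sub0r ?opprK //.
    by rewrite subr0; move: mg; rewrite monicE lead_coefE sg => /eqP.
  by rewrite nth_default ?sg // ?subrr ?oppr0 ?addr0.
split; last by rewrite -eg -et.
by rewrite mem_enum h -eg -et.
Qed.

Theorem ec_mertens_mseq n : ec_mertens iota E n.+1 = mseq q%:Z (ec_trace E) n.
Proof.
rewrite (ec_mertens_coef hp hq hK).
have N1 : ((rmumf bF fF 1)%:Z = q%:Z - ec_trace E)%R.
  by rewrite /ec_trace card_points -(addn1 (rmumf bF fF 1)) PoszD; ring.
have sb := size_bpol E; have mf := monic_fpol E; have sf := size_fpol E.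
apply: (@conv_uniq (fun i => (ntriples bF fF i)%:Z) q (ec_trace E) _ _ _
   (fun i => (mobpol iota E n)`_i) n) => //.
- by rewrite ntriples0.
- by rewrite ntriples1.
- by move=> k; rewrite ntriples_gt1 // PoszM -N1 -(addn1 (rmumf bF fF 1)) PoszD -!natz natrX.
by move=> k; exact: (mobpol_conv hp hq hK).
Qed.

End MertensRecurrence.

(** * Growth of the recurrence *)

Section Density.
Variable R : realType.

(** Multiples of a step eta between 0 and e leave no gap of length e: i eta is the last one below be
    + L, where the integer L is chosen so that i >= N. *)
Lemma rotation_core (al be e : R) (d N : nat) (j0 : int) : (0 < d)%N ->
  0 < d%:R * al - j0%:~R < e ->
  exists2 n, (N <= n)%N & exists j : int, `|n%:R * al - be - j%:~R| < e.
Proof.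
move=> d0; set eta := d%:R * al - j0%:~R => /andP[eta0 etae].
pose L : int := Num.ceil (N%:R * eta - be).
have hL : N%:R * eta <= be + L%:~R.
  by have := Num.Theory.ceil_ge (N%:R * eta - be); rewrite -/L; lra.
pose i := `|Num.floor ((be + L%:~R) / eta)|%N.
have fN : (N%:Z <= Num.floor ((be + L%:~R) / eta)).
  by rewrite floor_ge_int ler_pdivlMr.
have iE : (i%:Z = Num.floor ((be + L%:~R) / eta))%R.
  by rewrite /i gez0_abs // (le_trans _ fN).
have iR : (i%:R : R) = (Num.floor ((be + L%:~R) / eta))%:~R by rewrite -iE.
have h1 : i%:R * eta <= be + L%:~R.
  by rewrite -ler_pdivlMr // iR floor_le.
have h2 : be + L%:~R < (i%:R + 1) * eta.
  rewrite -ltr_pdivrMr // iR; have := floorD1_gt ((be + L%:~R) / eta).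
  by rewrite intrD.
exists (i * d)%N.
  have : (N <= i)%N by rewrite -lez_nat iE.
  by move=> h; apply: leq_trans h _; rewrite leq_pmulr.
exists (L + i%:Z * j0); rewrite natrM intrD intrM -mulrA.
have -> : d%:R * al = eta + j0%:~R by rewrite /eta subrK.
rewrite ltr_norml; apply/andP; split; lra.
Qed.

(** Dirichlet's pigeonhole yields two multiples of al whose fractional parts differ by less than 1 /
    M < e. A negative step is treated by changing the signs of al and be. *)
Lemma rotation_dense (al be e : R) (N : nat) :
  (forall (k : nat) (j : int), (0 < k)%N -> k%:R * al != j%:~R) -> 0 < e ->
  exists2 n, (N <= n)%N & exists j : int, `|n%:R * al - be - j%:~R| < e.
Proof.
move=> irr e0.
pose M := (Num.bound e^-1).+1.
have M0 : (0 : R) < M%:R by rewrite ltr0n.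
have hM : M%:R^-1 < e.
  rewrite invf_plt ?posrE //; apply: lt_le_trans (archi_boundP _) _.
    by rewrite invr_ge0 ltW.
  by rewrite ler_nat /M.
pose fr (k : nat) : R := k%:R * al - (Num.floor (k%:R * al))%:~R.
have fr01 k : 0 <= fr k < 1.
  rewrite /fr subr_ge0 floor_le /= ltrBlDr.
  by have := floorD1_gt (k%:R * al); rewrite intrD addrC.
pose box (k : 'I_M.+1) : 'I_M := inord (Num.truncn (M%:R * fr k)).
have boxE k : (box k : nat) = Num.truncn (M%:R * fr k).
  rewrite /box /M inordK // -/M truncn_lt_nat; last first.
    by apply: mulr_ge0; [exact: ltW | case/andP: (fr01 k)].
  by rewrite -[ltRHS]mulr1 ltr_pM2l //; case/andP: (fr01 k).
have : ~~ injectiveb box.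
  apply/negP => /injectiveP /leq_card; rewrite !card_ord ltnn //.
case/injectivePn => k1 [k2 ne eb].
wlog lt : k1 k2 ne eb / (k1 < k2)%N.
  move=> W; case: (ltngtP k1 k2) => h; first exact: (W k1 k2).
    by apply: (W k2 k1) => //; rewrite eq_sym.
  by case/eqP: ne; apply: val_inj.
have close : `|fr k2 - fr k1| < M%:R^-1.
  have tr k : (box k)%:R <= M%:R * fr k < (box k)%:R + 1.
    rewrite boxE; have := truncn_itv (x := M%:R * fr k).
    by rewrite natr1; apply; apply: mulr_ge0; [exact: ltW | case/andP: (fr01 k)].
  have := tr k1; have := tr k2; rewrite eb => /andP[a1 a2] /andP[b1 b2].
  rewrite -(ltr_pM2l M0) mulfV ?gt_eqF // -{1}(gtr0_norm M0) -normrM ltr_norml.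
  apply/andP; split; rewrite mulrBr; lra.
pose d := (k2 - k1)%N.
have d0 : (0 < d)%N by rewrite subn_gt0.
pose j0 : int := Num.floor (k2%:R * al) - Num.floor (k1%:R * al).
have etaE : d%:R * al - j0%:~R = fr k2 - fr k1.
  by rewrite /d /j0 /fr natrB ?(ltnW lt) // intrB; ring.
have eta_neq0 : d%:R * al - j0%:~R != 0 by rewrite subr_eq0 irr.
have [h|h|h] := ltgtP (d%:R * al - j0%:~R) 0.
- have [//|n Nn [j hj]] := @rotation_core (- al) (- be) e d N (- j0) d0.
    rewrite intrN mulrN -opprD oppr_gt0 h /= etaE.
    by apply: le_lt_trans (lt_trans close hM); rewrite -normrN ler_norm.
  exists n => //; exists (- j); rewrite intrN -normrN.
  by move: hj; congr (`|_| < _); ring.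
- apply: (@rotation_core al be e d N j0 d0); rewrite h /= etaE.
  by apply: le_lt_trans (lt_trans close hM); rewrite ler_norm.
by rewrite h eqxx in eta_neq0.
Qed.

Lemma cos_int_period (x : R) (j : int) : cos (x + j%:~R * (pi *+ 2)) = cos x.
Proof.
have pn (n : nat) (y : R) : cos (y + n%:R * (pi *+ 2)) = cos y.
  elim: n y => [|n IH] y; first by rewrite mul0r addr0.
  by rewrite -natr1 mulrDl mul1r addrA cosD2pi IH.
case: j => n; first exact: pn.
by rewrite NegzE intrN -[RHS](pn n.+1) mulNr -{2}(subrK (n.+1%:R * (pi *+ 2)) x) pn // -addrA.
Qed.

Lemma cos_near1 (e : R) : 0 < e -> exists2 d, 0 < d & forall x, `|x| < d -> 1 - e < cos x.
Proof.
move=> e0; have c0 : cos x @[x --> (0 : R)] --> cos (0 : R) by exact: continuous_cos.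
have : \forall x \near (0 : R), 1 - e < cos x.
  by apply: (cvgr_gt _ c0); rewrite cos0 ltrBlDr ltrDl.
case/nbhs_ballP => d /= d0 hd; exists d => // x hx; apply: hd.
by rewrite /ball /= sub0r normrN.
Qed.

Lemma unit_circle_angle (x y : R) : x ^+ 2 + y ^+ 2 = 1 -> exists psi, x = cos psi /\ y = sin psi.
Proof.
move=> h; have hx : -1 <= x <= 1.
  rewrite -ler_norml -(ler_pXn2r (n := 2)) ?nnegrE // expr1n real_normK ?num_real //.
  by rewrite -h lerDl sqr_ge0.
have hc : cos (acos x) = x by rewrite acosK // in_itv.
have hs : sin (acos x) = `|y|.
  by rewrite sin_acos // -h addrAC subrr add0r sqrtr_sqr.
case: (lerP 0 y) => hy; first by exists (acos x); rewrite hc hs ger0_norm.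
by exists (- acos x); rewrite cosN sinN hc hs ltr0_norm // opprK.
Qed.

Lemma cos_rotation_dense (th psi e : R) (N : nat) :
  (forall (k : nat) (j : int), (0 < k)%N -> k%:R * th != j%:~R * (pi *+ 2)) -> 0 < e ->
  exists2 n, (N <= n)%N & 1 - e < cos (n%:R * th - psi).
Proof.
move=> irr e0; have [d d0 hd] := cos_near1 e0.
have p2 : (0 : R) < pi *+ 2 by rewrite pmulrn_lgt0 // pi_gt0.
have p2n : (pi : R) *+ 2 != 0 by rewrite gt_eqF.
have [||n hn [j hj]] := @rotation_dense (th / (pi *+ 2)) (psi / (pi *+ 2)) (d / (pi *+ 2)) N.
- move=> k j k0; apply: contraNneq (irr k j k0) => h.
  by rewrite -h mulrA divfK.
- by rewrite divr_gt0.
exists n => //; rewrite -(cos_int_period _ (- j)); apply: hd.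
have -> : n%:R * th - psi + (- j)%:~R * (pi *+ 2) =
    (n%:R * (th / (pi *+ 2)) - psi / (pi *+ 2) - j%:~R) * (pi *+ 2).
  by rewrite !mulrBl intrN mulNr mulrA !divfK.
by rewrite normrM (gtr0_norm p2) -ltr_pdivlMr.
Qed.

End Density.



Lemma denq_sqrB2 (x : rat) : denq (x ^+ 2 - 2) = denq x ^+ 2.
Proof.
have d0 : denq x != 0 by exact: denq_neq0.
have d0' : (denq x)%:~R != 0 :> rat by rewrite intr_eq0.
have -> : x ^+ 2 - 2 = (numq x ^+ 2 - 2 * denq x ^+ 2)%:~R / (denq x ^+ 2)%:~R.
  rewrite -{1}(divq_num_den x) rmorphB rmorphM /= !rmorphXn /=.
  by field.
rewrite coprimeq_den; last first.
  have c : coprimez (denq x ^+ 2) (numq x ^+ 2).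
    by rewrite coprimezXl // coprimezXr // coprimez_sym coprimezE coprime_num_den.
  rewrite -coprimezE coprimez_sym /coprimez addrC -mulNr gcdzMDl.
  exact: c.
by rewrite expf_eq0 /= (negPf d0) normrX gtr0_norm.
Qed.

(* Doubling the angle squares the denominator of 2 cos, so a rational value of
   2 cos on a rational angle must be an integer. *)
Lemma cos_rational_denq (R : realType) (th : R) (W : rat) :
  2 * cos (th *+ 2) = ratr W -> denq W != 1 ->
  forall (k : nat) (j : int), (0 < k)%N -> k%:R * th != j%:~R * (pi *+ 2).
Proof.
move=> hW dW k j k0; apply/eqP => e.
pose Wn i := iter i (fun x : rat => x ^+ 2 - 2) W.
have WnE i : ratr (Wn i) = 2 * cos ((2 ^ i * 2)%:R * th).
  elim: i => [|i IH]; first by rewrite -[Wn 0]/W -hW expn0 mul1n [_ * th]mulr_natl.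
  rewrite -[Wn i.+1]/(Wn i ^+ 2 - 2) rmorphB rmorphXn /= rmorph_nat IH.
  have -> : (2 ^ i.+1 * 2)%:R * th = ((2 ^ i * 2)%:R * th) *+ 2 by rewrite expnS -mulnA natrM -mulrA mulr_natl.
  rewrite cos_mulr2n.
  by ring.
have dWn i : denq (Wn i) = denq W ^+ (2 ^ i).
  elim: i => [|i IH]; first by rewrite expr1.
  by rewrite -[Wn i.+1]/(Wn i ^+ 2 - 2) denq_sqrB2 IH -exprM expnSr.
have d2 : (1 < denq W)%R by rewrite lt_neqAle eq_sym dW -gtz0_ge1 denq_gt0.
(* If k th were a multiple of 2 pi, W_i would depend only on 2^(i+1) modulo k, so two of W_0, ...,
   W_k would coincide, although their denominators are distinct powers of [denq W]. *)
pose f (i : 'I_k.+1) : 'I_k := Ordinal (ltn_pmod (2 ^ i * 2) k0).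
have : ~~ injectiveb f.
  by apply/negP => /injectiveP /leq_card; rewrite !card_ord ltnn.
case/injectivePn => i [i' ne ei].
wlog lt : i i' ne ei / (i < i')%N.
  move=> Q; case: (ltngtP i i') => h; first exact: (Q i i').
    by apply: (Q i' i) => //; rewrite eq_sym.
  by case/eqP: ne; apply: val_inj.
have {}ei : (2 ^ i * 2 = 2 ^ i' * 2 %[mod k])%N by have := congr1 val ei.
have hle : (2 ^ i * 2 <= 2 ^ i' * 2)%N by rewrite leq_mul2r leq_exp2l // ltnW.
have /dvdnP[l el] : (k %| 2 ^ i' * 2 - 2 ^ i * 2)%N by rewrite -eqn_mod_dvd //; exact/eqP/esym.
have eW : Wn i' = Wn i.
  apply: (fmorph_inj (ratr : {rmorphism rat -> R})); rewrite /= !WnE.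
  have -> : (2 ^ i' * 2)%:R * th = (2 ^ i * 2)%:R * th + (l%:Z * j)%:~R * (pi *+ 2).
    rewrite -(subnK hle) el natrD mulrDl addrC; congr (_ + _).
    by rewrite natrM -mulrA e mulrA intrM.
  by rewrite cos_int_period.
have inj : injective (GRing.exp (denq W)).
  by apply: ieexprIn; rewrite ?(lt_trans ltr01) // gt_eqF.
have := congr1 denq eW; rewrite !dWn => /inj/eqP.
by rewrite eqn_exp2l // gtn_eqF.
Qed.

(** * Solutions of y(n+2) = t y(n+1) - y(n) *)

Section LinearRecurrence.
Variable R : realType.
Variables (t : R) (y : nat -> R).
Hypothesis rec : forall n, y n.+2 = t * y n.+1 - y n.

(** The conserved quadratic form of the recurrence; for y n = A cos(n theta - psi) and t = 2 cos
    theta it equals A^2 sin^2 theta. *)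
Definition energy := y 1%N ^+ 2 - t * y 0%N * y 1%N + y 0%N ^+ 2.

Lemma energyE n : y n.+1 ^+ 2 - t * y n * y n.+1 + y n ^+ 2 = energy.
Proof. by elim: n => // n <-; rewrite rec; ring. Qed.

Lemma harmonic : `|t| < 2 -> 0 < energy ->
  exists th psi A, [/\ t = 2 * cos th, 0 < A, A ^+ 2 = energy / (1 - t ^+ 2 / 4)
     & forall n, y n = A * cos (n%:R * th - psi)].
Proof.
move=> t2 e0; move: (t2); rewrite ltr_norml => /andP[t2a t2b].
have ht : -1 < t / 2 < 1 by apply/andP; split; lra.
have htw : -1 <= t / 2 <= 1 by case/andP: ht => ? ?; rewrite !ltW.
pose th := acos (t / 2).
have cth : cos th = t / 2 by rewrite acosK // in_itv.
have D0 : 0 < 1 - t ^+ 2 / 4 by nra.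
have sth2 : sin th ^+ 2 = 1 - t ^+ 2 / 4 by rewrite sin2cos2 cth; field.
have sth : sin th != 0 by rewrite -sqrf_eq0 sth2 gt_eqF.
pose u := (y 1%N - cos th * y 0%N) / sin th.
have yE n : y n = y 0%N * cos (n%:R * th) + u * sin (n%:R * th) /\
   y n.+1 = y 0%N * cos (n.+1%:R * th) + u * sin (n.+1%:R * th).
  elim: n => [|n [IH1 IH2]].
    rewrite !mul0r !mul1r cos0 sin0 mulr0 mulr1 addr0; split => //.
    by rewrite /u divfK //; ring.
  split => //; rewrite rec IH1 IH2.
  have -> : n.+2%:R * th = n.+1%:R * th + th by rewrite -natr1; ring.
  have -> : n%:R * th = n.+1%:R * th - th by rewrite -natr1; ring.
  rewrite cosB sinB cosD sinD.
  have -> : t = 2 * cos th by rewrite cth; field.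
  by ring.
pose A2 := energy / (1 - t ^+ 2 / 4).
have A20 : 0 < A2 by rewrite divr_gt0.
have A2E : y 0%N ^+ 2 + u ^+ 2 = A2.
  rewrite /u exprMn exprVn sth2 /A2 /energy cth; field.
  by rewrite (_ : 4 - t ^+ 2 = 4 * (1 - t ^+ 2 / 4)) ?mulf_neq0 ?gt_eqF //; field.
clearbody u; pose A := Num.sqrt A2.
have A0 : 0 < A by rewrite sqrtr_gt0.
have AA : A ^+ 2 = A2 by rewrite sqr_sqrtr // ltW.
have [|psi [h1 h2]] := @unit_circle_angle R (y 0%N / A) (u / A).
  by rewrite !exprMn -mulrDl A2E exprVn AA mulfV // gt_eqF.
exists th, psi, A; split => //; first by rewrite cth; field.
move=> n; rewrite (yE n).1 cosB -h1 -h2; field.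
by rewrite gt_eqF.
Qed.

(** With t = 2 cos theta these values make theta a multiple of pi/4 or pi/6, so 12 theta is a
    multiple of pi. Steps of two in the index involve only t^2 - 2 = 2 cos(2 theta). *)
Lemma periodic12 : t ^+ 2 \in [:: 0; 1; 2; 3] -> forall n, `|y (n + 12)%N| = `|y n|.
Proof.
move=> ht n.
have z k : y (k + 4)%N = (t ^+ 2 - 2) * y (k + 2)%N - y k.
  by rewrite !addnS addn0 !rec; ring.
have e12 : y (n + 12)%N = (t ^+ 2 - 2) * y (n + 10)%N - y (n + 8)%N.
  by have := z (n + 8)%N; rewrite -!addnA.
have e10 : y (n + 10)%N = (t ^+ 2 - 2) * y (n + 8)%N - y (n + 6)%N.
  by have := z (n + 6)%N; rewrite -!addnA.
have e8 : y (n + 8)%N = (t ^+ 2 - 2) * y (n + 6)%N - y (n + 4)%N.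
  by have := z (n + 4)%N; rewrite -!addnA.
have e6 : y (n + 6)%N = (t ^+ 2 - 2) * y (n + 4)%N - y (n + 2)%N.
  by have := z (n + 2)%N; rewrite -!addnA.
move: ht; rewrite !inE => /or4P[] /eqP h.
- have t0 : t = 0 by apply/eqP; rewrite -sqrf_eq0 h.
  have r k : y (k + 2)%N = - y k by rewrite addn2 rec t0 mul0r add0r.
  have -> : (n + 12 = n + 2 + 2 + 2 + 2 + 2 + 2)%N by rewrite -!addnA.
  by rewrite !r !opprK.
- by rewrite e12 e10 e8 e6 (z n) h; congr (`|_|); ring.
- by rewrite e12 e10 e8 e6 (z n) h -[RHS]normrN; congr (`|_|); ring.
by rewrite e12 e10 e8 e6 (z n) h; congr (`|_|); ring.
Qed.

(** For t >= 2 the increments do not decrease as long as y is positive, so y grows at least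
    linearly. *)
Lemma growth n0 : 2 <= t -> 0 < y n0.+1 -> y n0 < y n0.+1 ->
  forall N, exists2 n, (N <= n)%N & 1 < y n.
Proof.
move=> t2 y0 ylt N; pose d := y n0.+1 - y n0; have d0 : 0 < d by rewrite subr_gt0.
have h k : y n0.+1 + k%:R * d <= y (n0.+1 + k)%N /\ d <= y (n0.+1 + k)%N - y (n0 + k)%N.
  elim: k => [|k [IH1 IH2]]; first by rewrite mul0r addr0 !addn0.
  rewrite !addSn !addnS rec -!addSn.
  have pos : 0 < y (n0.+1 + k)%N.
    by apply: lt_le_trans IH1; rewrite ltr_pwDl // mulr_ge0 // ltW.
  have : 0 <= (t - 2) * y (n0.+1 + k)%N by rewrite mulr_ge0 ?subr_ge0 // ltW.
  by rewrite -natr1 => h; split; lra.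
pose k := (Num.bound d^-1 + N)%N.
have hk : 1 < k%:R * d.
  rewrite -ltr_pdivrMr // div1r; apply: lt_le_trans (archi_boundP _) _.
    by rewrite invr_ge0 ltW.
  by rewrite ler_nat /k leq_addr.
exists (n0.+1 + k)%N; first by rewrite /k; lia.
by case: (h k) => h1 _; lra.
Qed.

End LinearRecurrence.

(** * The normalised Mertens sequence *)

Section Numeric.
Variable R : realType.
Variables (q : nat) (a : int).
Hypotheses (q1 : (1 < q)%N) (aq : a <= q%:Z).
Local Notation s := (Num.sqrt (q%:R : R)).
Local Notation t := (a%:~R / s).

(** The exponent is [n.+1] because [mseq q a n] stands for M(n + 1). *)
Definition mnorm (n : nat) : R := (mseq q a n)%:~R / s ^+ n.+1.
Local Notation y := mnorm.

Let q0 : (0 : R) < q%:R. Proof. by rewrite ltr0n ltnW. Qed.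
Let s0 : 0 < s. Proof. by rewrite sqrtr_gt0. Qed.
Let sn : s != 0. Proof. by rewrite gt_eqF. Qed.
Let ss : s ^+ 2 = q%:R. Proof. by rewrite sqr_sqrtr // ltW. Qed.
Let s1 : 1 < s.
Proof. by rewrite -(ltr_pXn2r (n := 2)) ?nnegrE ?ltW // ss expr1n ltr1n. Qed.

Lemma mnorm0 : y 0 = s^-1.
Proof. by rewrite /mnorm /= expr1 mul1r. Qed.

Lemma mnorm1 : y 1 = t / s - 1.
Proof.
rewrite /mnorm -[mseq _ _ _]/(a - q%:Z) intrB.
have -> : (q%:Z)%:~R = s ^+ 2 :> R by rewrite ss.
by field.
Qed.

Lemma mnormSS n : y n.+2 = t * y n.+1 - y n.
Proof.
rewrite /mnorm mseqSS intrB !intrM !exprS.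
have -> : (q%:Z)%:~R = s ^+ 2 :> R by rewrite ss.
have : s ^+ n != 0 by rewrite expf_neq0.
move: (s ^+ n) => z z0; field.
by rewrite sn z0.
Qed.

Lemma mnorm_energy : energy t y = (q%:R + 1 - a%:~R) / q%:R.
Proof.
rewrite /energy mnorm0 mnorm1.
have : (q%:R : R) = s ^+ 2 by rewrite ss.
by move: sn; set w := s; clearbody w => w0 ->; field.
Qed.

Lemma mnorm_energy_gt0 : 0 < energy t y.
Proof.
rewrite mnorm_energy divr_gt0 //.
have : (a%:~R : R) <= q%:R by rewrite -[q%:R]/((q%:Z)%:~R) ler_int.
lra.
Qed.

Lemma tsqr : t ^+ 2 = (a ^+ 2)%:~R / q%:R.
Proof. by rewrite exprMn exprVn ss rmorphXn. Qed.

(** Doubling the angle removes the square root of q: 2 cos(2 theta) = a^2 / q - 2 is rational, and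
    not an integer unless q divides a^2. *)
Lemma mnorm_dense N e : ~~ (q%:Z %| a ^+ 2)%Z -> `|t| < 2 -> 0 < e ->
  exists2 n, (N <= n)%N &
    Num.sqrt (energy t y / (1 - t ^+ 2 / 4)) * (1 - e) < y n.
Proof.
move=> ndv t2 e0.
have [th [psi [A [tE A0 AA yE]]]] := harmonic mnormSS t2 mnorm_energy_gt0.
pose W : rat := (a ^+ 2)%:~R / q%:R - 2.
have hW : 2 * cos (th *+ 2) = ratr W.
  rewrite /W rmorphB rmorphM fmorphV /= !rmorph_nat rmorph_int -tsqr tE cos_mulr2n.
  by ring.
have dW : denq W != 1.
  apply: contraNneq ndv => d1.
  have eW : W = (numq W)%:~R by rewrite -[LHS]divq_num_den d1 divr1.
  have qr : (q%:R : rat) != 0 by rewrite pnatr_eq0 -lt0n ltnW.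
  have : (a ^+ 2)%:~R = ((numq W + 2) * q%:Z)%:~R :> rat.
    by rewrite intrM intrD -eW /W subrK divfK.
  by move/intr_inj => ->; exact: dvdz_mull.
have [n hn hc] := cos_rotation_dense psi N (cos_rational_denq hW dW) e0.
by exists n => //; rewrite -AA sqrtr_sqr gtr0_norm // yE ltr_pM2l.
Qed.

(** Here |t| >= 2. The growth applies after alternating the signs when t < 0, and to -y when t > 0,
    because y 1 = a / q - 1 is at most 0. *)
Lemma mnorm_gt1_large N : 4 * q%:Z <= a ^+ 2 -> exists2 n, (N <= n)%N & 1 < `|y n|.
Proof.
move=> h.
have t4 : 4 <= t ^+ 2.
  by rewrite tsqr ler_pdivlMr // -[q%:R]/((q%:Z)%:~R) -[4]/((4 : int)%:~R) -intrM ler_int.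
have aqR : (a%:~R : R) <= q%:R by rewrite -[q%:R]/((q%:Z)%:~R) ler_int.
have si0 : 0 < s^-1 by rewrite invr_gt0.
have si1 : s^-1 < 1 by rewrite invf_lt1.
have [tneg|tpos] := ltP t 0.
  pose z n : R := (-1) ^+ n * y n.
  have zr n : z n.+2 = (- t) * z n.+1 - z n by rewrite /z mnormSS !exprS; ring.
  have t2 : 2 <= - t by nra.
  have z1 : z 1%N = 1 - t / s by rewrite /z mnorm1 expr1; ring.
  have z0 : z 0%N = s^-1 by rewrite /z mnorm0 mul1r.
  have p : 0 < - t * s^-1 by rewrite mulr_gt0 // oppr_gt0.
  have [||n hn hz] := @growth R (- t) z zr 0%N t2 _ _ N.
  - by rewrite z1; lra.
  - by rewrite z1 z0; lra.
  exists n => //; apply: lt_le_trans hz _; apply: le_trans (ler_norm _) _.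
  by rewrite /z normrM normrX normrN1 expr1n mul1r.
have t2 : 2 <= t by nra.
pose z n : R := - y n.
have zr n : z n.+2 = t * z n.+1 - z n by rewrite /z mnormSS; ring.
have z1 : z 1%N = 1 - t / s by rewrite /z mnorm1; ring.
have z0 : z 0%N = - s^-1 by rewrite /z mnorm0.
have ts : t <= s by rewrite ler_pdivrMr // -expr2 ss.
have tss : t / s <= 1 by rewrite ler_pdivrMr // mul1r.
(* When a = q the term z 1 vanishes, and the growth starts one index later. *)
have [n0 hz hzlt] : exists2 n0, 0 < z n0.+1 & z n0 < z n0.+1.
  have [e|ne] := eqVneq (t / s) 1; last first.
    exists 0%N; first by rewrite z1 subr_gt0 lt_neqAle ne.
    rewrite z1 z0; lra.
  exists 1%N; rewrite zr z1 z0 e subrr mulr0 sub0r opprK //.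
have [n hn hz'] := growth zr t2 hz hzlt N.
by exists n => //; apply: lt_le_trans hz' _; rewrite -normrN ler_norm.
Qed.

Lemma abs_lt2 : a ^+ 2 < 4 * q%:Z -> `|t| < 2.
Proof.
move=> h; rewrite -(ltr_pXn2r (n := 2)) ?nnegrE // real_normK ?num_real // tsqr.
rewrite ltr_pdivrMr // -[q%:R]/((q%:Z)%:~R) -natrX -[(2 ^ 2)%:R]/((4 : int)%:~R) -intrM.
by rewrite ltr_int.
Qed.

(** The squared amplitude exceeds 1 because 4 (q + 1 - a) - (4 q - a^2) = (a - 2)^2. *)
Lemma amp_gt1 : a ^+ 2 < 4 * q%:Z -> a != 2 -> 1 < energy t y / (1 - t ^+ 2 / 4).
Proof.
move=> h a2; have := abs_lt2 h; rewrite ltr_norml => /andP[h1 h2].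
have D0 : 0 < 1 - t ^+ 2 / 4 by nra.
rewrite ltr_pdivlMr // mul1r mnorm_energy tsqr ltr_pdivlMr // mulrBl mul1r.
rewrite mulrAC divfK; last by rewrite gt_eqF.
have : 0 < (a%:~R - 2 : R) ^+ 2.
  rewrite lt_neqAle sqr_ge0 andbT eq_sym sqrf_eq0 subr_eq0.
  by rewrite -[2]/((2 : int)%:~R) eqr_int.
rewrite rmorphXn /=; nra.
Qed.

Lemma mseq_periodic12 j : a ^+ 2 = j%:Z * q%:Z -> (j < 4)%N ->
  forall k n, `|y (k + n * 12)| = `|y k|.
Proof.
move=> e j4 k n.
have ht : t ^+ 2 \in [:: 0; 1; 2; 3].
  rewrite tsqr e intrM mulfK ?gt_eqF //.
  by case: j j4 {e} => [|[|[|[|]]]] // _; rewrite !inE eqxx ?orbT.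
elim: n => [|n IH]; first by rewrite addn0.
by rewrite mulSn [(12 + _)%N]addnC addnA (periodic12 mnormSS ht).
Qed.

Lemma mnorm_large_periodic j k N : a ^+ 2 = j%:Z * q%:Z -> (j < 4)%N ->
  exists2 n, (N <= n)%N & `|y n| = `|y k|.
Proof.
move=> e j4; exists (k + N * 12)%N; first by lia.
exact: mseq_periodic12 e j4 k N.
Qed.

(** When a^2 = j q, every value recurs beyond n0, so the bound extends to the initial terms: y 1
    gives a >= 0, and y 2 and y 4 exclude j = 2 and j = 3. *)
Theorem mnorm_bounded_cases n0 : (forall n, (n0 <= n)%N -> `|y n| <= 1) ->
  [\/ a = 0, a = 2 | a%:~R = s].
Proof.
move=> hb.
have [h4|h4] := leP (4 * q%:Z) (a ^+ 2).
  have [n hn] := mnorm_gt1_large n0 h4.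
  by rewrite ltNge hb.
have [/eqP a2|a2] := boolP (a == 2); first by constructor 2.
have [dv|ndv] := boolP (q%:Z %| a ^+ 2)%Z; last first.
  have t2 := abs_lt2 h4; have A1 := amp_gt1 h4 a2.
  set A := Num.sqrt (energy t y / (1 - t ^+ 2 / 4)).
  have hA : 1 < A by rewrite -[1]sqrtr1 ltr_sqrt // (lt_trans _ A1).
  have e0 : 0 < 1 - A^-1 by rewrite subr_gt0 invf_lt1 // (lt_trans _ hA).
  have [n hn] := mnorm_dense n0 ndv t2 e0.
  rewrite -/A opprB addrCA subrr addr0 mulfV ?gt_eqF ?(lt_trans _ hA) // => h.
  have := hb n hn; rewrite leNgt => /negP[]; apply: lt_le_trans h _; exact: ler_norm.
have [j ej] : exists j : nat, a ^+ 2 = j%:Z * q%:Z.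
  case/dvdzP: dv => c ec; exists `|c|%N; rewrite gez0_abs //.
  have : 0 <= c * q%:Z by rewrite -ec sqr_ge0.
  by rewrite pmulr_lge0 // ltz_nat ltnW.
have j4 : (j < 4)%N.
  by move: h4; rewrite ej ltr_pM2r ?ltz_nat // ltnW.
have ub k : `|y k| <= 1.
  by have [n hn <-] := mnorm_large_periodic k n0 ej j4; exact: hb.
have ejR : (a%:~R : R) ^+ 2 = j%:R * s ^+ 2.
  by rewrite ss -rmorphXn /= ej intrM.
have a_ge0 : 0 <= a.
  rewrite -(ler0z R).
  have := ub 1%N; rewrite mnorm1 ler_norml => /andP[h _].
  have {h} : 0 <= t / s by lra.
  by rewrite !pmulr_lge0 ?invr_gt0.
have y2 : y 2%N = s^-1 * (1 - a%:~R) + s^-1 * (t ^+ 2 - 2).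
  by rewrite mnormSS mnorm1 mnorm0; field.
have y4 : y 4%N = s^-1 * ((t ^+ 2) ^+ 2 - 3 * t ^+ 2 + 1 + a%:~R * (2 - t ^+ 2)).
  by rewrite !mnormSS mnorm1 mnorm0; field.
have tj : t ^+ 2 = j%:R by rewrite exprMn exprVn ejR mulfK // expf_neq0.
have small (c : R) : `|s^-1 * c| <= 1 -> c ^+ 2 <= s ^+ 2.
  rewrite normrM gtr0_norm ?invr_gt0 // mulrC ler_pdivrMr // mul1r => h.
  by rewrite -(real_normK (num_real c)) ler_pXn2r ?nnegrE ?normr_ge0 ?sqrtr_ge0.
case: j ej j4 ejR tj => [|[|[|[|j]]]] // ej _ ejR tj.
- by constructor 1; apply/eqP; rewrite -sqrf_eq0 ej mul0r.
- constructor 3; apply/eqP; rewrite -(eqrXn2 (n := 2)) ?ler0z ?sqrtr_ge0 //.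
  by rewrite ejR mul1r.
(* For j = 2, y 2 = (1 - a) / s, so (a - 1)^2 <= q = a^2 / 2 and a <= 3. *)
- exfalso; have := ub 2%N; rewrite y2 tj -mulrDr subrr addr0 => /small.
  rewrite ss -[q%:R]/((q%:Z)%:~R) -[1]/((1 : int)%:~R) -intrB -rmorphXn /= ler_int.
  move: ej; rewrite expr2 => ej h; have hq1 := q1.
  have a3 : a <= 3 by nia.
  clear -a2 a_ge0 a3 ej hq1; move: a2 a_ge0 a3 ej; case: a => // -[|[|[|[|n]]]] //=; lia.
(* For j = 3, y 4 = (1 - a) / s, so (a - 1)^2 <= q = a^2 / 3 and a <= 2. *)
exfalso; have := ub 4%N; rewrite y4 tj.
have -> : 3%:R ^+ 2 - 3 * 3%:R + 1 + a%:~R * (2 - 3%:R) = 1 - a%:~R :> R by ring.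
move/small.
rewrite ss -[q%:R]/((q%:Z)%:~R) -[1]/((1 : int)%:~R) -intrB -rmorphXn /= ler_int.
move: ej; rewrite expr2 => ej h; have hq1 := q1.
have a2' : a <= 2 by nia.
clear -a_ge0 a2' ej hq1; move: a_ge0 a2' ej; case: a => // -[|[|[|n]]] //=; lia.
Qed.

(** For a = 0 and a = s the sequence changes sign after 2 and 3 steps and takes the value -1. For a
    = 2 the amplitude is exactly 1, and it is approached by density unless q divides 4. *)
Theorem mnorm_cases_bounded : [\/ a = 0, a = 2 | a%:~R = s] ->
  (forall n, `|y n| <= 1) /\
  (forall e N, 0 < e -> exists2 n, (N <= n)%N & 1 - e < `|y n|).
Proof.
have si1 : s^-1 < 1 by rewrite invf_lt1.
have si0 : 0 < s^-1 by rewrite invr_gt0.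
have fromper (j k : nat) : a ^+ 2 = j%:Z * q%:Z -> (j < 4)%N -> `|y k| = 1 ->
    forall e N, 0 < e -> exists2 n, (N <= n)%N & 1 - e < `|y n|.
  move=> ej j4 hk e N e0; have [n hn hy] := mnorm_large_periodic k N ej j4.
  by exists n => //; rewrite hy hk ltrBlDr ltrDl.
have case_s : a%:~R = s -> (forall n, `|y n| <= 1) /\
   (forall e N, 0 < e -> exists2 n, (N <= n)%N & 1 - e < `|y n|).
  move=> hs; have t1 : t = 1 by rewrite hs mulfV.
  have y2 : y 2%N = -1 by rewrite mnormSS mnorm1 mnorm0 t1; ring.
  have ej : a ^+ 2 = 1%:Z * q%:Z.
    by apply: (intr_inj (R := R)); rewrite rmorphXn /= hs ss mul1r.
  split; last by apply: (fromper 1%N 2%N) => //; rewrite y2 normrN1.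
  have y3 n : y n.+3 = - y n by rewrite mnormSS mnormSS t1; ring.
  elim/ltn_ind => -[|[|[|n]]] IH.
  - by rewrite mnorm0 gtr0_norm // ltW.
  - by rewrite mnorm1 t1 div1r ler_norml; apply/andP; split; lra.
  - by rewrite y2 normrN1.
  by rewrite y3 normrN IH // !ltnS ltnW.
case => [a0|a2|]; last exact: case_s.
- have t0 : t = 0 by rewrite a0 mul0r.
  have y1 : y 1%N = -1 by rewrite mnorm1 t0; ring.
  split; last first.
    by apply: (fromper 0%N 1%N) => //; rewrite ?a0 ?y1 ?normrN1 // mul0r expr0n.
  have y3 n : y n.+2 = - y n by rewrite mnormSS t0; ring.
  elim/ltn_ind => -[|[|n]] IH.
  - by rewrite mnorm0 gtr0_norm // ltW.
  - by rewrite y1 normrN1.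
  by rewrite y3 normrN IH // ltnS.
have t2 : t ^+ 2 = 4 / q%:R by rewrite tsqr a2.
have D0 : 0 < 1 - t ^+ 2 / 4.
  by rewrite t2 mulrAC mulfV ?mul1r // subr_gt0 invf_lt1 // ltr1n.
have eD : energy t y = 1 - t ^+ 2 / 4.
  by rewrite mnorm_energy t2 a2 -[2%:~R]/(2%:R : R); field; rewrite gt_eqF.
split.
  move=> n; have := energyE mnormSS n; rewrite eD => h.
  rewrite -(ler_pXn2r (n := 2)) ?nnegrE // expr1n real_normK ?num_real //.
  rewrite -(ler_pM2l D0) mulr1 -{2}h.
  (* Completing the square: the energy is (y(n+1) - t y(n) / 2)^2 + (1 - t^2 / 4) y(n)^2. *)
  have := sqr_ge0 (y n.+1 - t / 2 * y n).
  nra.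
have [dv|ndv] := boolP (q%:Z %| a ^+ 2)%Z; last first.
  move=> e N e0; have h4 : a ^+ 2 < 4 * q%:Z by rewrite a2; lia.
  have [n hn h] := mnorm_dense N ndv (abs_lt2 h4) e0.
  exists n => //; move: h; rewrite eD mulfV ?gt_eqF // sqrtr1 mul1r => h.
  by apply: lt_le_trans h _; exact: ler_norm.
have : (q %| 4)%N by move: dv; rewrite a2.
move=> /(dvdn_leq (isT : 0 < 4)%N) q4.
(* For q = 2 the value -1 occurs at index 3; for q = 4 the trace 2 is the square root of q. *)
have : [\/ q = 2%N, q = 3%N | q = 4%N].
  by move: q1 q4; case: q => [|[|[|[|[|]]]]] // _ _; constructor.
case=> eq.
- apply: (fromper 2%N 3%N) => //; first by rewrite a2 eq.
  suff -> : y 3%N = -1 by rewrite normrN1.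
  rewrite !mnormSS mnorm1 mnorm0 a2 -[2%:~R]/(2%:R : R).
  have : s ^+ 2 = 2 by rewrite ss eq.
  move: sn; set w := s; clearbody w => w0 w2.
  transitivity (8 / (w ^+ 2) ^+ 2 - 8 / w ^+ 2 + 1); first by field.
  by rewrite w2; lra.
- by move: dv; rewrite a2 eq.
have e4 : (4%:R : R) = 2%:R ^+ 2 by rewrite -natrX.
have hs : a%:~R = s by rewrite a2 eq e4 sqrtr_sqr ger0_norm.
by case: (case_s hs).
Qed.


End Numeric.

(** * Traces attained by elliptic curves *)

Section MertensConditions.
Variables (R : realType) (F : finFieldType) (p m : nat).
Hypotheses (hp : p \in [pchar F]) (hq : #|F| = (p ^ m)%N).
Variables (K : closedFieldType) (iota : {rmorphism F -> K}).
Hypothesis hK : integralRange iota.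
Variable E : elliptic_curve F.
Local Notation q := #|F|.
Local Notation a := (ec_trace E).

Let pr : prime p. Proof. exact: pcharf_prime hp. Qed.
Let hpK : p \in [pchar K]. Proof. by rewrite (fmorph_pchar iota). Qed.
Let q1 : (1 < q)%N. Proof. exact: q_gt1 F. Qed.
Let m_gt0 : (0 < m)%N. Proof. exact: exponent_gt0 hq. Qed.

Lemma ec_trace_le : a <= q%:Z.
Proof. by rewrite /ec_trace card_on_curve; move: #|F| (\sum_x _)%N => u v; clear; lia. Qed.

Lemma sqrt_powR X : (q%:R : R) `^ (X%:R / 2%:R) = Num.sqrt q%:R ^+ X.
Proof. by rewrite mulrC powRrM powR12_sqrt // powR_mulrn ?sqrtr_ge0. Qed.

Let sX n : 0 < Num.sqrt q%:R ^+ n :> R.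
Proof. by rewrite exprn_gt0 // sqrtr_gt0 ltr0n ltnW. Qed.

Lemma ec_mertens_norm n : `|(ec_mertens iota E n.+1)%:~R : R| =
  `|mnorm R q a n| * Num.sqrt q%:R ^+ n.+1.
Proof.
rewrite (ec_mertens_mseq hp hq hK) /mnorm normrM normrV ?unitfE ?gt_eqF //.
by rewrite (gtr0_norm (sX n.+1)) divfK // gt_eqF.
Qed.

Lemma mertens_boundE n : mertens_bound R iota E n.+1 <-> `|mnorm R q a n| <= 1.
Proof.
by rewrite /mertens_bound sqrt_powR ec_mertens_norm -[X in _ <= X]mul1r ler_pM2r.
Qed.

Lemma mertens_conjecture_cases :
  mertens_conjecture R iota E -> [\/ a = 0, a = 2 | a%:~R = Num.sqrt (q%:R : R)].
Proof.
case=> n0 _ h; apply: (@mnorm_bounded_cases R q a q1 ec_trace_le n0) => n hn.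
by apply/mertens_boundE/h => /=; exact: leq_trans hn _.
Qed.

Lemma short_count : odd p -> p != 3%N -> ~~ odd m -> (p%:Z %| a)%Z ->
  (p = 1 %[mod 4] -> a <> 0) /\ (p = 1 %[mod 3] -> ~~ odd #|on_curve idfun E|).
Proof.
move=> p2 p3 me pa; have [s [us ms ss]] := rational_points_short hp hq iota E p2 p3.
have s1 : (size s)%:R = 1 :> K.
  have -> : (size s)%:R = (q%:Z + 1 - a)%:~R :> K.
    by rewrite /ec_trace ss subKr.
  case/dvdzP: pa => b ->.
  rewrite rmorphB rmorphD rmorphM /= -!pmulrn hq natrX (pcharf0 hpK) mulr0 subr0.
  by rewrite expr0n gtn_eqF // add0r.
split=> [p4 a0|p31].
  apply: (supersingular_1mod4 hK p2 p3 us ms me s1 p4).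
  by move: a0; rewrite ss /ec_trace; move: #|F| #|on_curve _ _| => u v; clear; lia.
by rewrite -ss; have := supersingular_1mod3 hK p2 p3 us ms me s1 p31.
Qed.

(** In characteristic 2 only q = 2 and q = 4 remain; in the latter case 2 is the square root of q,
    which is the second condition. *)
Lemma trace2_cond : a = 2 -> mertens_cond1 p m a \/ mertens_cond2 R p m a.
Proof.
move=> a2; have [p2|/eqP p2] := eqVneq p 2%N; last by left; split; [|left].
have h2 : 2%N \in [pchar F] by rewrite -p2.
have hq2 : #|F| = (2 ^ m)%N by rewrite hq p2.
have := trace2_char2 h2 hq2 a2; case: (m) m_gt0 => [|[|[|n]]] // _ _; first by left; split; [|right].
right; split=> //; last by rewrite p2.
by rewrite a2 p2 -[(2 ^ 2)%N%:R]/(4%:R) (_ : 4%:R = 2%:R ^+ 2) ?sqrtr_sqr ?ger0_norm // -natrX.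
Qed.

Lemma trace0_cond : a = 0 -> mertens_cond3 p m a.
Proof.
move=> a0; split=> //; case: (boolP (odd m)) => me; [by right | left; split=> // p4].
have p3 : p != 3%N by apply/eqP => h; rewrite h in p4.
have p2 : odd p by case: (even_prime pr) => // h; rewrite h in p4.
have pa : (p%:Z %| a)%Z by rewrite a0 dvdz0.
by have [/(_ p4)] := short_count p2 p3 me pa.
Qed.

(** For odd p both a and q are odd, so #E = q + 1 - a is odd, whereas p = 1 mod 3 would make it
    even. *)
Lemma trace_sqrt_cond : a%:~R = Num.sqrt (q%:R : R) -> mertens_cond2 R p m a.
Proof.
move=> as_.
have a_ge0 : 0 <= a by rewrite -(ler0z R) as_ sqrtr_ge0.
have a2 : (`|a| ^ 2)%N = (p ^ m)%N.
  apply/eqP; rewrite -(eqr_nat R) -hq natrX -[q%:R]sqr_sqrtr ?ler0n // -as_.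
  by rewrite -[X in X%:~R ^+ 2](gez0_abs a_ge0).
have mE : m = (2 * logn p `|a|)%N by rewrite -lognX a2 pfactorK.
have me : ~~ odd m by rewrite mE oddM.
split=> //; first by rewrite -hq.
move=> p31.
have p3 : p != 3%N by apply/eqP => h; rewrite h in p31.
have p2 : odd p by case: (even_prime pr) => // h; rewrite h in p31.
have pa : (p %| `|a|)%N.
  have : (p %| `|a| ^ 2)%N by rewrite a2 dvdn_exp.
  by rewrite Euclid_dvdX // => /andP[].
have [_ /(_ p31)] := short_count p2 p3 me pa.
have oa : odd `|a| by have := congr1 odd a2; rewrite !oddX p2 orbT /= => ->.
have oq : odd q by rewrite hq oddX p2 orbT.
move: oa oq; rewrite /ec_trace; move: #|F| #|on_curve _ _| => u v; clear; lia.
Qed.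

(** The restrictions on p and m hold automatically for the trace of a curve that has one of the
    three values. *)
Lemma cond_cases : [\/ mertens_cond1 p m a, mertens_cond2 R p m a | mertens_cond3 p m a]
  <-> [\/ a = 0, a = 2 | a%:~R = Num.sqrt (q%:R : R)].
Proof.
rewrite hq; split=> [[[]|[]|[]]|].
- by constructor 2.
- by constructor 3.
- by constructor 1.
rewrite -hq => -[/trace0_cond|/trace2_cond[]|/trace_sqrt_cond].
- by constructor 3.
- by constructor 1.
- by constructor 2.
- by constructor 2.
Qed.

(** The values of a overlap only when 2 is the square root of q, that is for q = 4, which the first
    condition excludes by asking m = 1 when p = 2. *)
Lemma cond_exactly_one :
  exactly_one (mertens_cond1 p m a) (mertens_cond2 R p m a) (mertens_cond3 p m a) <->
  [\/ mertens_cond1 p m a, mertens_cond2 R p m a | mertens_cond3 p m a].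
Proof.
have s0 : 0 < Num.sqrt ((p ^ m)%:R : R) by rewrite sqrtr_gt0 ltr0n -hq ltnW.
have n12 : mertens_cond1 p m a -> mertens_cond2 R p m a -> False.
  move=> [a2 h1] [as_ _ _].
  have e4 : (p ^ m)%N = (2 ^ 2)%N.
    apply/eqP; rewrite -(eqr_nat R) -[(p ^ m)%:R]sqr_sqrtr ?ler0n // -as_ a2 natrX.
    by [].
  have p2 : p = 2%N.
    have : (p %| 2 ^ 2)%N by rewrite -e4 dvdn_exp.
    by rewrite Euclid_dvdX // dvdn_prime2 // andbT => /eqP.
  have m2 : m = 2%N by move/eqP: e4; rewrite p2 eqn_exp2l // => /eqP.
  by case: h1 => [/(_ p2)|[]] //; rewrite m2.
have n13 : mertens_cond1 p m a -> mertens_cond3 p m a -> False.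
  by move=> [-> _] [].
have n23 : mertens_cond2 R p m a -> mertens_cond3 p m a -> False.
  by move=> [e _ _] [e' _]; move: s0; rewrite -e e' ltxx.
split=> [[[h _ _]|[_ h _]|[_ _ h]]|[h|h|h]].
- exact: Or31.
- exact: Or32.
- exact: Or33.
- by apply: Or31; split=> // h'; [exact: n12 h h' | exact: n13 h h'].
- by apply: Or32; split=> // h'; [exact: n12 h' h | exact: n23 h h'].
- by apply: Or33; split=> // h'; [exact: n13 h' h | exact: n23 h' h].
Qed.

End MertensConditions.

Lemma unbounded_infinite_set (A : set nat) :
  (forall N, exists2 n, (N <= n)%N & A n) -> infinite_set A.
Proof.
move=> h /finite_seqP[s As]; have [n hn An] := h (\max_(x <- s) x).+1.
have ns : n \in s by move: An; rewrite As.
suff : (n <= \max_(x <- s) x)%N by move: hn; move: (\max_(_ <- _) _)%N; clear; lia.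
exact: (leq_bigmax_seq (F := id)).
Qed.

Theorem theorem1 (R : realType) (F : finFieldType) (p m : nat)
    (hp : p \in [pchar F]) (hq : #|F| = (p ^ m)%N)
    (K : closedFieldType) (iota : {rmorphism F -> K})
    (hK : integralRange iota) (E : elliptic_curve F) :
  (mertens_conjecture R iota E <->
     exactly_one (mertens_cond1 p m (ec_trace E))
                 (mertens_cond2 R p m (ec_trace E))
                 (mertens_cond3 p m (ec_trace E)))
  /\ ([\/ mertens_cond1 p m (ec_trace E),
          mertens_cond2 R p m (ec_trace E)
        | mertens_cond3 p m (ec_trace E)] ->
      (forall X : nat, (1 <= X)%N -> mertens_bound R iota E X)
      /\ (forall eps : R, 0 < eps ->
            infinite_set [set X : nat | (1 <= X)%N /\
              `|(ec_mertens iota E X)%:~R : R|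
                > (1 - eps) * (#|F|%:R : R) `^ (X%:R / 2%:R)])).
Proof.
have bounded : [\/ mertens_cond1 p m (ec_trace E), mertens_cond2 R p m (ec_trace E)
    | mertens_cond3 p m (ec_trace E)] ->
  forall X : nat, (1 <= X)%N -> mertens_bound R iota E X.
  move=> /(cond_cases R hp hq hK E) /(mnorm_cases_bounded (q_gt1 F) (ec_trace_le E))[h _] [|n] // _.
  exact/(mertens_boundE R hp hq hK).
split; [split | move=> h; split=> [|eps eps0]]; last 1 first.
- apply: unbounded_infinite_set => N.
  have [_ /(_ eps N eps0)[n hn hlt]] :=
    mnorm_cases_bounded (q_gt1 F) (ec_trace_le E) (proj1 (cond_cases R hp hq hK E) h).
  exists n.+1; [exact: leqW | split=> //].
  rewrite sqrt_powR (ec_mertens_norm R hp hq hK) ltr_pM2r // exprn_gt0 // sqrtr_gt0 ltr0n.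
  exact: ltnW (q_gt1 F).
- by move/(mertens_conjecture_cases hp hq hK)/(cond_cases R hp hq hK E)/(cond_exactly_one R hp hq).
- move/(cond_exactly_one R hp hq E)/bounded => h.
  by exists 1%N => // X /= hX; apply: h.
- exact: bounded.
Qed.
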